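(* The Heisenberg X-ray transform $I:L^1(\mathbb{H})\to L^1(\mathcal{G},d\mathcal{G})$, $If(z,t,\lambda)=I_\lambda f(z,t)$, is injective. In particular, if $f\in L^1(\mathbb{H})$ and there is $\eta>0$ such that $I_\lambda f=0$ (in $L^1(\mathcal{G}_\lambda)$) for all $\lambda\in(0,\eta)$, then $f=0$ in $L^1(\mathbb{H})$.
   Context: The Heisenberg group is $\mathbb{H}=\mathbb{C}\times\mathbb{R}$ with group law $(x+iy,t)(u+iv,s)=\left(x+u+i(y+v),\,t+s+\tfrac12(xv-yu)\right)$ and Haar measure equal to Lebesgue measure. It carries the left-invariant sub-Riemannian metric for which $X=\partial_x-\tfrac12 y\partial_t$, $Y=\partial_y+\tfrac12 x\partial_t$ are orthonormal. For $\lambda>0$ put $R=1/\lambda$ and $\gamma_\lambda(s)=\left(Re^{is/R},\tfrac12 sR\right)\in\mathbb{H}$, $s\in\mathbb{R}$. The unoriented sub-Riemannian geodesics of charge $\lambda$ (those projecting to circles of radius $1/\lambda$ in $\mathbb{C}$) are exactly the left translates $s\mapsto(z,t)\gamma_\lambda(s)$, $(z,t)\in\mathbb{H}$; negative charges give the same unoriented curves, and the straight-line geodesics of charge $0$ are disregarded. The stabilizer of $\gamma_\lambda$ is the central discrete subgroup $\Gamma_\lambda=\{(0,k\pi R^2):k\in\mathbb{Z}\}$, so the set $\mathcal{G}_\lambda$ of geodesics of charge $\lambda$ is identified with $\mathbb{H}/\Gamma_\lambda$ by $(z,t)\gamma_\lambda\mapsto(z,t)\Gamma_\lambda$. Functions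 on $\mathbb{H}/\Gamma_\lambda$ are written $g(z,t)$ with $t$ taken mod $\pi R^2$. $\mathcal{G}_\lambda$ carries the measure $d\mathcal{G}_\lambda=\lambda\,dx\,dy\,dt$ (where $dx\,dy\,dt$ is Haar measure on $\mathbb{H}/\Gamma_\lambda$, i.e. Lebesgue measure on $\mathbb{C}\times[0,\pi R^2)$), and $\mathcal{G}$, the set of all geodesics $\{(z,t,\lambda):\lambda>0,\ (z,t)\in\mathbb{H}/\Gamma_\lambda\}$, carries the measure $d\mathcal{G}=\lambda e^{-\lambda}\,dx\,dy\,dt\,d\lambda$. For $f\in C_c(\mathbb{H})$, $I_\lambda f(z,t)=\int_{\mathbb{R}}f\left((z,t)\gamma_\lambda(s)\right)ds$ and $If(z,t,\lambda)=I_\lambda f(z,t)$. The maps $I_\lambda:L^1(\mathbb{H})\to L^1(\mathcal{G}_\lambda,d\mathcal{G}_\lambda)$ and $I:L^1(\mathbb{H})\to L^1(\mathcal{G},d\mathcal{G})$ are the bounded extensions from $C_c(\mathbb{H})$. *)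

(* Defs.v *)
From HB Require Import structures.
From mathcomp Require Import all_boot all_order all_algebra.
From mathcomp Require Import all_classical all_reals all_analysis.
From mathcomp Require Import measurable_realfun.
From mathcomp Require Import complex.

Set Implicit Arguments.
Unset Strict Implicit.
Unset Printing Implicit Defensive.

Import Order.TTheory GRing.Theory Num.Theory.
Import numFieldNormedType.Exports.

Local Open Scope classical_set_scope.
Local Open Scope ring_scope.

Section weighted_measure.
Local Open Scope ereal_scope.
Context d (T : measurableType d) (R : realType).
Variables (mu : {measure set T -> \bar R}) (D : set T) (w : T -> R).
Hypotheses (mD : measurable D) (mw : measurable_fun D w).
Hypothesis (w0 : forall x, D x -> (0 <= w x)%R).

(** The measure [w dmu] on [D]. *)
Definition weighted of measurable D & measurable_fun D w
    & (forall x, D x -> (0 <= w x)%R) :=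
  fun A : set T => \int[mu]_(x in A `&` D) (w x)%:E.

Local Notation nu := (weighted mD mw w0).

Let weighted0 : nu set0 = 0.
Proof. by rewrite /weighted set0I integral_set0. Qed.

Let weighted_ge0 A : 0 <= nu A.
Proof. by apply: integral_ge0 => x [_ Dx]; rewrite lee_fin w0. Qed.

Let weighted_sigma_additive : semi_sigma_additive nu.
Proof.
move=> F mF tF mUF; rewrite /weighted setI_bigcupl ge0_integral_bigcup.
- by apply: is_cvg_nneseries_cond => n _ _; exact: weighted_ge0.
- by move=> k; exact: measurableI.
- apply: (@measurable_funS _ _ _ _ D) => //.
  + by move=> x [k _ []].
  + exact/measurable_EFinP.
- by move=> x [k _ [_ Dx]]; rewrite lee_fin w0.
- exact/trivIset_setIr.
Qed.

HB.instance Definition _ := isMeasure.Build _ _ _ nu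
  weighted0 weighted_ge0 weighted_sigma_additive.

End weighted_measure.

(** Complex-valued functions.  [R[i]] has no Borel structure in the library:
    measurability, integrability and continuity are meant componentwise. *)
Section complex_L1.
Context {R : realType} d {T : measurableType d}.
Variable mu : {measure set T -> \bar R}.
Implicit Types f g : T -> R[i].

Definition L1 f : Prop :=
  (fun x => complex.Re (f x)) \in Lfun mu 1%E /\
  (fun x => complex.Im (f x)) \in Lfun mu 1%E.

Definition L1norm f : \bar R :=
  Lnorm mu 1%E (fun x => (ComplexField.Normc.normc (f x))%:E).

End complex_L1.

Definition Cc {R : realType} {T : topologicalType} (f : T -> R[i]) : Prop :=
  [/\ continuous (fun x => complex.Re (f x) : R),
      continuous (fun x => complex.Im (f x) : R)
    & compact (closure [set x | f x != 0])].

(** Operators between L^1 spaces act on representatives; equality in L^1 is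
    almost-everywhere equality.  Such operators respect it automatically, by
    linearity and boundedness. *)
Section bounded_extension.
Context {R : realType} d d' {T : measurableType d} {T' : measurableType d'}.
Variables (mu : {measure set T -> \bar R}) (nu : {measure set T' -> \bar R}).

Definition bounded_operator (A : (T -> R[i]) -> (T' -> R[i])) : Prop :=
  [/\ forall f, L1 mu f -> L1 nu (A f),
      forall (a : R[i]) f g, L1 mu f -> L1 mu g ->
        A (fun x => a * f x + g x) = (fun y => a * A f y + A g y) %[ae nu]
    & exists M : R, forall f, L1 mu f ->
        (L1norm nu (A f) <= M%:E * L1norm mu f)%E].

(** The bounded operator from L^1(mu) to L^1(nu) that agrees with [A0] on the
    class [K] of functions; unique up to a.e. equality when [K] is dense.
    The default value [0] is taken only if there is no such operator. *)
Definition bounded_extension (K : set (T -> R[i]))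
    (A0 : (T -> R[i]) -> (T' -> R[i])) : (T -> R[i]) -> (T' -> R[i]) :=
  xget (fun _ _ => 0)
    [set A | bounded_operator A /\ forall f, K f -> A f = A0 f %[ae nu]].

End bounded_extension.

(** [(x, y, t)] stands for [(x + iy, t)].  [measurableTypeR R] is [R] itself,
    with the Borel sigma-algebra under the display used by [lebesgue_measure]. *)
Notation heis R :=
  (measurableTypeR R * measurableTypeR R * measurableTypeR R)%type.

Section heisenberg.
Variable R : realType.

Definition heis_mul (p q : heis R) : heis R :=
  let: (x, y, t) := p in let: (u, v, s) := q in
  (x + u, y + v, t + s + 2^-1 * (x * v - y * u)).

Definition geod (l s : R) : heis R :=
  let r := l^-1 in (r * cos (s / r), r * sin (s / r), 2^-1 * s * r).

(** One turn of the geodesic amounts to the translation by [(0, pi r^2)],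
    the generator of its stabilizer. *)
Lemma geod_turn (l s : R) : l != 0 ->
  geod l (s + l^-1 * pi *+ 2) = heis_mul (0, 0, pi * l^-1 ^+ 2) (geod l s).
Proof.
move=> l0; rewrite /geod /heis_mul /=.
have -> : (s + l^-1 * pi *+ 2) / l^-1 = s / l^-1 + pi *+ 2.
  by rewrite mulrDl -mulrnAr mulrAC divff ?mul1r// invr_eq0.
rewrite cosD2pi sinD2pi !add0r !mul0r subrr mulr0 addr0; congr (_, _).
by rewrite -[_ * pi *+ 2]mulr_natl mulrDr mulKf ?pnatr_eq0// mulrDl addrC
  [_ * pi]mulrC expr2 mulrA.
Qed.

Local Notation leb := (@lebesgue_measure R).

Definition haar : {measure set (heis R) -> \bar R} := ((leb \x leb) \x leb)%E.

Definition geod_integral (l : R) (f : heis R -> R[i]) (p : heis R) : R[i] :=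
  Complex
    (\int[leb]_s complex.Re (f (heis_mul p (geod l s))))
    (\int[leb]_s complex.Im (f (heis_mul p (geod l s)))).

(** Fundamental domain [C x [0, pi r^2)] for the central subgroup
    [{(0, k pi r^2)}], [r = l^-1]: the geodesics of charge [l] are the classes
    [p * geod l] with [p] in [Glam_dom l].  A function on the space of these
    geodesics is handled as a function on [heis R] of which only the values on
    [Glam_dom l] matter, as the measures below vanish elsewhere. *)
Definition Glam_dom (l : R) : set (heis R) :=
  [set p | 0 <= p.2 < pi * l^-1 ^+ 2].

Lemma measurable_Glam_dom l : measurable (Glam_dom l).
Proof.
rewrite (_ : Glam_dom l = setT `&` snd @^-1` `[0, pi * l^-1 ^+ 2[).
  by apply: measurable_snd => //; exact: measurable_itv.
by apply/seteqP; split=> p /=; rewrite in_itv //= => -[].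
Qed.

Definition Glam_measure (l : {posnum R}) : {measure set (heis R) -> \bar R} :=
  mscale l%:num%:nng (mrestr haar (measurable_Glam_dom l%:num)).

(** All geodesics, as pairs [(p, l)] of a class representative and a charge. *)
Definition G_dom : set (heis R * measurableTypeR R) :=
  [set q | 0 < q.2 /\ Glam_dom q.2 q.1].

Lemma measurable_G_dom : measurable G_dom.
Proof.
have mt : measurable_fun setT (fun q : heis R * measurableTypeR R => q.1.2).
  exact: measurableT_comp measurable_snd measurable_fst.
have ml : measurable_fun setT (fun q : heis R * measurableTypeR R => q.2).
  exact: measurable_snd.
rewrite (_ : G_dom = [set q | (0 < q.2) && ((0 <= q.1.2) &&
    (q.1.2 * q.2 ^+ 2 < pi))]).
  have : measurable_fun setT (fun q : heis R * measurableTypeR R =>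
      (0 < q.2) && ((0 <= q.1.2) && (q.1.2 * q.2 ^+ 2 < pi))).
    apply: measurable_and; first exact: measurable_fun_ltr.
    apply: measurable_and; first exact: measurable_fun_ler.
    apply: measurable_fun_ltr => //.
    by apply: measurable_funM => //; exact: measurable_funX.
  by move=> /(_ measurableT [set true] Logic.I); rewrite setTI.
have E (t l : R) : 0 < l -> (t < pi * l^-1 ^+ 2) = (t * l ^+ 2 < pi).
  by move=> l0; rewrite exprVn ltr_pdivlMr ?exprn_gt0.
apply/seteqP; split=> -[[[x y] t] l] /=; rewrite /Glam_dom/=.
  by move=> [l0 /andP[t0 tl]]; apply/and3P; split; rewrite // -E.
by move=> /and3P[l0 t0 tl]; split=> //; apply/andP; split; rewrite // E.
Qed.

Definition G_weight (q : heis R * R) : R := q.2 * expR (- q.2).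

Lemma measurable_G_weight : measurable_fun G_dom G_weight.
Proof.
apply: measurable_funTS; apply: measurable_funM; first exact: measurable_snd.
by apply: measurableT_comp => //; exact: measurableT_comp.
Qed.

Lemma G_weight_ge0 q : G_dom q -> 0 <= G_weight q.
Proof. by move=> [/ltW q0 _]; rewrite mulr_ge0 ?expR_ge0. Qed.

Definition G_measure : {measure set (heis R * measurableTypeR R) -> \bar R} :=
  weighted (haar \x leb)%E
    measurable_G_dom measurable_G_weight G_weight_ge0.

Definition xray_at (l : {posnum R}) :
    (heis R -> R[i]) -> heis R -> R[i] :=
  bounded_extension haar (Glam_measure l) Cc (geod_integral l%:num).

Definition xray : (heis R -> R[i]) -> heis R * measurableTypeR R -> R[i] :=
  bounded_extension haar G_measure Cc (fun f q => geod_integral q.2 f q.1).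

End heisenberg.

(* Main.v *)
(* If the integrals of [F] along the geodesics of charge [l] vanish then, by
   Fubini and unfolding of the geodesic parameter, [F] is orthogonal to
   [q |-> \int_0^(2 pi / l) psi (q * (geod l s)^-1) ds] for every bounded [psi]
   invariant under the stabilizer of [geod l].  For [tau = 2 k l^2] take for
   [psi] the translates of
   [Psi_(k+n) = e^(-i tau t) e^(-tau |z|^2 / 4) conj(z)^(k+n)]: the average over
   one turn maps [Psi_(k+n)] to a multiple of [Psi_n], whose factor is a Laguerre
   coefficient, polynomial in [k] with value [1] at [k = 0], hence nonzero for
   arbitrarily large [k].  So [F] is orthogonal to the translates of [Psi_n], for
   a dense set of [tau] as soon as the charges [l] are dense near [0], and by
   continuity for all [tau > 0].  Summing these moments against [c^n / n!] gives
   the vanishing of the Fourier transform of [F e^(-tau |z|^2 / 4)] at vertical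
   frequency [tau]; the Gaussian is then removed, and the uniqueness theorem for
   Fourier transforms in each variable yields [F = 0].

   Integration along geodesics is itself a bounded operator between the L^1
   spaces, hence equal to the bounded extension from [Cc].  A transform that
   vanishes almost everywhere on the space of all geodesics vanishes, by Fubini,
   for almost every charge, hence for a dense set of charges. *)
Require Import Defs.
From HB Require Import structures.
From mathcomp Require Import all_boot all_order all_algebra.
From mathcomp Require Import all_classical all_reals all_analysis.
From mathcomp Require Import measurable_realfun.
From mathcomp Require Import complex.
From mathcomp Require Import ring lra.
Set Implicit Arguments.
Unset Strict Implicit.
Unset Printing Implicit Defensive.
Import Order.TTheory GRing.Theory Num.Theory.
Import numFieldNormedType.Exports.
Local Open Scope classical_set_scope.
Local Open Scope ring_scope.

(** The frequencies tau = 2 k l^2 are forced: e^(-i tau t) is invariant under the stabilizer of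
    [geod l] exactly when tau pi / l^2 is a multiple of 2 pi. One charge thus sees only a discrete
    set of frequencies, and even at these a moment is lost when its Laguerre coefficient vanishes.
    This is where small charges come in: for fixed tau, k can be taken large only if l = sqrt(tau /
    (2 k)) can be taken small. The admissible k depend on n, so every moment gets its own sequence
    of charges.

    The weight e^(-tau |z|^2 / 4) is the one for which, along a turn, the angular dependence of
    weight and phase combines into an exponential holomorphic in conj(z) e^(i theta). It has no
    negative Fourier modes, hence the turn average of a test function is again a single power of
    conj(z).

    Powers of conj(z) about one centre do not determine a function of z. The translates make up for
    this: the centres a1 + i a2 range over the whole plane and turn into the horizontal
    frequencies. *)

Notation normc := ComplexField.Normc.normc.
Notation Re := complex.Re.
Notation Im := complex.Im.

(** * Haar measure *)

Section product_sigma_finite.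
Local Open Scope ereal_scope.
Context d1 d2 (T1 : measurableType d1) (T2 : measurableType d2) (R : realType).
Variables (m1 : {sigma_finite_measure set T1 -> \bar R})
  (m2 : {sigma_finite_measure set T2 -> \bar R}).

Lemma product_sigma_finite : sigma_finite setT (m1 \x m2).
Proof.
have /sigma_finiteP[F [TF ndF Foo]] := sigma_finiteT m1.
have /sigma_finiteP[G [TG ndG Goo]] := sigma_finiteT m2.
(* Both exhaustions increase, so a point of [F i] times [G j] lies in the rectangle of index
   [maxn i j]. *)
exists (fun n => F n `*` G n).
  apply/esym/seteqP; split=> // -[x y] _.
  have [[i _ Fi] [j _ Gj]] : (\bigcup_i F i) x /\ (\bigcup_i G i) y.
    by rewrite -TF -TG.
  exists (maxn i j) => //; split.
    by move: x Fi; exact/subsetPset/ndF/leq_maxl.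
  by move: y Gj; exact/subsetPset/ndG/leq_maxr.
move=> k; have [mF Fk] := Foo k; have [mG Gk] := Goo k.
split; first exact: measurableX.
by rewrite product_measure1E// lte_mul_pinfty// ge0_fin_numE.
Qed.

End product_sigma_finite.

Section haar_sigma_finite.
Variable R : realType.
Local Notation leb := (@lebesgue_measure R).

Definition plane_leb :
    set (measurableTypeR R * measurableTypeR R)%type -> \bar R :=
  (leb \x leb)%E.

HB.instance Definition _ := Measure.on plane_leb.

HB.instance Definition _ := @Measure_isSigmaFinite.Build _ _ _ plane_leb
  (product_sigma_finite leb leb).

(* [haar R] is a bundled measure; this is its underlying set function, to
   which the sigma-finiteness is attached. *)
Definition haarf : set (heis R) -> \bar R := (plane_leb \x leb)%E.

HB.instance Definition _ := Measure.on haarf.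

HB.instance Definition _ := @Measure_isSigmaFinite.Build _ _ _ haarf
  (product_sigma_finite plane_leb leb).

End haar_sigma_finite.
Arguments plane_leb {R} _.
Arguments haarf {R} _.

Section measure_preserving.
Local Open Scope ereal_scope.
Context d (T : measurableType d) (R : realType).
Implicit Types (mu : {measure set T -> \bar R}) (phi : T -> T).

Definition mpres mu phi := measurable_fun setT phi /\
  forall A, measurable A -> mu (phi @^-1` A) = mu A.

Lemma mpres_ge0_integral mu phi (f : T -> \bar R) : mpres mu phi ->
  measurable_fun setT f -> (forall x, 0 <= f x) ->
  \int[mu]_x f (phi x) = \int[mu]_x f x.
Proof.
move=> [mphi E] mf f0.
rewrite -[LHS](@ge0_integral_pushforward _ _ _ _ _ _ mphi mu setT f)//.
by apply: eq_measure_integral => A mA _; exact: E.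
Qed.

Lemma mpres_integrable mu phi (f : T -> \bar R) : mpres mu phi ->
  mu.-integrable setT f -> mu.-integrable setT (f \o phi).
Proof.
move=> mp /integrableP[mf fi]; apply/integrableP; split.
  by apply: measurableT_comp => //; case: mp.
rewrite (mpres_ge0_integral (f := abse \o f) mp)//.
  exact: measurableT_comp.
by move=> x; exact: abse_ge0.
Qed.

Lemma mpres_integral mu phi (f : T -> \bar R) : mpres mu phi ->
  mu.-integrable setT f -> \int[mu]_x f (phi x) = \int[mu]_x f x.
Proof.
move=> mp fi; have [mphi E] := mp.
have fp := mpres_integrable mp fi.
rewrite -[LHS](@integral_pushforward _ _ _ _ _ _ mphi mu setT f)//.
  by apply: eq_measure_integral => A mA _; exact: E.
exact: measurable_int fi.
Qed.

End measure_preserving.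

Section skew_product.
Local Open Scope ereal_scope.
Context d1 d2 (T1 : measurableType d1) (T2 : measurableType d2) (R : realType).

(** Fibre by fibre: over x, the preimage of A is the [psi x]-preimage of the section of A over
    [phi x]. Heisenberg translations have this form, with the plane as base and the centre as
    fibre. *)
Lemma mpres_skew1 (m1 : {measure set T1 -> \bar R})
    (m2 : {sigma_finite_measure set T2 -> \bar R})
    (phi : T1 -> T1) (psi : T1 -> T2 -> T2) :
  mpres m1 phi -> (forall x, mpres m2 (psi x)) ->
  measurable_fun setT (fun p : T1 * T2 => psi p.1 p.2) ->
  mpres (m1 \x m2) (fun p => (phi p.1, psi p.1 p.2)).
Proof.
move=> mp1 mp2 mpsi; have [mphi E1] := mp1.
have mS : measurable_fun setT (fun p : T1 * T2 => (phi p.1, psi p.1 p.2)).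
  apply/measurable_fun_pairP; split=> /=; last exact: mpsi.
  exact: (measurableT_comp mphi measurable_fst).
split=> // A mA; rewrite /product_measure1.
rewrite -[RHS](mpres_ge0_integral mp1)//; last first.
  exact: measurable_fun_xsection.
apply: eq_integral => x _ /=.
rewrite -[RHS](mp2 x).2; last exact: measurable_xsection.
congr (m2 _); apply/seteqP; split=> y /=; rewrite /xsection /= !inE //.
Qed.

Lemma product_measureC (m1 : {sigma_finite_measure set T1 -> \bar R})
    (m2 : {sigma_finite_measure set T2 -> \bar R}) A : measurable A ->
  (m1 \x m2) A = \int[m2]_y m1 (ysection A y).
Proof.
move=> mA; rewrite [LHS](product_measure_unique (m' := (m1 \x^ m2)))//.
by move=> B C mB mC /=; rewrite product_measure2E.
Qed.

(** The base is now the second factor and stays fixed, so the product is sliced the other way. It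
    serves the map [(p, s) -> (p * geod l s, s)]. *)
Lemma mpres_skew2 (m1 : {sigma_finite_measure set T1 -> \bar R})
    (m2 : {sigma_finite_measure set T2 -> \bar R}) (psi : T2 -> T1 -> T1) :
  (forall y, mpres m1 (psi y)) ->
  measurable_fun setT (fun p : T1 * T2 => psi p.2 p.1) ->
  mpres (m1 \x m2) (fun p => (psi p.2 p.1, p.2)).
Proof.
move=> mp mpsi.
have mS : measurable_fun setT (fun p : T1 * T2 => (psi p.2 p.1, p.2)).
  apply/measurable_fun_pairP; split=> /=; first exact: mpsi.
  exact: measurable_snd.
split=> // A mA; rewrite [LHS]product_measureC; last first.
  by rewrite -[X in measurable X]setTI; exact: mS.
rewrite [RHS]product_measureC//.
apply: eq_integral => y _.
rewrite -[RHS](mp y).2; last exact: measurable_ysection.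
by congr (m1 _); apply/seteqP; split=> x /=; rewrite /ysection /= !inE.
Qed.

End skew_product.

Section translations.
Variable R : realType.
Local Notation leb := (@lebesgue_measure R).
Local Open Scope ereal_scope.

Lemma mpres_leb_shift (c : R) :
  mpres leb (fun x : measurableTypeR R => (x + c)%R).
Proof.
pose phi (x : measurableTypeR R) : measurableTypeR R := (x + c)%R.
have mc : measurable_fun setT phi by exact: measurable_funD.
pose phi' : {mfun measurableTypeR R >-> measurableTypeR R} :=
  HB.pack phi (isMeasurableFun.Build _ _ _ _ _ mc).
split=> // A mA; apply/esym.
apply: (@lebesgue_measure_unique _ (pushforward leb phi')) => // X.
move=> /ocitvP[->|[[a b] /= ab ->]]; first by rewrite !measure0.
rewrite /pushforward (_ : _ @^-1` _ = `](a - c)%R, (b - c)%R]%classic); last first.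
  by apply/seteqP; split=> x /=; rewrite /phi !in_itv/= ltrBlDr lerBrDr.
by rewrite !lebesgue_measure_itv/= !lte_fin ltrD2r -!EFinB opprB addrA subrK.
Qed.

(** A right translation moves the plane by a vector and, above each point of the plane, moves the
    centre by a constant: a skew product of Lebesgue translations. *)
Lemma mpres_heis_mul (g : heis R) :
  mpres (@haarf R) (fun p => heis_mul p g).
Proof.
case: g => -[u v] s.
pose phi (p : measurableTypeR R * measurableTypeR R) : measurableTypeR R * measurableTypeR R :=
  ((p.1 + u, p.2 + v)%R).
have mp : mpres (@plane_leb R) phi.
  apply: (mpres_skew1 (m1 := leb) (m2 := leb)
    (phi := fun x : measurableTypeR R => (x + u)%R)
    (psi := fun _ (y : measurableTypeR R) => (y + v)%R)).
  - exact: mpres_leb_shift.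
  - by move=> x; exact: mpres_leb_shift.
  - by apply: measurable_funD => //; exact: measurable_snd.
rewrite (_ : (fun p => _) = (fun p : heis R => (phi p.1, p.2 + (s + 2^-1 * (p.1.1 * v - p.1.2 *
  u))))%R); last first.
  by apply/funext => -[[x y] t] /=; rewrite addrA.
apply: (mpres_skew1 (m1 := plane_leb) (m2 := leb) (phi := phi) (psi := fun (z : measurableTypeR R
  * measurableTypeR R) t => t + (s + 2^-1 * (z.1 * v - z.2 * u)))%R) => //=.
  by move=> z; exact: mpres_leb_shift.
apply: measurable_funD => //; apply: measurable_funD => //.
apply: measurable_funM => //; apply: measurable_funB; apply: measurable_funM => //.
- exact: measurableT_comp.
- exact: measurableT_comp.
Qed.

End translations.

(** * Integrable real functions and dominated convergence *)

Notation intg mu f := (mu.-integrable setT (EFin \o f)).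

Section real_integrals.
Context d (T : measurableType d) (R : realType) (mu : {measure set T -> \bar R}).
Implicit Types f g h : T -> R.

Lemma intg_meas f : intg mu f -> measurable_fun setT f.
Proof. by move=> /measurable_int/measurable_EFinP. Qed.

Lemma intg_le g f : measurable_fun setT f -> intg mu g ->
  (forall x, `|f x| <= g x) -> intg mu f.
Proof.
move=> mf ig fg; apply: le_integrable ig => //; first exact/measurable_EFinP.
by move=> x _ /=; rewrite lee_fin (le_trans (fg x))// ler_norm.
Qed.

Lemma intgD f g : intg mu f -> intg mu g -> intg mu (fun x => f x + g x).
Proof. by move=> fi gi; exact: (integrableD measurableT fi gi). Qed.

Lemma intgB f g : intg mu f -> intg mu g -> intg mu (fun x => f x - g x).
Proof. by move=> fi gi; exact: (integrableB measurableT fi gi). Qed.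

Lemma intgZ c f : intg mu f -> intg mu (fun x => c * f x).
Proof. by move=> fi; exact: (integrableZl measurableT c fi). Qed.

Lemma intg_norm f : intg mu f -> intg mu (fun x => `|f x|).
Proof. by move=> fi; exact: (integrable_norm fi). Qed.

Lemma intgM_bounded C f h : intg mu f -> measurable_fun setT h ->
  (forall x, `|h x| <= C) -> intg mu (fun x => f x * h x).
Proof.
move=> fi mh hC; apply: (intg_le (g := fun x => C * `|f x|)).
- by apply: measurable_funM => //; exact: intg_meas.
- by apply: intgZ; exact: intg_norm.
- by move=> x; rewrite normrM mulrC ler_wpM2r.
Qed.

Lemma dct (f_ : nat -> T -> R) f g : (forall n, measurable_fun setT (f_ n)) ->
  (forall x, f_ ^~ x @ \oo --> f x) -> intg mu g ->
  (forall n x, `|f_ n x| <= g x) ->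
  intg mu f /\ (\int[mu]_x f_ n x) @[n --> \oo] --> \int[mu]_x f x.
Proof.
move=> mf_ ff gi fg.
have mf : measurable_fun setT f.
  by apply: (measurable_fun_cvg (h := f_)) => // x _; exact: ff.
have [|||||fi _ lim] := @dominated_convergence _ _ _ mu setT measurableT
  (fun n => EFin \o f_ n) (EFin \o f) (EFin \o g).
- by move=> n; exact/measurable_EFinP.
- exact/measurable_EFinP.
- apply: aeW => x _; apply: cvg_EFin; first exact: nearW.
  exact: ff.
- exact: gi.
- by apply: aeW => x n _; rewrite lee_fin fg.
split=> //; apply: fine_cvg; rewrite fineK; first exact: lim.
exact: integrable_fin_num.
Qed.

End real_integrals.

(** * A functional monotone class theorem, for linear classes closed under limits dominated by
    multiples of [e] *)

Section function_class.
Context (T : Type) (R : realType) (V : (T -> R) -> Prop) (e : T -> R).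
Hypothesis VZ : forall c f, V f -> V (fun x => c * f x).
Hypothesis VB : forall f g, V f -> V g -> V (fun x => f x - g x).
Hypothesis Vlim : forall (h_ : nat -> T -> R) h C, (forall n, V (h_ n)) ->
  (forall n x, `|h_ n x| <= C * e x) -> (forall x, h_ ^~ x @ \oo --> h x) -> V h.

Lemma classD f g : V f -> V g -> V (fun x => f x + g x).
Proof.
move=> Vf Vg; have := VB Vf (VZ (-1) Vg).
by congr V; apply/funext => x; rewrite mulN1r opprK.
Qed.

Lemma class_sum I (s : seq I) (F : I -> T -> R) f0 : V f0 ->
  (forall i, V (F i)) -> V (fun x => \sum_(i <- s) F i x).
Proof.
move=> V0 VF; elim: s => [|i s IH].
  by have := VB V0 V0; congr V; apply/funext => x; rewrite big_nil subrr.
have := classD (VF i) IH; congr V; apply/funext => x.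
by rewrite big_cons.
Qed.

(** The pi-lambda argument with a weight [w] carried along: the constants may fail to be in [V], so
    a complement is [w] minus a member, and a countable disjoint union is a limit dominated by
    [C * e]. *)
Lemma class_dynkin d (T1 : measurableType d) (X : T -> T1) (G : set (set T1))
    (w : T -> R) C : @measurable _ T1 = <<s G >> -> setI_closed G ->
  (forall x, `|w x| <= C * e x) -> V w ->
  (forall A, G A -> V (fun x => \1_A (X x) * w x)) ->
  forall A, measurable A -> V (fun x => \1_A (X x) * w x).
Proof.
move=> GE GI wC Vw VG A; rewrite GE; move: A.
apply: (dynkin_induction GE GI).
- by move: Vw; congr V; apply/funext => x; rewrite indicT mul1r.
- exact: VG.
- move=> A mA VA; have := VB Vw VA; congr V; apply/funext => x.
  by rewrite !indicE in_setC; case: (_ \in _);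
    rewrite /= ?(mul1r, mul0r, subrr, subr0).
- move=> F mF tF VF.
  pose S n : set T1 := \big[setU/set0]_(i < n) F i.
  have SE n x : \1_(S n) x = \sum_(i < n) \1_(F i) x :> R.
    elim: n => [|n IH]; first by rewrite /S !big_ord0 indic0.
    rewrite big_ord_recr/= -IH /S big_ord_recr/= -!(bigcup_mkord n F) !indicE.
    rewrite in_setU; have [Fn|_] := boolP (x \in F n); last by rewrite orbF addr0.
    rewrite orbT memNset ?add0r// => -[i /= ltin Fi].
    move/set_mem: Fn => Fn; have /= := tF i n Logic.I Logic.I.
    by move=> /(_ (ex_intro _ x (conj Fi Fn))) ein; rewrite ein ltnn in ltin.
  apply: (@Vlim (fun n x => \1_(S n) (X x) * w x) _ C).
  + move=> n; have := @class_sum _ (index_enum 'I_n)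
      (fun (i : 'I_n) x => \1_(F i) (X x) * w x) _ Vw (fun i => VF i).
    by congr V; apply/funext => x; rewrite -mulr_suml SE.
  + move=> n x; rewrite normrM (le_trans _ (wC x))// -[leRHS]mul1r.
    by rewrite ler_wpM2r// indicE; case: (_ \in _); rewrite ?normr1 ?normr0.
  + move=> x; apply: cvgMl; apply: cvg_near_cst.
    rewrite !indicE; have [/set_mem[i _ Fi]|XF] := boolP (X x \in \bigcup_k F k).
      exists i.+1 => // n /= lt; rewrite indicE mem_set//.
      by rewrite /S -(bigcup_mkord n F); exists i.
    apply: nearW => n; rewrite indicE memNset// /S -(bigcup_mkord n F).
    move=> -[i _ Fi]; move/negP: XF; apply; rewrite inE; exists i => //.
Qed.

Lemma class_prod d1 d2 (T1 : measurableType d1) (T2 : measurableType d2)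
    (X : T -> T1) (Y : T -> T2) (w : T -> R) C :
  (forall x, `|w x| <= C * e x) ->
  (forall A B, measurable A -> measurable B ->
     V (fun x => \1_A (X x) * (\1_B (Y x) * w x))) ->
  forall D, measurable D -> V (fun x => \1_D (X x, Y x) * w x).
Proof.
move=> wC VAB; apply: (class_dynkin (C := C) (measurable_prod_measurableType T1 T2)) => //.
- move=> _ _ [A mA [B mB <-]] [A' mA' [B' mB' <-]].
  exists (A `&` A'); first exact: measurableI.
  by exists (B `&` B'); [exact: measurableI|rewrite setXI].
- have := VAB _ _ measurableT measurableT; congr V; apply/funext => x.
  by rewrite !indicT !mul1r.
- move=> _ [A mA [B mB <-]]; have := VAB _ _ mA mB; congr V; apply/funext => x.
  by rewrite mulrA; congr (_ * _); rewrite !indicE in_setX/=;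
    do 2 case: (_ \in _); rewrite ?(mul1r, mul0r).
Qed.

Import HBNNSimple.

(** Simple functions increase to [h], so their products with [w] are dominated by [h (X x) * w x]
    itself. Thus [h] may be unbounded as long as this product is controlled by [e]. *)
Lemma class_fun d (T1 : measurableType d) (X : T -> T1) (w : T -> R) C :
  (forall A, measurable A -> V (fun x => \1_A (X x) * w x)) ->
  forall h : T1 -> R, measurable_fun setT h -> (forall y, 0 <= h y) ->
  (forall x, `|h (X x) * w x| <= C * e x) -> V (fun x => h (X x) * w x).
Proof.
move=> VA h mh h0 hC.
have mh' : measurable_fun setT (EFin \o h) by exact/measurable_EFinP.
have h0' x : setT x -> (0 <= (EFin \o h) x)%E by rewrite lee_fin.
pose g n : T1 -> R := nnsfun_approx measurableT mh' n.
apply: (@Vlim (fun n x => g n (X x) * w x) _ C).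
- move=> n; have := @class_sum _ (finmap.enum_fset (fset_set (range (g n))))
    (fun y x => y * (\1_(g n @^-1` [set y]) (X x) * w x)) _
    (VA setT measurableT) (fun y => VZ y (VA _ (measurable_sfunP _ (measurable_set1 y)))).
  congr V; apply/funext => x; rewrite [in RHS]/g fimfunE.
  rewrite fsbig_finite//= mulr_suml.
  by apply: eq_bigr => y _; rewrite mulrA.
- move=> n x; apply: le_trans (hC x).
  rewrite !normrM ler_wpM2r// !ger0_norm//.
  by rewrite -lee_fin /g nnsfun_approxE; exact: le_approx.
- move=> x; apply: cvgMl.
  have /fine_cvg := cvg_nnsfun_approx measurableT mh' h0' (x := X x) Logic.I.
  exact.
Qed.

End function_class.

(** * Uniqueness for trigonometric integrals *)

Section power_limits.
Variable R : realType.

Lemma bernoulli_ineq (x : R) n : -1 <= x -> 1 + n%:R * x <= (1 + x) ^+ n.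
Proof.
move=> x1; elim: n => [|n IH]; first by rewrite mul0r addr0 expr0.
have x0 : 0 <= 1 + x by lra.
rewrite exprS; apply: le_trans (ler_wpM2l x0 IH).
rewrite -subr_ge0 (_ : _ - _ = n%:R * x ^+ 2); first by rewrite mulr_ge0 ?sqr_ge0.
by rewrite -natr1; ring.
Qed.

Lemma cvg_expr0 (x : R) : `|x| < 1 -> x ^+ n @[n --> \oo] --> (0 : R).
Proof.
move=> x1; have := @cvg_geometric R 1 x x1.
by rewrite (_ : geometric 1 x = fun n => x ^+ n)//; apply/funext => n;
  rewrite /geometric/= mul1r.
Qed.

(* With [s = (1 + sin) / 2], these polynomials in [s] approximate the indicator
   of a half-period. *)
Lemma cvg_threshold_lo (s : R) : 0 <= s -> s < 2^-1 ->
  (1 - s ^+ n) ^+ (2 ^ n) @[n --> \oo] --> (1 : R).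
Proof.
move=> s0 s2; apply: (@squeeze_cvgr _ _ _ _ (fun n => 1 - (2 * s) ^+ n) (fun=> 1)).
- apply: nearW => n.
  have sn : s ^+ n <= 1 by rewrite exprn_ile1//; lra.
  have sn0 : 0 <= s ^+ n by rewrite exprn_ge0.
  apply/andP; split; last by rewrite exprn_ile1//; lra.
  (* The exponent 2^n turns Bernoulli's bound 1 - 2^n s^n into 1 - (2 s)^n, which puts the threshold
     at 1/2. *)
  have := @bernoulli_ineq (- s ^+ n) (2 ^ n); rewrite mulrN natrX -exprMn.
  by apply; lra.
- rewrite -[X in _ --> X]subr0; apply: cvgB; first exact: cvg_cst.
  by apply: cvg_expr0; rewrite ger0_norm; lra.
- exact: cvg_cst.
Qed.

Lemma cvg_threshold_hi (s : R) : 2^-1 < s -> s <= 1 ->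
  (1 - s ^+ n) ^+ (2 ^ n) @[n --> \oo] --> (0 : R).
Proof.
move=> s2 s1; apply: (@squeeze_cvgr _ _ _ _ (fun=> 0) (fun n => ((2 * s)^-1) ^+ n)).
- apply: nearW => n.
  have s0 : 0 < s by lra.
  have sn : s ^+ n <= 1 by rewrite exprn_ile1//; lra.
  have sn0 : 0 < s ^+ n by rewrite exprn_gt0.
  apply/andP; split; first by rewrite exprn_ge0//; lra.
  rewrite exprVn -[leRHS]mul1r ler_pdivlMr ?exprn_gt0//; last by lra.
  (* Since (1 - s^n) (1 + s^n) <= 1, a lower bound for the powers of 1 + s^n is an upper bound for
     those of 1 - s^n. *)
  have B : (2 * s) ^+ n <= (1 + s ^+ n) ^+ (2 ^ n).
    apply: (le_trans _ (@bernoulli_ineq (s ^+ n) (2 ^ n) _)); last lra.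
    by rewrite natrX -exprMn; lra.
  apply: le_trans (ler_wpM2l _ B) _; first by rewrite exprn_ge0//; lra.
  by rewrite -exprMn exprn_ile1//; nra.
- exact: cvg_cst.
- apply: cvg_expr0; rewrite ger0_norm ?invr_ge0; last lra.
  by rewrite invf_lt1; lra.
Qed.

End power_limits.

Section null_class.
Context d (T : measurableType d) (R : realType) (mu : {measure set T -> \bar R}).
Variables (W e : T -> R).
Hypothesis e0 : forall x, 0 <= e x.
Hypothesis We : intg mu (fun x => W x * e x).

Definition null_class (f : T -> R) :=
  intg mu (fun x => W x * f x) /\ \int[mu]_x (W x * f x) = 0.

Lemma null_classZ c f : null_class f -> null_class (fun x => c * f x).
Proof.
move=> [fi f0]; split.
  by under eq_fun do rewrite mulrCA; exact: intgZ.
by under eq_Rintegral do rewrite mulrCA; rewrite RintegralZl// f0 mulr0.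
Qed.

Lemma null_classB f g : null_class f -> null_class g -> null_class (fun x => f x - g x).
Proof.
move=> [fi f0] [gi g0]; split.
  by under eq_fun do rewrite mulrBr; exact: intgB.
by under eq_Rintegral do rewrite mulrBr; rewrite RintegralB// f0 g0 subrr.
Qed.

Lemma null_class_lim (f_ : nat -> T -> R) f C : (forall n, null_class (f_ n)) ->
  (forall n x, `|f_ n x| <= C * e x) -> (forall x, f_ ^~ x @ \oo --> f x) ->
  null_class f.
Proof.
move=> Vf fC cf.
have [|||fi lim] := dct (f_ := fun n x => W x * f_ n x) (f := fun x => W x * f x)
    (g := fun x => C * `|W x * e x|) _ _ (intgZ C (intg_norm We)).
- by move=> n; exact: intg_meas (Vf n).1.
- by move=> x; apply: cvgMr; exact: cf.
- move=> n x; rewrite !normrM (ger0_norm (e0 _)).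
  by rewrite mulrCA ler_wpM2l.
split=> //; move: lim; under eq_cvg do rewrite (Vf _).2.
by move=> /(cvg_unique _ (cvg_cst 0)) ->.
Qed.

End null_class.

Section trigonometric_uniqueness.
Context d (T : measurableType d) (R : realType) (mu : {measure set T -> \bar R}).
Variables (W X : T -> R).
Hypotheses (Wi : intg mu W) (mX : measurable_fun setT X).
(* The image of [W dmu] under [X] has a vanishing Fourier transform. *)
Hypothesis W0 : forall xi p : R, \int[mu]_x (W x * cos (xi * X x + p)) = 0.

Let bmeas (h : T -> R) :=
  measurable_fun setT h /\ exists C, forall x, `|h x| <= C.

(** All frequencies and phases are required at once; this is what makes the class stable under
    multiplication by a cosine. *)
Let ann (h : T -> R) := bmeas h /\
  forall xi p : R, \int[mu]_x (W x * (h x * cos (xi * X x + p))) = 0.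

(* Multipliers of [ann]: a bounded-pointwise closed algebra that contains the
   functions [cos (eta * X x + q)]. *)
Let mult (m : T -> R) := bmeas m /\ forall h, ann h -> ann (fun x => m x * h x).

Let measurable_cosX xi p : measurable_fun setT (fun x => cos (xi * X x + p)).
Proof.
apply: (measurableT_comp (continuous_measurable_fun (@continuous_cos R))).
by apply: measurable_funD => //; exact: measurable_funM.
Qed.

Let bmeasM f g : bmeas f -> bmeas g -> bmeas (fun x => f x * g x).
Proof.
move=> [mf [C fC]] [mg [D gD]]; split; first exact: measurable_funM.
by exists (C * D) => x; rewrite normrM ler_pM.
Qed.

Let bmeasZ c f : bmeas f -> bmeas (fun x => c * f x).
Proof.
by apply: bmeasM; split=> //; exists `|c|.
Qed.

Let bmeasD f g : bmeas f -> bmeas g -> bmeas (fun x => f x + g x).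
Proof.
move=> [mf [C fC]] [mg [D gD]]; split; first exact: measurable_funD.
by exists (C + D) => x; rewrite (le_trans (ler_normD _ _))// lerD.
Qed.

Let bmeas_cos xi p : bmeas (fun x => cos (xi * X x + p)).
Proof. by split=> //; exists 1 => x; rewrite ler_norml cos_geN1 cos_le1. Qed.

Let bmeas_int f : bmeas f -> intg mu (fun x => W x * f x).
Proof. by move=> [mf [C fC]]; exact: (intgM_bounded (C := C)). Qed.

Let bmeas_lim (f_ : nat -> T -> R) f C : (forall n, bmeas (f_ n)) ->
  (forall n x, `|f_ n x| <= C) -> (forall x, f_ ^~ x @ \oo --> f x) ->
  bmeas f /\ (\int[mu]_x (W x * f_ n x) @[n --> \oo] --> \int[mu]_x (W x * f x)).
Proof.
move=> bf fC cf.
have mf : measurable_fun setT f.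
  by apply: (measurable_fun_cvg (h := f_)) => [n|x _]; [case: (bf n)|exact: cf].
split.
  split=> //; exists C => x.
  have c : `|f_ n x| @[n --> \oo] --> `|f x| by exact: cvg_norm (cf x).
  by apply: (cvgr_to_le c); exact: nearW.
apply: (dct (f_ := fun n x => W x * f_ n x) (g := fun x => C * `|W x|) _ _ _ _).2.
- by move=> n; apply: measurable_funM; [exact: intg_meas Wi|case: (bf n)].
- by move=> x; apply: cvgMr; exact: cf.
- by apply: intgZ; exact: intg_norm.
- by move=> n x; rewrite normrM mulrC ler_wpM2r.
Qed.

Let ann_lim (f_ : nat -> T -> R) f C : (forall n, ann (f_ n)) ->
  (forall n x, `|f_ n x| <= C) -> (forall x, f_ ^~ x @ \oo --> f x) -> ann f.
Proof.
move=> af fC cf.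
have [bf _] := bmeas_lim (fun n => (af n).1) fC cf; split=> // xi p.
have c1 x : `|cos (xi * X x + p)| <= 1 by rewrite ler_norml cos_geN1 cos_le1.
have [] := @bmeas_lim (fun n x => f_ n x * cos (xi * X x + p))
  (fun x => f x * cos (xi * X x + p)) C.
- by move=> n; apply: bmeasM; [exact: (af n).1|exact: bmeas_cos].
- by move=> n x; rewrite normrM -[leRHS]mulr1 ler_pM.
- by move=> x; apply: cvgMl; exact: cf.
move=> _; under eq_cvg do rewrite (af _).2.
by move=> /(cvg_unique _ (cvg_cst 0)) ->.
Qed.

Let annZ c f : ann f -> ann (fun x => c * f x).
Proof.
move=> [bf f0]; split=> [|xi p]; first exact: bmeasZ.
under eq_Rintegral do rewrite -mulrA mulrCA.
rewrite RintegralZl//; first by rewrite f0 mulr0.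
by apply: bmeas_int; exact: bmeasM.
Qed.

Let annD f g : ann f -> ann g -> ann (fun x => f x + g x).
Proof.
move=> [bf f0] [bg g0]; split=> [|xi p]; first exact: bmeasD.
under eq_Rintegral do rewrite mulrDl mulrDr.
rewrite RintegralD//; first by rewrite f0 g0 addr0.
- by apply: bmeas_int; exact: bmeasM.
- by apply: bmeas_int; exact: bmeasM.
Qed.

Let ann1 : ann (fun=> 1).
Proof.
split; first by split=> //; exists 1 => x; rewrite normr1.
by move=> xi p; under eq_Rintegral do rewrite mul1r.
Qed.

Let mult_cst c : mult (fun=> c).
Proof. split=> [|h ah]; last exact: annZ.
by split=> //; exists `|c|. Qed.

Let multM m n : mult m -> mult n -> mult (fun x => m x * n x).
Proof.
move=> [bm Am] [bn An]; split=> [|h ah]; first exact: bmeasM.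
by under eq_fun do rewrite -mulrA; exact/Am/An.
Qed.

Let multD m n : mult m -> mult n -> mult (fun x => m x + n x).
Proof.
move=> [bm Am] [bn An]; split=> [|h ah]; first exact: bmeasD.
by under eq_fun do rewrite mulrDl; apply: annD; [exact: Am|exact: An].
Qed.

Let mult1B m : mult m -> mult (fun x => 1 - m x).
Proof.
move=> mm; have := multD (mult_cst 1) (multM (mult_cst (-1)) mm).
by under eq_fun do rewrite mulN1r.
Qed.

Let multX m n : mult m -> mult (fun x => m x ^+ n).
Proof.
move=> mm; elim: n => [|n IH]; first exact: mult_cst.
by under eq_fun do rewrite exprS; exact: multM.
Qed.

Let mult_lim (m_ : nat -> T -> R) m C : (forall n, mult (m_ n)) ->
  (forall n x, `|m_ n x| <= C) -> (forall x, m_ ^~ x @ \oo --> m x) -> mult m.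
Proof.
move=> mm mC cm; have [bm _] := bmeas_lim (fun n => (mm n).1) mC cm.
split=> // h ah; have [[mh [D hD]] _] := ah.
apply: (ann_lim (f_ := fun n x => m_ n x * h x) (C := C * D)).
- by move=> n; exact: (mm n).2.
- by move=> n x; rewrite normrM ler_pM.
- by move=> x; apply: cvgMl; exact: cm.
Qed.

Let mult_cos eta q : mult (fun x => cos (eta * X x + q)).
Proof.
split=> [|h [bh h0]]; first exact: bmeas_cos.
split=> [|xi p]; first exact: bmeasM.
(* Product to sum: multiplying by a cosine only shifts frequency and phase. *)
transitivity (\int[mu]_x (2^-1 * (W x * (h x * cos ((xi + eta) * X x + (p + q)))
   + W x * (h x * cos ((xi - eta) * X x + (p - q)))))).
  apply: eq_Rintegral => x _; set A := xi * X x + p; set B := eta * X x + q.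
  rewrite (_ : (_ + _) * _ + _ = A + B); last by rewrite /A /B; ring.
  rewrite (_ : (_ - _) * _ + _ = A - B); last by rewrite /A /B; ring.
  by rewrite (cosD A) (cosB A); field.
have i1 u v : intg mu (fun x => W x * (h x * cos (u * X x + v))).
  by apply: bmeas_int; exact: bmeasM.
by rewrite RintegralZl ?RintegralD ?h0 ?addr0 ?mulr0//; exact: intgD.
Qed.

Let mult_sin xi a : mult (fun x => sin (xi * (X x - a))).
Proof.
have := mult_cos xi (- (xi * a) - pi / 2); congr mult; apply/funext => x.
by rewrite addrA cosBpihalf mulrBr.
Qed.

Let mult_sin_eq0 xi a : mult (fun x => (sin (xi * (X x - a)) == 0)%:R).
Proof.
have s2 x : 0 <= sin (xi * (X x - a)) ^+ 2 <= 1.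
  rewrite sqr_ge0 sin2cos2 lerBlDr lerDl sqr_ge0 //.
apply: (mult_lim (m_ := fun n x => (1 - sin (xi * (X x - a)) ^+ 2) ^+ n) (C := 1)).
- by move=> n; exact/multX/mult1B/multX/mult_sin.
- move=> n x; have /andP[s0 s1] := s2 x.
  by rewrite ger0_norm ?exprn_ge0 ?exprn_ile1//; lra.
- move=> x; have /andP[s0 s1] := s2 x.
  have [->|sn0] := eqVneq (sin (xi * (X x - a))) 0.
    by under eq_fun do rewrite expr0n subr0 expr1n; exact: cvg_cst.
  have {}sn0 : 0 < sin (xi * (X x - a)) ^+ 2 by rewrite lt_def sqrf_eq0 sn0.
  by apply: cvg_expr0; rewrite ger0_norm; lra.
Qed.

Let mult_sin_lt0 xi a : mult (fun x => (sin (xi * (X x - a)) < 0)%R%:R).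
Proof.
pose s x := 2^-1 * (1 + sin (xi * (X x - a))).
have ms : mult s by apply/multM/multD/mult_sin.
have s01 x : 0 <= s x <= 1.
  by rewrite /s; have := sin_geN1 (xi * (X x - a));
    have := sin_le1 (xi * (X x - a)); lra.
(* Where the sine vanishes, s = 1/2 and the threshold powers tend to e^(-1); the first factor
   removes these points. *)
apply: (mult_lim (m_ := fun n x => (1 - (sin (xi * (X x - a)) == 0)%:R) *
    (1 - s x ^+ n) ^+ (2 ^ n)) (C := 1)).
- by move=> n; apply: multM; [exact/mult1B/mult_sin_eq0|exact/multX/mult1B/multX].
- move=> n x; have /andP[s0 s1] := s01 x.
  have sn : s x ^+ n <= 1 by rewrite exprn_ile1.
  have sn0 : 0 <= s x ^+ n by rewrite exprn_ge0.
  rewrite normrM -[leRHS]mulr1 ler_pM//.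
    by case: (_ == _); rewrite ?subrr ?normr0 ?subr0 ?normr1.
  by rewrite ger0_norm ?exprn_ge0 ?exprn_ile1//; lra.
- move=> x; have /andP[s0 s1] := s01 x.
  case: ltgtP => [lt0|gt0|_] /=; last first.
  + by rewrite subrr; under eq_fun do rewrite mul0r; exact: cvg_cst.
  + rewrite subr0; under eq_fun do rewrite mul1r.
    by apply: cvg_threshold_hi => //; rewrite /s; lra.
  + rewrite subr0; under eq_fun do rewrite mul1r.
    by apply: cvg_threshold_lo => //; rewrite /s; lra.
Qed.

Let mult_ray a : mult (fun x => (X x < a)%R%:R).
Proof.
(* At low frequency the half-periods next to a grow without bound: once |X x - a| < n + 1 the
   argument lies in ]-1, 1[, where the sine has the sign of its argument. *)
apply: (mult_lim (m_ := fun n x => (sin (n.+1%:R^-1 * (X x - a)) < 0)%R%:R) (C := 1)).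
- by move=> n; exact: mult_sin_lt0.
- by move=> n x; case: (_ < _); rewrite ?normr1 ?normr0.
- move=> x; apply: cvg_near_cst.
  have : \forall n \near \oo, `|X x - a| < n.+1%:R.
    near=> n; apply: lt_trans (_ : n%:R < _); last by rewrite ltr_nat.
    by near: n; exact: nbhs_infty_gtr.
  apply: filterS => n; rewrite ltr_norml => /andP[lo hi]; congr (nat_of_bool _)%:R.
  have n0 : 0 < n.+1%:R^-1 :> R by rewrite invr_gt0.
  set y := n.+1%:R^-1 * (X x - a).
  have y1 : -1 < y < 1.
    by rewrite /y mulrC ltr_pdivlMr// ltr_pdivrMr// mulN1r mul1r lo hi.
  have yE : (X x < a) = (y < 0) by rewrite /y pmulr_rlt0// subr_lt0.
  rewrite yE; case: (ltgtP y 0) => [y0|y0|->].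
  + by rewrite -oppr_gt0 -sinN sin2_gt0//; lra.
  + by apply/negbTE; rewrite -leNgt ltW// sin2_gt0//; lra.
  + by rewrite sin0 ltxx.
Unshelve. all: by end_near. Qed.

Let ann_set A : measurable A -> ann (fun x => \1_A (X x)).
Proof.
move=> mA.
have := @class_dynkin _ _ ann (fun=> 1) annZ _ _ _ _ X
  (@RGenInftyO.G R) (fun=> 1) 1 _ _ _ ann1 _ A mA.
move=> H; suff : ann (fun x => \1_A (X x) * 1) by under eq_fun do rewrite mulr1.
apply: H.
- by move=> f g af ag; have := annD af (annZ (-1) ag);
    under eq_fun do rewrite mulN1r.
- by move=> h_ h C ah hC ch; apply: (ann_lim (C := C) ah) => // n x;
    rewrite (le_trans (hC n x))// mulr1.
- exact: RGenInftyO.measurableE.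
- move=> _ _ [a ->] [b ->]; exists (Num.min a b).
  by apply/seteqP; split=> x /=; rewrite !in_itv/= lt_min => /andP.
- by move=> x; rewrite normr1 mulr1.
- move=> _ [a ->]; have := (mult_ray a).2 _ ann1; congr ann.
  apply/funext => x; congr (_ * _); rewrite indicE; congr (nat_of_bool _)%:R.
  by apply/idP/idP => [xa|/set_mem]; rewrite ?inE /= ?in_itv/=.
Qed.

(** The indicators of Borel sets of X are reached through bounded multipliers; [h] itself is then
    reached with [h (X x) + 1] as dominating function. Unbounded [h] matter later, when a Gaussian
    factor has to be divided out. *)
Lemma trig_unique (h : R -> R) : measurable_fun setT h -> (forall y, 0 <= h y) ->
  intg mu (fun x => W x * h (X x)) -> \int[mu]_x (W x * h (X x)) = 0.
Proof.
move=> mh h0 Whi.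
suff : null_class mu W (fun x => h (X x) * 1).
  by move=> [_]; under eq_Rintegral do rewrite mulr1.
have We : intg mu (fun x => W x * (h (X x) + 1)).
  by under eq_fun do rewrite mulrDr mulr1; exact: intgD.
apply: (@class_fun _ _ (null_class mu W) (fun x => h (X x) + 1) _ _ _ _ _ X (fun=> 1) 1) => //.
- by move=> c f; exact: null_classZ.
- by move=> f g; exact: null_classB.
- by move=> f_ f C; apply: null_class_lim => // x; rewrite addr_ge0.
- move=> A mA; have [bA A0] := ann_set mA; split.
    by under eq_fun do rewrite mulr1; exact: bmeas_int.
  by rewrite -[RHS](A0 0 0); apply: eq_Rintegral => x _; rewrite mul0r addr0 cos0.
- by move=> x; rewrite mulr1 mul1r ger0_norm// lerDl.
Qed.

End trigonometric_uniqueness.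

(** * Complex exponentials and integrals *)

Section exponential_polynomials.
Variable F : numFieldType.
Implicit Types x y : F.

(** The field is arbitrary so that the same identities hold over [R] and over [R[i]], and the
    complex remainders can be compared with the real ones. *)
Definition expS N x : F := \sum_(i < N) x ^+ i / i`!%:R.

Lemma expSS N x : expS N.+1 x = expS N x + x ^+ N / N`!%:R.
Proof. by rewrite /expS big_ord_recr. Qed.

Lemma exp_term_add N x y : (x + y) ^+ N / N`!%:R =
  \sum_(j < N.+1) (x ^+ j / j`!%:R) * (y ^+ (N - j) / (N - j)`!%:R).
Proof.
rewrite addrC exprDn mulr_suml; apply: eq_bigr => -[j /= jN] _.
have fact0 n : n`!%:R != 0 :> F by rewrite pnatr_eq0 -lt0n fact_gt0.
have /(congr1 (fun n => n%:R : F)) := bin_fact (m := j) (n := N) jN.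
rewrite !natrM => <-; rewrite -mulr_natr.
have c0 : 'C(N, j)%:R != 0 :> F by rewrite pnatr_eq0 -lt0n bin_gt0.
by field; rewrite !fact0 c0.
Qed.

Lemma expS_add N x y : expS N (x + y) =
  \sum_(j < N) \sum_(0 <= l < N - j) (x ^+ j / j`!%:R) * (y ^+ l / l`!%:R).
Proof.
elim: N => [|N IH]; first by rewrite /expS !big_ord0.
rewrite expSS IH exp_term_add [RHS]big_ord_recr/= subSnn big_nat1.
rewrite [X in _ + X]big_ord_recr/= subnn addrA -big_split/=; congr (_ + _).
by apply: eq_bigr => -[j /= jN] _; rewrite subSn ?(ltnW jN)// big_nat_recr.
Qed.

(** What remains are the monomials of total degree at least N. Their coefficients are nonnegative,
    so the remainder at complex arguments is bounded by the remainder at their moduli. *)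
Lemma expS_mul N x y : expS N x * expS N y - expS N (x + y) =
  \sum_(j < N) \sum_(N - j <= l < N) (x ^+ j / j`!%:R) * (y ^+ l / l`!%:R).
Proof.
rewrite expS_add {1 2}/expS mulr_suml -sumrB; apply: eq_bigr => j _.
rewrite mulr_sumr -(big_mkord xpredT (fun l => _ * (y ^+ l / l`!%:R))).
by rewrite (@big_cat_nat _ _ _ (N - j))//= ?leq_subr// addrC addrK.
Qed.

End exponential_polynomials.

Section complex_exponential.
Variable R : realType.
Implicit Types (z w : R[i]) (x y : R).

Lemma cReM z w : Re (z * w) = Re z * Re w - Im z * Im w.
Proof. by case: z w => [? ?] []. Qed.

Lemma cImM z w : Im (z * w) = Re z * Im w + Im z * Re w.
Proof. by case: z w => [? ?] []. Qed.

Lemma cReB z w : Re (z - w) = Re z - Re w.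
Proof. by case: z w => [? ?] []. Qed.

Lemma cImB z w : Im (z - w) = Im z - Im w.
Proof. by case: z w => [? ?] []. Qed.

Lemma normc_re z : `|Re z| <= normc z.
Proof.
case: z => a b /=; rewrite -sqrtr_sqr ler_wsqrtr// lerDl sqr_ge0 //.
Qed.

Lemma normc_im z : `|Im z| <= normc z.
Proof.
case: z => a b /=; rewrite -sqrtr_sqr ler_wsqrtr// lerDr sqr_ge0 //.
Qed.

Lemma normc_ge0 z : 0 <= normc z.
Proof. by case: z => a b; rewrite /= sqrtr_ge0. Qed.

Lemma normc_real x : normc x%:C%C = `|x|.
Proof. by rewrite /= expr0n addr0 sqrtr_sqr. Qed.

Lemma normcX z n : normc (z ^+ n) = normc z ^+ n.
Proof.
elim: n => [|n IH]; first by rewrite !expr0 ComplexField.Normc.normc1.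
by rewrite !exprS ComplexField.Normc.normcM IH.
Qed.

Lemma natr_complex n : n%:R = (n%:R : R)%:C%C :> R[i].
Proof. by rewrite rmorph_nat. Qed.

Lemma normc_nat n : normc (n%:R : R[i]) = n%:R.
Proof. by rewrite natr_complex normc_real normr_nat. Qed.

Lemma normc_sum I (s : seq I) (P : pred I) (F : I -> R[i]) :
  normc (\sum_(i <- s | P i) F i) <= \sum_(i <- s | P i) normc (F i).
Proof.
elim/big_ind2 : _ => //; first by rewrite ComplexField.Normc.normc0.
by move=> a b c e h1 h2; rewrite (le_trans (le_normcD _ _))// lerD.
Qed.

Lemma normc_term z i : normc (z ^+ i / i`!%:R) = normc z ^+ i / i`!%:R.
Proof.
by rewrite ComplexField.Normc.normcM ComplexField.Normc.normcV normcX normc_nat.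
Qed.

Lemma expS_series x : (fun N => expS N x) = series (exp_coeff x).
Proof. by apply/funext => N; rewrite /expS /series/= big_mkord. Qed.

Lemma cvg_expS x : expS N x @[N --> \oo] --> expR x.
Proof. by rewrite expS_series; exact: is_cvg_series_exp_coeff. Qed.

Lemma expS_le N x : 0 <= x -> expS N x <= expR x.
Proof.
move=> x0; rewrite -[expS N x]/((fun N => expS N x) N) expS_series.
apply: nondecreasing_cvgn_le; last exact: is_cvg_series_exp_coeff.
apply: nondecreasing_series => n _ _.
by rewrite /exp_coeff/= divr_ge0 ?exprn_ge0.
Qed.

Lemma normc_expS N z : normc (expS N z) <= expR (normc z).
Proof.
apply: le_trans (expS_le N (normc_ge0 z)).
by apply: le_trans (normc_sum _ _ _) _; apply: ler_sum => i _; rewrite normc_term.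
Qed.

Definition cis x : R[i] := (cos x +i* sin x)%C.
Definition cexp z : R[i] := (expR (Re z))%:C%C * cis (Im z).

Lemma cisD x y : cis (x + y) = cis x * cis y.
Proof. by rewrite /cis cosD sinD; apply/eqP; rewrite eq_complex /= eqxx addrC eqxx. Qed.

Lemma cis0 : cis 0 = 1. Proof. by rewrite /cis cos0 sin0. Qed.

Lemma cisN x : cis (- x) * cis x = 1.
Proof. by rewrite -cisD addNr cis0. Qed.

Lemma cisX n x : cis (n%:R * x) = cis x ^+ n.
Proof.
elim: n => [|n IH]; first by rewrite mul0r cis0.
by rewrite exprS -IH -cisD -natr1; congr cis; ring.
Qed.

Lemma normc_cis x : normc (cis x) = 1.
Proof. by rewrite /= cos2Dsin2 sqrtr1. Qed.

Lemma normc_cexp z : normc (cexp z) = expR (Re z).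
Proof.
by rewrite ComplexField.Normc.normcM normc_cis mulr1 normc_real ger0_norm ?expR_ge0.
Qed.

Definition ccvg (u : nat -> R[i]) (l : R[i]) :=
  (Re (u n) @[n --> \oo] --> Re l) /\ (Im (u n) @[n --> \oo] --> Im l).

Lemma ccvgM u v l m : ccvg u l -> ccvg v m -> ccvg (fun n => u n * v n) (l * m).
Proof.
move=> [ur ui] [vr vi]; split.
  by rewrite cReM; under eq_cvg do rewrite cReM; apply: cvgB; apply: cvgM.
by rewrite cImM; under eq_cvg do rewrite cImM; apply: cvgD; apply: cvgM.
Qed.

Lemma ccvg_squeeze u v l (e : nat -> R) : ccvg u l ->
  (forall n, normc (v n - u n) <= e n) -> e n @[n --> \oo] --> (0 : R) -> ccvg v l.
Proof.
move=> [ur ui] vu e0.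
have D (p : R[i] -> R) : (forall z, `|p z| <= normc z) ->
    p (v n - u n) @[n --> \oo] --> (0 : R).
  move=> pN; apply/norm_cvg0P; apply: (@squeeze_cvgr _ _ _ _ (fun=> 0) e) => //.
    by apply: nearW => n; rewrite normr_ge0 (le_trans (pN _)).
  exact: cvg_cst.
split.
  rewrite (_ : (fun n => Re (v n)) = fun n => Re (u n) + Re (v n - u n)).
    by rewrite -[X in _ --> X]addr0; exact: cvgD ur (D _ normc_re).
  by apply/funext => n; rewrite cReB addrC subrK.
rewrite (_ : (fun n => Im (v n)) = fun n => Im (u n) + Im (v n - u n)).
  by rewrite -[X in _ --> X]addr0; exact: cvgD ui (D _ normc_im).
by apply/funext => n; rewrite cImB addrC subrK.
Qed.

Lemma expS_real N x : expS N x%:C%C = (expS N x)%:C%C.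
Proof.
rewrite /expS rmorph_sum; apply: eq_bigr => i _.
by rewrite natr_complex rmorphM rmorphXn fmorphV.
Qed.

Lemma complex_eq z w : Re z = Re w -> Im z = Im w -> z = w.
Proof. by case: z w => [? ?] [? ?] /= -> ->. Qed.

Lemma imag_term x n : ((0 +i* x)%C : R[i]) ^+ n / n`!%:R =
  (cos_coeff x n +i* sin_coeff x n)%C.
Proof.
have iE : ((0 +i* x)%C : R[i]) = 'i%C * x%:C%C by apply: complex_eq => /=; ring.
rewrite iE exprMn -rmorphXn natr_complex -fmorphV -mulrA -rmorphM/=.
have i2 k : ('i%C : R[i]) ^+ k.*2 = ((-1) ^+ k)%:C%C.
  by rewrite -muln2 mulnC exprM sqr_i rmorphXn rmorphN1.
rewrite /cos_coeff /sin_coeff/= -[in 'i%C ^+ n](odd_double_half n).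
have [no|/negbTE no] := boolP (odd n); rewrite ?no/=.
  have -> : n.-1./2 = n./2 by rewrite -[in LHS](odd_double_half n) no/= doubleK.
  by rewrite add1n exprS i2; apply: complex_eq => /=; ring.
by rewrite add0n i2 -exprnP; apply: complex_eq => /=; ring.
Qed.

Lemma ccvg_expS_imag x : ccvg (fun N => expS N ((0 +i* x)%C : R[i])) (cis x).
Proof.
have E N : expS N ((0 +i* x)%C : R[i]) =
    (series (cos_coeff x) N +i* series (sin_coeff x) N)%C.
  rewrite /expS /series/= !big_mkord; elim: N => [|N IH].
    by rewrite !big_ord0.
  by rewrite !big_ord_recr/= IH imag_term.
split; under eq_cvg do rewrite E /=.
  by rewrite /cis/= unlock; exact: is_cvg_series_cos_coeff.
by rewrite /cis/= unlock; exact: is_cvg_series_sin_coeff.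
Qed.

(** The real and the imaginary exponential converge separately. The defect of multiplicativity is at
    most the same defect at |a| and |b|, which tends to 0 because the real exponential is
    multiplicative. *)
Lemma ccvg_expS z : ccvg (fun N => expS N z) (cexp z).
Proof.
case: z => a b.
apply: (@ccvg_squeeze (fun N => expS N a%:C%C * expS N (0 +i* b)%C) _ _
  (fun N => expS N `|a| * expS N `|b| - expS N (`|a| + `|b|))).
- apply: ccvgM; last exact: ccvg_expS_imag.
  split; under eq_cvg do rewrite expS_real; last exact: cvg_cst.
  exact: cvg_expS.
- move=> N; rewrite -normcN opprB.
  have -> : (a +i* b)%C = a%:C%C + (0 +i* b)%C :> R[i] by apply: complex_eq => /=; ring.
  rewrite !expS_mul; apply: le_trans (normc_sum _ _ _) _; apply: ler_sum => j _.
  apply: le_trans (normc_sum _ _ _) _; apply: ler_sum => l _.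
  rewrite ComplexField.Normc.normcM !normc_term normc_real/=.
  by rewrite expr0n add0r sqrtr_sqr.
- rewrite -(subrr (expR `|a| * expR `|b|)); apply: cvgB.
    by apply: cvgM; exact: cvg_expS.
  by rewrite -expRD; exact: cvg_expS.
Qed.

End complex_exponential.

Section complex_integrals.
Context d (T : measurableType d) (R : realType) (mu : {measure set T -> \bar R}).
Implicit Types f g h : T -> R[i].

Definition cmeas f :=
  measurable_fun setT (fun x => Re (f x)) /\ measurable_fun setT (fun x => Im (f x)).

Definition cintg f := intg mu (fun x => Re (f x)) /\ intg mu (fun x => Im (f x)).

Definition cint f : R[i] :=
  (\int[mu]_x Re (f x) +i* \int[mu]_x Im (f x))%C.

Lemma cReD (z w : R[i]) : Re (z + w) = Re z + Re w.
Proof. by case: z w => [? ?] []. Qed.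

Lemma cImD (z w : R[i]) : Im (z + w) = Im z + Im w.
Proof. by case: z w => [? ?] []. Qed.

Lemma Re_mulf f g : (fun x => Re (f x * g x)) =
  (fun x => Re (f x) * Re (g x) - Im (f x) * Im (g x)).
Proof. by apply/funext => x; rewrite cReM. Qed.

Lemma Im_mulf f g : (fun x => Im (f x * g x)) =
  (fun x => Re (f x) * Im (g x) + Im (f x) * Re (g x)).
Proof. by apply/funext => x; rewrite cImM. Qed.

Lemma Re_addf f g : (fun x => Re (f x + g x)) = (fun x => Re (f x) + Re (g x)).
Proof. by apply/funext => x; rewrite cReD. Qed.

Lemma Im_addf f g : (fun x => Im (f x + g x)) = (fun x => Im (f x) + Im (g x)).
Proof. by apply/funext => x; rewrite cImD. Qed.

Lemma cmeas_real (w : T -> R) : measurable_fun setT w -> cmeas (fun x => (w x)%:C%C).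
Proof. by move=> mw; split. Qed.

Lemma cmeas_cst (c : R[i]) : cmeas (fun=> c).
Proof. by split. Qed.

Lemma cmeasM f g : cmeas f -> cmeas g -> cmeas (fun x => f x * g x).
Proof.
move=> [fr fi] [gr gi]; split.
  by rewrite Re_mulf; apply: measurable_funB; exact: measurable_funM.
by rewrite Im_mulf; apply: measurable_funD; exact: measurable_funM.
Qed.

Lemma cmeasD f g : cmeas f -> cmeas g -> cmeas (fun x => f x + g x).
Proof.
move=> [fr fi] [gr gi]; split.
  by rewrite Re_addf; exact: measurable_funD.
by rewrite Im_addf; exact: measurable_funD.
Qed.

Lemma cmeasX f n : cmeas f -> cmeas (fun x => f x ^+ n).
Proof.
move=> mf; elim: n => [|n IH]; first exact: cmeas_cst.
by rewrite (_ : (fun _ => _) = fun x => f x * f x ^+ n); [exact: cmeasM|apply/funext => x;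
  rewrite exprS].
Qed.

Lemma cmeas_sum I (s : seq I) (F : I -> T -> R[i]) : (forall i, cmeas (F i)) ->
  cmeas (fun x => \sum_(i <- s) F i x).
Proof.
move=> mF; elim: s => [|i s IH].
  by rewrite (_ : (fun _ => _) = fun=> 0); [exact: cmeas_cst|apply/funext => x; rewrite big_nil].
rewrite (_ : (fun _ => _) = fun x => F i x + \sum_(j <- s) F j x); first exact: cmeasD.
by apply/funext => x; rewrite big_cons.
Qed.

Lemma cmeas_cis (w : T -> R) : measurable_fun setT w -> cmeas (fun x => cis (w x)).
Proof.
move=> mw; split.
  exact: (measurableT_comp (continuous_measurable_fun (@continuous_cos R))).
exact: (measurableT_comp (continuous_measurable_fun (@continuous_sin R))).
Qed.

Lemma cmeas_cexp f : cmeas f -> cmeas (fun x => cexp (f x)).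
Proof.
move=> [fr fi]; apply: cmeasM; last exact: cmeas_cis.
by apply: cmeas_real; exact: measurableT_comp.
Qed.

Lemma cmeas_expS N f : cmeas f -> cmeas (fun x => expS N (f x)).
Proof.
move=> mf; rewrite /expS; apply: cmeas_sum => i.
by apply: cmeasM; [exact: cmeasX|exact: cmeas_cst].
Qed.

Lemma cintg_meas f : cintg f -> cmeas f.
Proof. by move=> [fr fi]; split; [exact: intg_meas fr|exact: intg_meas fi]. Qed.

Lemma cintg_le f (g : T -> R) : cmeas f -> intg mu g ->
  (forall x, normc (f x) <= g x) -> cintg f.
Proof.
move=> [fr fi] gi fg; split; apply: (intg_le (g := g)) => // x.
  exact: le_trans (normc_re _) (fg x).
exact: le_trans (normc_im _) (fg x).
Qed.

Lemma cintgD f g : cintg f -> cintg g -> cintg (fun x => f x + g x).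
Proof.
move=> [fr fi] [gr gi]; split.
  by rewrite Re_addf; exact: intgD.
by rewrite Im_addf; exact: intgD.
Qed.

Lemma cintgZ c f : cintg f -> cintg (fun x => c * f x).
Proof.
move=> [fr fi]; split.
  by rewrite Re_mulf; apply: intgB; exact: intgZ.
by rewrite Im_mulf; apply: intgD; exact: intgZ.
Qed.

Lemma cintg0 : cintg (fun=> 0).
Proof.
have i0 : intg mu (fun=> 0 : R).
  by have := integrable0 mu setT; apply: eq_integrable.
by split.
Qed.

Lemma cint0 : cint (fun=> 0) = 0.
Proof. by rewrite /cint /Rintegral /= !integral0. Qed.

Lemma cintD f g : cintg f -> cintg g -> cint (fun x => f x + g x) = cint f + cint g.
Proof.
move=> [fr fi] [gr gi]; apply: complex_eq; rewrite /cint ?cReD ?cImD /=.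
  by under eq_Rintegral do rewrite cReD; rewrite RintegralD.
by under eq_Rintegral do rewrite cImD; rewrite RintegralD.
Qed.

Lemma cintZ c f : cintg f -> cint (fun x => c * f x) = c * cint f.
Proof.
move=> [fr fi]; apply: complex_eq; rewrite /cint ?cReM ?cImM /=.
  under eq_Rintegral do rewrite cReM.
  by rewrite RintegralB ?RintegralZl//; exact: intgZ.
under eq_Rintegral do rewrite cImM.
by rewrite RintegralD ?RintegralZl//; exact: intgZ.
Qed.

Lemma cintg_sum I (s : seq I) (F : I -> T -> R[i]) : (forall i, cintg (F i)) ->
  cintg (fun x => \sum_(i <- s) F i x).
Proof.
move=> mF; elim: s => [|i s IH].
  by rewrite (_ : (fun _ => _) = fun=> 0); [exact: cintg0|apply/funext => x; rewrite big_nil].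
rewrite (_ : (fun _ => _) = fun x => F i x + \sum_(j <- s) F j x); first exact: cintgD.
by apply/funext => x; rewrite big_cons.
Qed.

Lemma cint_sum I (s : seq I) (F : I -> T -> R[i]) : (forall i, cintg (F i)) ->
  cint (fun x => \sum_(i <- s) F i x) = \sum_(i <- s) cint (F i).
Proof.
move=> mF; elim: s => [|i s IH].
  rewrite big_nil (_ : (fun _ => _) = fun=> 0) ?cint0//.
  by apply/funext => x; rewrite big_nil.
rewrite (_ : (fun _ => _) = fun x => F i x + \sum_(j <- s) F j x); last first.
  by apply/funext => x; rewrite big_cons.
by rewrite cintD ?IH ?big_cons//; exact: cintg_sum.
Qed.

Lemma cintg_bounded C (w : T -> R) h : intg mu w -> cmeas h ->
  (forall x, normc (h x) <= C) -> cintg (fun x => (w x)%:C%C * h x).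
Proof.
move=> wi mh hC; apply: (cintg_le (g := fun x => C * `|w x|)).
- by apply: cmeasM => //; apply: cmeas_real; exact: intg_meas wi.
- by apply: intgZ; exact: intg_norm.
- by move=> x; rewrite ComplexField.Normc.normcM normc_real mulrC ler_wpM2r.
Qed.

Lemma cdct (f_ : nat -> T -> R[i]) f (g : T -> R) : (forall n, cmeas (f_ n)) ->
  (forall x, ccvg (f_ ^~ x) (f x)) -> intg mu g ->
  (forall n x, normc (f_ n x) <= g x) ->
  cintg f /\ ccvg (fun n => cint (f_ n)) (cint f).
Proof.
move=> mf cf gi fg.
have [fr lr] := dct (fun n => (mf n).1) (fun x => (cf x).1) gi
  (fun n x => le_trans (normc_re _) (fg n x)).
have [fi li] := dct (fun n => (mf n).2) (fun x => (cf x).2) gi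
  (fun n x => le_trans (normc_im _) (fg n x)).
by split; split.
Qed.

End complex_integrals.

Section ccvg_facts.
Variable R : realType.

Lemma ccvg_cst (l : R[i]) : ccvg (fun=> l) l.
Proof. by split; exact: cvg_cst. Qed.

Lemma ccvg_unique (u : nat -> R[i]) l m : ccvg u l -> ccvg u m -> l = m.
Proof.
move=> [ur ui] [vr vi]; apply: complex_eq.
  exact: (cvg_unique _ ur vr).
exact: (cvg_unique _ ui vi).
Qed.

Lemma ccvg_near (u v : nat -> R[i]) l N : (forall n, (N <= n)%N -> u n = v n) ->
  ccvg u l -> ccvg v l.
Proof.
move=> uv [ur ui]; split.
  apply: cvg_trans ur; apply: near_eq_cvg; exists N => // n /= Nn.
  by rewrite uv.
apply: cvg_trans ui; apply: near_eq_cvg; exists N => // n /= Nn.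
by rewrite uv.
Qed.

End ccvg_facts.

Section circle.
Variable R : realType.
Local Notation leb := (@lebesgue_measure R).

Definition turn (P : R) : set (measurableTypeR R) := `[0, P[%classic.

Lemma measurable_turn P : measurable (turn P).
Proof. exact: measurable_itv. Qed.

Lemma intg_turn P : intg leb (\1_(turn P) : _ -> R).
Proof.
exact: integrable_indic_itv.
Qed.

Lemma Rintegral_turn (f F : R -> R) P : 0 < P -> continuous f ->
  (forall x : R, is_derive x (1 : R) F (f x)) ->
  \int[leb]_x (\1_(turn P) x * f x) = F P - F 0.
Proof.
move=> P0 cf dF.
have -> : \int[leb]_x (\1_(turn P) x * f x) = \int[leb]_(x in turn P) f x.
  by rewrite [RHS]Rintegral_mkcond patch_indic; apply: eq_Rintegral => x _; rewrite mulrC.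
have fi : leb.-integrable `[0, P] (EFin \o f).
  apply: continuous_compact_integrable; first exact: segment_compact.
  exact: continuous_subspaceT.
rewrite Rintegral_itv_bndo_bndc; last first.
  by move: fi; apply: integrableS => //; exact: subset_itv_co_cc.
rewrite /Rintegral (@continuous_FTC2 _ f F)//.
- exact: continuous_subspaceT.
- have cF x : {for x, continuous F}.
    by apply: differentiable_continuous; apply/derivable1_diffP; case: (dF x).
  split.
  + by move=> x _; case: (dF x).
  + exact/cvg_at_right_filter/cF.
  + exact/cvg_at_left_filter/cF.
- by move=> x _; rewrite derive1E; case: (dF x).
Qed.

End circle.

(** * Integrals over one turn *)

Section circle_integrals.
Variable R : realType.
Local Notation leb := (@lebesgue_measure R).

Lemma cis_turn n : cis (n%:R * (2 * pi)) = 1 :> R[i].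
Proof.
rewrite cisX (_ : cis _ = 1) ?expr1n//.
by rewrite /cis mulr_natl cos2pi sin2pi.
Qed.

Lemma cis_turnB m n : cis ((m%:R - n%:R) * (2 * pi)) = 1 :> R[i].
Proof.
by rewrite -[RHS](cis_turn m) -[LHS]mulr1 -(cis_turn n) -cisD -mulrDl subrK.
Qed.

Lemma circle_orth (c P : R) : 0 < P -> c != 0 -> cis (c * P) = 1 ->
  cint leb (fun s => (\1_(turn P) s)%:C%C * cis (c * s)) = 0.
Proof.
move=> P0 c0 [cos1 sin0'].
have lin (x : R) : is_derive x (1 : R) (fun s : R => c * s) c.
  have := is_deriveZ c (is_derive_id x (1 : R)); congr is_derive.
  by rewrite /GRing.scale/= mulr1.
have clin : continuous (fun s : R => c * s).
  by move=> x; apply: cvgM; [exact: cvg_cst|exact: cvg_id].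
have dsin (x : R) : is_derive x (1 : R) (fun s : R => c^-1 * sin (c * s)) (cos (c * x)).
  have := is_deriveZ c^-1 (is_derive1_comp (is_derive_sin (c * x)) (lin x)).
  by congr is_derive; rewrite /GRing.scale/=; field.
have dcos (x : R) : is_derive x (1 : R) (fun s : R => - c^-1 * cos (c * s)) (sin (c * x)).
  have := is_deriveZ (- c^-1) (is_derive1_comp (is_derive_cos (c * x)) (lin x)).
  by congr is_derive; rewrite /GRing.scale/=; field.
apply: complex_eq => /=.
  transitivity (\int[leb]_s (\1_(turn P) s * cos (c * s))).
    by apply: eq_Rintegral => s _ /=; rewrite mul0r subr0.
  rewrite (Rintegral_turn P0 _ dsin).
    by rewrite sin0' !mulr0 sin0 mulr0 subrr.
  by move=> x; apply: continuous_comp; [exact: clin|exact: continuous_cos].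
transitivity (\int[leb]_s (\1_(turn P) s * sin (c * s))).
  by apply: eq_Rintegral => s _ /=; rewrite mul0r addr0.
rewrite (Rintegral_turn P0 _ dcos).
  by rewrite cos1 mulr0 cos0 subrr.
by move=> x; apply: continuous_comp; [exact: clin|exact: continuous_sin].
Qed.

Lemma circle_area (P : R) : 0 < P ->
  cint leb (fun s => (\1_(turn P) s)%:C%C * cis (0 * s)) = P%:C%C.
Proof.
move=> P0; apply: complex_eq => /=.
  transitivity (\int[leb]_s (\1_(turn P) s * 1)).
    by apply: eq_Rintegral => s _ /=; rewrite !mul0r cos0 subr0.
  rewrite (Rintegral_turn P0 _ (fun x => is_derive_id x (1 : R))) ?subr0//.
  exact: cst_continuous.
transitivity (\int[leb]_(s in [set: R]) (0 : R)).
  by apply: eq_Rintegral => s _ /=; rewrite !mul0r sin0 mulr0 addr0.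
by rewrite /Rintegral/= integral0.
Qed.

Section radius.
Variable r : R.
Hypothesis r0 : 0 < r.
Let P := r * (2 * pi).

Let P0 : 0 < P. Proof. by rewrite !mulr_gt0 ?pi_gt0. Qed.

Lemma circle_freq m n :
  cint leb (fun s => (\1_(turn P) s)%:C%C * cis ((m%:R - n%:R) / r * s)) =
  if m == n then P%:C%C else 0.
Proof.
have [->|mn] := eqVneq m n.
  by rewrite subrr mul0r; exact: circle_area.
apply: circle_orth => //.
  apply: mulf_neq0; last by rewrite invr_eq0 gt_eqF.
  by rewrite subr_eq0 eqr_nat.
by rewrite -[RHS](cis_turnB m n) mulrA divfK// gt_eqF.
Qed.

Lemma cintg_turn C (h : R -> R[i]) : cmeas (T := measurableTypeR R) h ->
  (forall s, normc (h s) <= C) ->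
  cintg leb (fun s => (\1_(turn P) s)%:C%C * h s).
Proof. by move=> mh hC; apply: (cintg_bounded (C := C)) => //; exact: intg_turn. Qed.

Lemma measurable_lin (c : R) : measurable_fun setT (fun s : measurableTypeR R => c * s).
Proof. exact: measurable_funM. Qed.

(** Only the term of degree n - a of the exponential series has frequency 0 against the first
    factor. The partial sums with N > n therefore all have the same integral, and dominated
    convergence passes to the exponential. *)
Lemma circle_exp a n (z : R[i]) :
  cint leb (fun s => (\1_(turn P) s)%:C%C *
    (cis ((a%:R - n%:R) / r * s) * cexp (z * cis (r^-1 * s)))) =
  if (a <= n)%N then P%:C%C * (z ^+ (n - a) / (n - a)`!%:R) else 0.
Proof.
pose w N s : R[i] := cis ((a%:R - n%:R) / r * s) * expS N (z * cis (r^-1 * s)).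
have mw N : cmeas (T := measurableTypeR R) (w N).
  apply: cmeasM; first by apply: cmeas_cis; exact: measurable_lin.
  apply: cmeas_expS; apply: cmeasM; first exact: cmeas_cst.
  by apply: cmeas_cis; exact: measurable_lin.
have wC N s : normc (w N s) <= expR (normc z).
  rewrite ComplexField.Normc.normcM normc_cis mul1r.
  apply: le_trans (normc_expS _ _) _.
  by rewrite ComplexField.Normc.normcM normc_cis mulr1.
have [|||_] := @cdct _ _ _ leb (fun N s => (\1_(turn P) s)%:C%C * w N s)
  (fun s => (\1_(turn P) s)%:C%C *
    (cis ((a%:R - n%:R) / r * s) * cexp (z * cis (r^-1 * s))))
  (fun s => expR (normc z) * \1_(turn P) s) _ _ (intgZ _ (intg_turn P)).
- move=> N; apply: cmeasM; last exact: mw.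
  by apply: cmeas_real; exact: (intg_meas (intg_turn P)).
- move=> s; apply: (ccvgM (ccvg_cst _)); apply: (ccvgM (ccvg_cst _)).
  exact: ccvg_expS.
- move=> N s; rewrite ComplexField.Normc.normcM normc_real ger0_norm// mulrC.
  by rewrite ler_wpM2r.
move=> lim; apply: (ccvg_unique lim).
have E N : cint leb (fun s => (\1_(turn P) s)%:C%C * w N s) =
    \sum_(i < N) (z ^+ i / i`!%:R) * (if (a + i == n)%N then P%:C%C else 0).
  have I c : cintg leb (fun s => (\1_(turn P) s)%:C%C * cis (c * s)).
    by apply: (@cintg_turn 1) => [|s]; rewrite ?normc_cis//; by apply: cmeas_cis;
      exact: measurable_lin.
  under [RHS]eq_bigr do rewrite -circle_freq -cintZ//.
  rewrite -cint_sum; last by move=> i; exact: cintgZ.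
  congr cint; apply/funext => s; rewrite /w /expS !mulr_sumr.
  apply: eq_bigr => i _; rewrite exprMn -cisX natrD.
  rewrite (_ : (a%:R + i%:R - n%:R) / r * s = (a%:R - n%:R) / r * s + i%:R * (r^-1 * s)); last
    by ring.
  by rewrite cisD; ring.
apply: (@ccvg_near _ (fun=> if (a <= n)%N then P%:C%C * (z ^+ (n - a) / (n - a)`!%:R) else 0) _ _
  n.+1); last exact: ccvg_cst.
move=> N nN; rewrite E; case: leqP => an.
  have lt : (n - a < N)%N by rewrite (leq_ltn_trans (leq_subr _ _)).
  rewrite (bigD1 (Ordinal lt))//= subnKC// eqxx big1 ?addr0 1?mulrC// => i.
  move=> iN; rewrite ifF ?mulr0//; apply: contra_neqF iN => /eqP ain.
  by apply/val_inj => /=; rewrite -ain addKn.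
by rewrite big1// => i _; rewrite ifF ?mulr0//; apply/negbTE/eqP => ain;
  rewrite -ain ltnNge leq_addr in an.
Qed.

(** In the binomial expansion, the factor z^i of the i-th term meets the coefficient z^(n - i)
    extracted from the exponential, so every term is a multiple of the same power z^n. *)
Lemma circle_eigen k n (z : R[i]) (c : R) :
  cint leb (fun s => (\1_(turn P) s)%:C%C * ((z * cis (r^-1 * s) - r%:C%C) ^+ (k + n) *
    (cis (- (n%:R / r * s)) * cexp (c%:C%C * z * cis (r^-1 * s))))) =
  P%:C%C * (\sum_(i < n.+1) 'C(k + n, i)%:R * (- r) ^+ (k + n - i) *
    (c ^+ (n - i) / (n - i)`!%:R))%:C%C * z ^+ n.
Proof.
pose al i : R[i] := 'C(k + n, i)%:R * (- r%:C%C) ^+ (k + n - i) * z ^+ i.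
pose w i s : R[i] := cis ((i%:R - n%:R) / r * s) * cexp (c%:C%C * z * cis (r^-1 * s)).
have I i : cintg leb (fun s => (\1_(turn P) s)%:C%C * w i s).
  apply: (@cintg_turn (expR (normc (c%:C%C * z)))).
    apply: cmeasM; first by apply: cmeas_cis; exact: measurable_lin.
    apply: cmeas_cexp; apply: cmeasM; first exact: cmeas_cst.
    by apply: cmeas_cis; exact: measurable_lin.
  move=> s; rewrite ComplexField.Normc.normcM normc_cis mul1r normc_cexp ler_expR.
  apply: le_trans (ler_norm _) _; apply: le_trans (normc_re _) _.
  by rewrite ComplexField.Normc.normcM normc_cis mulr1.
transitivity (\sum_(i < (k + n).+1) al i * cint leb (fun s => (\1_(turn P) s)%:C%C * w i s)).
  under eq_bigr do rewrite -cintZ//.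
  rewrite -cint_sum; last by move=> i; exact: cintgZ.
  congr cint; apply/funext => s; rewrite addrC exprDn mulr_suml mulr_sumr.
  apply: eq_bigr => i _; rewrite /al /w -mulr_natr exprMn -cisX.
  rewrite (_ : (i%:R - n%:R) / r * s = i%:R * (r^-1 * s) + - (n%:R / r * s)); last by ring.
  by rewrite cisD; ring.
under eq_bigr do rewrite circle_exp.
(* The terms with i > n vanish, as the exponential has no negative frequencies; hence the sum stops
   at n although the expansion runs up to k + n. *)
rewrite rmorph_sum mulr_sumr mulr_suml [RHS](big_ord_widen _ (fun i => P%:C%C *
  ('C(k + n, i)%:R * (- r) ^+ (k + n - i) * (c ^+ (n - i) / (n - i)`!%:R))%:C%C * z ^+ n)
    (leq_addl k n.+1)).
rewrite addnS [RHS]big_mkcond/=; apply: eq_bigr => i _; rewrite ltnS.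
case: ifP => // lin; last by rewrite mulr0.
rewrite /al !rmorphM/= fmorphV !rmorph_nat !rmorphXn/= rmorphN exprMn.
have -> : z ^+ n = z ^+ (n - i) * z ^+ i by rewrite -exprD subnK.
ring.
Qed.

End radius.

Definition shift_coef n k : R :=
  \sum_(i < n.+1) 'C(k + n, i)%:R * (- k%:R) ^+ (n - i) / (n - i)`!%:R.

(* [shift_coef n] agrees on [nat] with a polynomial of value [1] at [0]; it is
   the Laguerre polynomial [L_n^(k)] evaluated at [k]. *)
Lemma shift_coef_neq0 n K : exists2 k, (K < k)%N & shift_coef n k != 0.
Proof.
(* As a function of k, i! C(k + n, i) is the falling factorial with factors k + n - j, j < i, which
   is a polynomial. *)
pose Q : {poly R} := \sum_(i < n.+1) (i`!%:R)^-1%:P *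
  (\prod_(j < i) ('X + (n - j)%:R%:P)) * (- 'X) ^+ (n - i) * ((n - i)`!%:R)^-1%:P.
have QE k : Q.[k%:R] = shift_coef n k.
  rewrite /Q horner_sum; apply: eq_bigr => -[i /= ltin] _.
  rewrite !hornerE horner_prod; congr (_ * _ / _).
  have fact0 : i`!%:R != 0 :> R by rewrite pnatr_eq0 -lt0n fact_gt0.
  apply: (mulfI fact0); rewrite mulrA mulfV// mul1r mulrC -natrM bin_ffact ffact_prod.
  rewrite natr_prod; apply: eq_bigr => -[j /= ltji] _.
  rewrite !hornerE -natrD addnBA//.
  by rewrite -ltnS (leq_trans _ ltin)// ltnW// ltnS.
have Q0 : Q != 0.
  apply/eqP => Qe; have := QE 0%N; rewrite Qe horner0 /shift_coef.
  rewrite big_ord_recr/= subnn expr0 add0n binn fact0 big1 => [|i _].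
    by rewrite add0r invr1 !mulr1 => /eqP; rewrite eq_sym oner_eq0.
  by rewrite oppr0 expr0n subn_eq0 leqNgt ltn_ord/= mulr0 mul0r.
(* If the coefficient vanished for all k > K, then Q would have [size Q] distinct roots, one more
   than its degree allows. *)
apply: contrapT => no.
have := @max_poly_roots _ Q [seq i%:R | i <- iota K.+1 (size Q)] Q0.
rewrite size_map size_iota ltnn => H; suff : false by [].
apply: H.
  apply/allP => x /mapP[k + ->]; rewrite mem_iota => /andP[Kk _].
  rewrite rootE QE; apply: contrapT => ne; apply: no; exists k => //.
  exact/negP.
by rewrite map_inj_uniq ?iota_uniq// => i j /eqP; rewrite eqr_nat => /eqP.
Qed.

End circle_integrals.

(** * Unfolding and orthogonality *)

Section unit_cells.
Variable R : realType.

(* The cells [[m, m + 1[] of the real line, enumerated by [nat] through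
   [pickle]; codes of no integer give the empty cell. *)
Definition cell n : set R :=
  if @pickle_inv int n is Some m then [set u | m%:~R <= u < m%:~R + 1] else set0.

Lemma bigcup_cell : \bigcup_n cell n = setT.
Proof.
apply/seteqP; split=> // u _; exists (pickle (Num.floor u)) => //.
by rewrite /cell pickleK_inv /=; have := floor_itv u; rewrite intrD.
Qed.

Lemma trivIset_cell : trivIset setT cell.
Proof.
move=> i j _ _ [u []]; rewrite /cell.
case: (@pickle_inv int i) (@pickle_invK int i) => //= m <- /andP[m1 m2].
case: (@pickle_inv int j) (@pickle_invK int j) => //= k <- /andP[k1 k2].
congr pickle; apply/eqP; rewrite eq_le -!ltzD1 -!(ltr_int R) !intrD.
by rewrite (le_lt_trans m1 k2) (le_lt_trans k1 m2).
Qed.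

Lemma measurable_cell n : measurable (cell n).
Proof.
rewrite /cell; case: pickle_inv => [m|//].
by rewrite (_ : [set _ | _] = `[m%:~R, m%:~R + 1[%classic)//; apply/seteqP; split=> u;
  rewrite /= in_itv.
Qed.

End unit_cells.

Section unfolding.
Variable R : realType.
Local Notation leb := (@lebesgue_measure R).
Variables (P T : R) (h psi : measurableTypeR R -> R).
Hypotheses (P0 : 0 < P) (T0 : 0 < T).
Hypotheses (mh : measurable_fun setT h) (mpsi : measurable_fun setT psi).
Hypotheses (hP : forall s, h (s + P) = h s - T) (psiP : forall s, psi (s + P) = psi s).

Lemma shift_period (m : int) s :
  h (s + m%:~R * P) = h s - m%:~R * T /\ psi (s + m%:~R * P) = psi s.
Proof.
have N n : forall s, h (s + n%:R * P) = h s - n%:R * T /\ psi (s + n%:R * P) = psi s.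
  elim: n => [|n IH] {}s; first by rewrite !mul0r addr0 subr0.
  have [h1 p1] := IH s.
  have -> : s + n.+1%:R * P = s + n%:R * P + P by rewrite -natr1; ring.
  by rewrite hP psiP h1 p1; split=> //; rewrite -natr1; ring.
case: m => n; first exact: N.
rewrite NegzE mulrNz !mulNr; have [h1 p1] := N n.+1 (s - n.+1%:R * P).
rewrite subrK in h1 p1; rewrite opprK; split=> //.
by rewrite h1 subrK.
Qed.

Let mcell (g : measurableTypeR R -> R) n : measurable_fun setT g ->
  measurable (g @^-1` cell n).
Proof. by move=> mg; rewrite -[X in measurable X]setTI; by apply: mg => //;
  exact: measurable_cell. Qed.

Let cell_cover (g : measurableTypeR R -> R) : \bigcup_n (g @^-1` cell n) = setT.
Proof. by rewrite -preimage_bigcup bigcup_cell. Qed.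

Let cell_triv (g : measurableTypeR R -> R) : trivIset setT (fun n => g @^-1` cell n).
Proof. by move=> i j _ _ [x [xi xj]]; apply: trivIset_cell => //; exists (g x). Qed.

Let integral_cells (g : measurableTypeR R -> R) (f : measurableTypeR R -> R) :
  measurable_fun setT g -> measurable_fun setT f -> (forall s, 0 <= f s) ->
  (\int[leb]_s (f s)%:E =
   \sum_(n <oo) \int[leb]_s (\1_(g @^-1` cell n) s * f s)%:E)%E.
Proof.
move=> mg mf f0; rewrite -[in LHS](cell_cover g) ge0_integral_bigcup//.
- apply: eq_eseriesr => n _; rewrite [LHS]integral_mkcond epatch_indic.
  by apply: eq_integral => s _ /=; rewrite EFinM muleC.
- by move=> n; exact: mcell.
- by rewrite cell_cover; exact/measurable_EFinP.
- by move=> s _; rewrite lee_fin.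
Qed.

(** With s cut into periods on the left and the height h(s) cut into steps of size T on the right,
    the translation by m P carries the m-th piece of the first sum to the m-th piece of the second:
    it brings s back to the first turn and lowers the height by m T. *)
Lemma unfold_ge0 : (forall s, 0 <= psi s) ->
  (\int[leb]_s (\1_(`[0, T[%classic : set R) (h s) * psi s)%:E =
   \int[leb]_s (\1_(turn P) s * psi s)%:E)%E.
Proof.
move=> psi0.
have mdiv c (g : measurableTypeR R -> R) : measurable_fun setT g -> measurable_fun setT (fun s =>
  g s / c).
  by move=> mg; exact: measurable_funM.
have mhT : measurable_fun setT (fun s => \1_(`[0, T[%classic : set R) (h s) : R).
  exact: (measurableT_comp (measurable_indic _)).
have mD : measurable_fun setT (\1_(turn P) : _ -> R) by apply: measurable_indic;
  exact: measurable_turn.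
rewrite (@integral_cells (fun s => s / P)); first last.
- by move=> s; rewrite mulr_ge0.
- exact: measurable_funM.
- by apply: mdiv; exact: measurable_id.
rewrite [RHS](@integral_cells (fun s => h s / T)); first last.
- by move=> s; rewrite mulr_ge0.
- exact: measurable_funM.
- exact: mdiv.
apply: eq_eseriesr => n _.
case E : (@pickle_inv int n) => [m|]; last first.
  by rewrite !integral0_eq// => s _; rewrite /cell E preimage_set0 indic0 mul0r.
rewrite -(mpres_ge0_integral (mpres_leb_shift (m%:~R * P))); last first.
- by move=> s; rewrite lee_fin !mulr_ge0.
- apply/measurable_EFinP; apply: measurable_funM; last exact: measurable_funM.
  by apply: measurable_indic; apply: mcell; apply: mdiv; exact: measurable_id.
apply: eq_integral => s _; have [-> ->] := shift_period m s; congr EFin.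
rewrite mulrA [RHS]mulrA [X in _ = X * _]mulrC; congr (_ * _ * _).
  rewrite !indicE; congr (nat_of_bool _)%:R; apply/idP/idP.
    rewrite !inE /cell E /turn /= in_itv/= => /andP[].
    by rewrite mulrDl mulfK ?gt_eqF// lerDr addrC ltrD2l ltr_pdivrMr// mul1r pmulr_lge0
      ?invr_gt0// => -> ->.
  rewrite !inE /cell E /turn /= in_itv/= => /andP[s0 sP].
  by rewrite mulrDl mulfK ?gt_eqF// lerDr addrC ltrD2l ltr_pdivrMr// mul1r pmulr_lge0 ?invr_gt0//
    s0 sP.
rewrite !indicE; congr (nat_of_bool _)%:R; apply/idP/idP.
  rewrite !inE /cell E /= in_itv/= subr_ge0 ltrBlDr => /andP[a b].
  rewrite ler_pdivlMr// ltr_pdivrMr// a mulrDl mul1r addrC//.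
rewrite !inE /cell E /= in_itv/= subr_ge0 ltrBlDr.
by rewrite ler_pdivlMr// ltr_pdivrMr// mulrDl mul1r [T + _]addrC.
Qed.

End unfolding.

Section tube.
Variables (R : realType) (l : R).
Hypothesis l0 : 0 < l.
Local Notation leb := (@lebesgue_measure R).
Local Notation r := (l^-1).
Local Notation P := (l^-1 * (2 * pi)).
Local Notation T := (pi * l^-1 ^+ 2).

Definition heis_opp (g : heis R) : heis R := (- g.1.1, - g.1.2, - g.2).

Lemma heis_mulK (p g : heis R) : heis_mul (heis_mul p g) (heis_opp g) = p.
Proof.
case: p g => [[x y] t] [[u v] s]; rewrite /heis_mul /heis_opp/=.
by congr (_, _, _); field.
Qed.

(** The base point of the geodesic of charge [l] that passes through [q] at parameter [s]. *)
Definition back (q : heis R) (s : R) : heis R := heis_mul q (heis_opp (geod l s)).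

Lemma backK (p : heis R) s : back (heis_mul p (geod l s)) s = p.
Proof. exact: heis_mulK. Qed.

Let r0 : 0 < r. Proof. by rewrite invr_gt0. Qed.
Let P0 : 0 < P. Proof. by rewrite !mulr_gt0 ?pi_gt0. Qed.
Let T0 : 0 < T. Proof. by rewrite mulr_gt0 ?pi_gt0 ?exprn_gt0. Qed.

Lemma back_turn q s : back q (s + P) = heis_mul (0, 0, - T) (back q s).
Proof.
have sP : (s + P) / r = s / r + pi *+ 2.
  by rewrite mulrDl -mulr_natl; congr (_ + _); field; rewrite gt_eqF.
case: q => [[x y] t]; rewrite /back /heis_opp /geod /heis_mul/=.
rewrite sP cosD2pi sinD2pi !add0r !mul0r subrr mulr0 addr0.
by congr (_, _, _); field; rewrite gt_eqF.
Qed.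

Lemma measurable_fun_triple d (X : measurableType d) (a b c : X -> measurableTypeR R) :
  measurable_fun setT a -> measurable_fun setT b -> measurable_fun setT c ->
  measurable_fun setT (fun x => (a x, b x, c x) : heis R).
Proof.
move=> ma mb mc; apply/measurable_fun_pairP; split=> //=.
by apply/measurable_fun_pairP; split.
Qed.

Lemma measurable_heis_mul d (X : measurableType d) (f g : X -> heis R) :
  measurable_fun setT f -> measurable_fun setT g ->
  measurable_fun setT (fun x => heis_mul (f x) (g x)).
Proof.
move=> mf mg.
have m11 (h : X -> heis R) : measurable_fun setT h -> measurable_fun setT (fun x => (h x).1.1).
  by move=> mh; do 2 apply: (measurableT_comp measurable_fst).
have m12 (h : X -> heis R) : measurable_fun setT h -> measurable_fun setT (fun x => (h x).1.2).
  by move=> mh; apply: (measurableT_comp measurable_snd); apply: (measurableT_comp measurable_fst).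
have m2 (h : X -> heis R) : measurable_fun setT h -> measurable_fun setT (fun x => (h x).2).
  by move=> mh; apply: (measurableT_comp measurable_snd).
rewrite (_ : (fun _ => _) = fun x => ((f x).1.1 + (g x).1.1, (f x).1.2 + (g x).1.2,
    (f x).2 + (g x).2 + 2^-1 * ((f x).1.1 * (g x).1.2 - (f x).1.2 * (g x).1.1))); last first.
  by apply/funext => x; case: (f x) (g x) => [[? ?] ?] [[? ?] ?].
apply: measurable_fun_triple.
- by apply: measurable_funD; exact: m11.
- by apply: measurable_funD; exact: m12.
- apply: measurable_funD; first by apply: measurable_funD; exact: m2.
  apply: measurable_funM => //; apply: measurable_funB; apply: measurable_funM;
    by [exact: m11|exact: m12].
Qed.

Lemma measurable_geod : measurable_fun setT (geod l : measurableTypeR R -> heis R).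
Proof.
have mdiv : measurable_fun setT (fun s : measurableTypeR R => s / r) by exact: measurable_funM.
apply: measurable_fun_triple.
- apply: measurable_funM => //.
  exact: (measurableT_comp (continuous_measurable_fun (@continuous_cos R)) mdiv).
- apply: measurable_funM => //.
  exact: (measurableT_comp (continuous_measurable_fun (@continuous_sin R)) mdiv).
- by apply: measurable_funM => //; apply: measurable_funM.
Qed.

Lemma measurable_heis_opp : measurable_fun setT heis_opp.
Proof.
apply: measurable_fun_triple; apply: measurableT_comp => //.
- by apply: measurableT_comp => //; exact: measurable_fst.
- by apply: measurableT_comp => //; exact: measurable_snd.
Qed.

Definition flow (z : heis R * measurableTypeR R) : heis R := heis_mul z.1 (geod l z.2).

Lemma measurable_flow : measurable_fun setT flow.
Proof.
apply: measurable_heis_mul => //.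
by apply: (measurableT_comp measurable_geod); exact: measurable_snd.
Qed.

Lemma measurable_back :
  measurable_fun setT (fun z : heis R * measurableTypeR R => back z.1 z.2).
Proof.
apply: measurable_heis_mul => //; apply: (measurableT_comp measurable_heis_opp).
by apply: (measurableT_comp measurable_geod); exact: measurable_snd.
Qed.

Lemma mpres_flow : mpres (haarf \x leb)%E (fun z => (flow z, z.2)).
Proof.
apply: (@mpres_skew2 _ _ _ _ _ haarf leb (fun s p => heis_mul p (geod l s))).
  by move=> s; exact: mpres_heis_mul.
exact: measurable_flow.
Qed.

Lemma backs q : measurable_fun setT (fun s : measurableTypeR R => back q s).
Proof. exact: (measurableT_comp measurable_back (pair1_measurable q)). Qed.

Let Glam_back q s : \1_(Glam_dom l) (back q s) = \1_(`[0, T[%classic : set R) (back q s).2 :> R.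
Proof. by rewrite !indicE; congr (nat_of_bool _)%:R; apply/idP/idP;
  rewrite !inE /Glam_dom/= in_itv. Qed.

Lemma unfold_back_ge0 (psi : heis R -> R) q : measurable_fun setT psi ->
  (forall p, psi (heis_mul (0, 0, - T) p) = psi p) -> (forall p, 0 <= psi p) ->
  (\int[leb]_s (\1_(Glam_dom l) (back q s) * psi (back q s))%:E =
   \int[leb]_s (\1_(turn P) s * psi (back q s))%:E)%E.
Proof.
move=> mpsi psiT psi0; under eq_integral do rewrite Glam_back.
apply: (@unfold_ge0 _ P T (fun s => (back q s).2) (fun s => psi (back q s))) => //.
- by apply: (measurableT_comp measurable_snd); exact: backs.
- by apply: (measurableT_comp mpsi); exact: backs.
- move=> s; rewrite back_turn; case: (back q s) => [[x y] t] /=.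
  by rewrite !mul0r subrr mulr0 addr0 addrC.
- by move=> s; rewrite back_turn psiT.
Qed.

Lemma integral_turn : (\int[leb]_s (\1_(turn P) s)%:E = P%:E)%E.
Proof.
rewrite integral_indic//; last exact: measurable_turn.
by rewrite setIT /turn [LHS]lebesgue_measure_itv/= lte_fin P0 sube0.
Qed.

(** Unfolding with psi = 1. Each point is met by the normalized geodesics for a total parameter
    length of one turn, 2 pi / l; all operator bounds below come from this number. *)
Lemma Glam_back_mass q : (\int[leb]_s (\1_(Glam_dom l) (back q s))%:E = P%:E)%E.
Proof.
have := @unfold_back_ge0 (fun=> 1) q (measurable_cst _) (fun=> erefl) (fun=> ler01).
under eq_integral do rewrite mulr1; move=> ->.
under eq_integral do rewrite mulr1; exact: integral_turn.
Qed.

Let mGlam : measurable_fun setT (\1_(Glam_dom l) : heis R -> R).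
Proof. by apply: measurable_indic; exact: measurable_Glam_dom. Qed.

(** In the coordinates (q, s) with q the point reached at parameter s, [F] depends on q alone and
    the integral in s is the mass of one turn. *)
Lemma tube_mass (F : heis R -> R) : measurable_fun setT F -> (forall p, 0 <= F p) ->
  (\int[haarf \x leb]_z (\1_(Glam_dom l) z.1 * F (flow z))%:E =
   P%:E * \int[haarf]_p (F p)%:E)%E.
Proof.
move=> mF F0.
pose G (z : heis R * measurableTypeR R) : \bar R := (F z.1 * \1_(Glam_dom l) (back z.1 z.2))%:E.
have mG : measurable_fun setT G.
  apply/measurable_EFinP; apply: measurable_funM.
    by apply: (measurableT_comp mF); exact: measurable_fst.
  exact: (measurableT_comp mGlam measurable_back).
have G0 z : (0 <= G z)%E by rewrite lee_fin mulr_ge0.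
transitivity (\int[haarf \x leb]_z G (flow z, z.2))%E.
  by apply: eq_integral => z _; rewrite /G /= backK mulrC.
rewrite (mpres_ge0_integral mpres_flow)// (@fubini_tonelli1 _ _ _ _ _ haarf leb)//.
rewrite /fubini_F -ge0_integralZl//; first last.
- by rewrite lee_fin ltW.
- by move=> p _; rewrite lee_fin.
- exact/measurable_EFinP.
apply: eq_integral => q _; rewrite muleC -(Glam_back_mass q) -ge0_integralZl ?lee_fin//.
apply/measurable_EFinP; exact: (measurableT_comp mGlam (backs q)).
Qed.

Lemma tube_integrable (F : heis R -> R) : intg haarf F ->
  intg (haarf \x leb)%E (fun z => \1_(Glam_dom l) z.1 * F (flow z)).
Proof.
move=> /integrableP[/measurable_EFinP mF Foo]; apply/integrableP; split.
  apply/measurable_EFinP; apply: measurable_funM; last exact: measurableT_comp measurable_flow.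
  exact: (measurableT_comp mGlam measurable_fst).
under eq_integral => z _ do rewrite /= normrM ger0_norm//.
rewrite (@tube_mass (fun p => `|F p|))//; last exact: measurableT_comp.
by rewrite lte_mul_pinfty// lee_fin ltW.
Qed.

End tube.

Section orthogonality.
Variables (R : realType) (l : R).
Hypothesis l0 : 0 < l.
Local Notation leb := (@lebesgue_measure R).
Local Notation P := (l^-1 * (2 * pi)).
Local Notation T := (pi * l^-1 ^+ 2).

Let mGlam : measurable_fun setT (\1_(Glam_dom l) : heis R -> R).
Proof. by apply: measurable_indic; exact: measurable_Glam_dom. Qed.

Variables (psi : heis R -> R) (C : R).
Hypotheses (mpsi : measurable_fun setT psi) (psiC : forall p, `|psi p| <= C).
Hypothesis psiT : forall p, psi (heis_mul (0, 0, - T) p) = psi p.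

Let intg_Glam_back q : intg leb (fun s => \1_(Glam_dom l) (back l q s)).
Proof.
apply/integrableP; split.
  by apply/measurable_EFinP; exact: (measurableT_comp mGlam (backs l q)).
under eq_integral => s _ do rewrite /= ger0_norm//.
by rewrite Glam_back_mass// ltry.
Qed.

Let C0 : 0 <= C. Proof. exact: le_trans (normr_ge0 _) (psiC (0, 0, 0)). Qed.

Lemma unfold_back q :
  \int[leb]_s (\1_(Glam_dom l) (back l q s) * psi (back l q s)) =
  \int[leb]_s (\1_(turn P) s * psi (back l q s)).
Proof.
have mb : measurable_fun setT (fun s : measurableTypeR R => psi (back l q s)).
  exact: (measurableT_comp mpsi (backs l q)).
(* Unfolding is available for nonnegative functions, so it is applied to psi + C and to the constant
   C, and the results are subtracted. *)
have split_psi (w : measurableTypeR R -> R) : intg leb w ->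
  \int[leb]_s (w s * psi (back l q s)) =
  \int[leb]_s (w s * (psi (back l q s) + C)) - \int[leb]_s (w s * C).
  move=> wi; rewrite -RintegralB//.
  - by apply: eq_Rintegral => s _; ring.
  - apply: (intgM_bounded (C := C + C)) => //; first exact: measurable_funD.
    by move=> s; rewrite (le_trans (ler_normD _ _))// lerD// ger0_norm.
  - by apply: (intgM_bounded (C := C)) => // s; rewrite ger0_norm.
rewrite !split_psi; last 2 first.
- exact: intg_turn.
- exact: intg_Glam_back.
congr (_ - _); rewrite /Rintegral; congr fine.
  apply: (unfold_back_ge0 l0 (psi := fun p => psi p + C)).
  - exact: measurable_funD.
  - by move=> p; rewrite psiT.
  - by move=> p; have := psiC p; rewrite ler_norml; lra.
by apply: (unfold_back_ge0 l0 (psi := fun _ => C)).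
Qed.

Lemma measurable_turn_integral :
  measurable_fun setT (fun q => \int[leb]_s (\1_(turn P) s * psi (back l q s))).
Proof.
pose G (z : heis R * measurableTypeR R) : \bar R :=
  (\1_(turn P) z.2 * (psi (back l z.1 z.2) + C))%:E.
have mG : measurable_fun setT G.
  apply/measurable_EFinP; apply: measurable_funM.
    apply: (measurableT_comp _ measurable_snd).
    by apply: measurable_indic; exact: measurable_turn.
  apply: measurable_funD => //.
  exact: (measurableT_comp mpsi (measurable_back l)).
have G0 z : (0 <= G z)%E.
  by rewrite lee_fin mulr_ge0//; have := psiC (back l z.1 z.2); rewrite ler_norml; lra.
have -> : (fun q => \int[leb]_s (\1_(turn P) s * psi (back l q s))) =
    (fun q => fine (fubini_F leb G q) - \int[leb]_s (\1_(turn P) s * C)).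
  apply/funext => q; rewrite /fubini_F -/(Rintegral leb setT (fun s => _)).
  have ti := @intg_turn R P.
  rewrite -RintegralB; first by apply: eq_Rintegral => s _ /=; ring.
  - exact: measurableT.
  - apply: (intgM_bounded (C := C + C)) => //.
      apply: measurable_funD => //.
      exact: (measurableT_comp mpsi (backs l q)).
    by move=> s; rewrite (le_trans (ler_normD _ _))// lerD// ger0_norm.
  - by apply: (intgM_bounded (C := C)) => // s; rewrite ger0_norm.
apply: measurable_funB => //; apply: measurableT_comp => //.
exact: measurable_fun_fubini_tonelli_F.
Qed.

Lemma orthogonality (F : heis R -> R) : intg haarf F ->
  {ae haarf, forall p, Glam_dom l p -> \int[leb]_s F (heis_mul p (geod l s)) = 0} ->
  \int[haarf]_q (F q * \int[leb]_s (\1_(turn P) s * psi (back l q s))) = 0.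
Proof.
move=> Fi F0; have mF := intg_meas Fi.
pose K (z : heis R * measurableTypeR R) : R :=
  F z.1 * (\1_(Glam_dom l) (back l z.1 z.2) * psi (back l z.1 z.2)).
have mK : measurable_fun setT K.
  apply: measurable_funM; first exact: (measurableT_comp mF measurable_fst).
  apply: measurable_funM; first exact: (measurableT_comp mGlam (measurable_back l)).
  exact: (measurableT_comp mpsi (measurable_back l)).
pose KS (z : heis R * measurableTypeR R) : R :=
  (\1_(Glam_dom l) z.1 * F (flow l z)) * psi z.1.
have KSE z : KS z = K (flow l z, z.2).
  by rewrite /KS /K /= backK; ring.
have KSi : intg (haarf \x leb)%E KS.
  apply: (intgM_bounded (C := C)) => //; first exact: tube_integrable.
  exact: (measurableT_comp mpsi measurable_fst).
have Ki : intg (haarf \x leb)%E K.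
  apply/integrableP; split; first exact/measurable_EFinP.
  rewrite -(mpres_ge0_integral (mpres_flow l) (f := fun z => `|(K z)%:E|%E)).
  - have /integrableP[_] := KSi; congr (_ < _)%E.
    by apply: eq_integral => z _; rewrite /= KSE.
  - by apply: measurableT_comp => //; exact/measurable_EFinP.
  - by [].
(* First reading of the double integral, at fixed base point p: the inner integral is a multiple of
   the integral of [F] along the geodesic of p, which vanishes. *)
have E : (\int[haarf]_q \int[leb]_s (K (q, s))%:E = 0)%E.
  rewrite (@integral12_prod_meas1 _ _ _ _ _ haarf leb (EFin \o K))//.
  rewrite -(mpres_integral (mpres_flow l) Ki).
  transitivity (\int[haarf \x leb]_z (KS z)%:E)%E.
    by apply: eq_integral => z _; rewrite /= -KSE.
  rewrite -(@integral12_prod_meas1 _ _ _ _ _ haarf leb (EFin \o KS))//.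
  rewrite -[RHS](integral0 haarf setT); apply: ae_eq_integral => //.
    exact: (@measurable_fubini_F _ _ _ _ _ haarf leb _ KSi).
  have := @ae_integrable1 _ _ _ _ _ haarf leb _ KSi.
  apply: filterS2 F0 => p F0p KSp _.
  rewrite /fubini_F -[LHS]fineK; last exact: integrable_fin_num KSp.
  congr EFin; pose c := \1_(Glam_dom l) p * psi p.
  have KSpE s : KS (p, s) = c * F (heis_mul p (geod l s)).
    by rewrite /KS /c /flow /=; ring.
  (* Only c times [F] is known to be integrable along the geodesic; for c = 0 this says nothing
     about [F], and the claim is trivial. *)
  have [c0|c0] := eqVneq c 0.
    by rewrite integral0_eq// => s _; rewrite /= KSpE c0 mul0r.
  have pG : Glam_dom l p.
    by apply: contrapT => nG; move: c0; rewrite /c indicE memNset// mul0r eqxx.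
  have -> : fine (\int[leb]_y (EFin \o KS) (p, y)) =
      \int[leb]_s (c * F (heis_mul p (geod l s))).
    by rewrite /Rintegral; congr fine; apply: eq_integral => s _; rewrite /= KSpE.
  rewrite RintegralZl ?F0p ?mulr0//.
  have := intgZ c^-1 KSp; apply: eq_integrable => // s _.
  by rewrite /= KSpE mulKf.
(* Second reading, at fixed q: [F q] factors out and unfolding turns the rest into an integral over
   one turn. *)
have /(congr1 fine) /= <- := E.
rewrite /Rintegral; congr fine; apply: ae_eq_integral => //.
- apply/measurable_EFinP; apply: measurable_funM => //.
  exact: measurable_turn_integral.
- exact: (@measurable_fubini_F _ _ _ _ _ haarf leb _ Ki).
have := @ae_integrable1 _ _ _ _ _ haarf leb _ Ki.
apply: filterS => q Kq _.
rewrite -[RHS]fineK; last exact: integrable_fin_num Kq.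
congr EFin.
rewrite -[fine (\int[leb]_x (\1_(turn P) x * _)%:E)]/(Rintegral leb setT _).
rewrite -(unfold_back q) -RintegralZl//.
apply: (intgM_bounded (C := C)) => //.
exact: (measurableT_comp mpsi (backs l q)).
Qed.

End orthogonality.

(** * Test functions and moments *)

Section test_functions.
Variable R : realType.
Local Notation leb := (@lebesgue_measure R).
Implicit Types (p q : heis R) (t : R).

Section def.
Variables (tau a1 a2 : R).

Definition offset p : R[i] := ((p.1.1 - a1) +i* (- (p.1.2 - a2)))%C.
Definition dist2 p : R := (p.1.1 - a1) ^+ 2 + (p.1.2 - a2) ^+ 2.

(* Left translates by [a1 + i a2] of [e^(-i tau t) e^(-tau |z|^2 / 4) conj(z)^n]. *)
Definition Psi n p : R[i] :=
  cis (- (tau * p.2) + tau / 2 * (a1 * p.1.2 - a2 * p.1.1)) *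
  (expR (- (tau / 4 * dist2 p)))%:C%C * offset p ^+ n.

Lemma normc_offset p : normc (offset p) ^+ 2 = dist2 p.
Proof. by rewrite /offset /= sqr_sqrtr ?addr_ge0 ?sqr_ge0// sqrrN. Qed.

Lemma normc_Psi n p : normc (Psi n p) =
  expR (- (tau / 4 * dist2 p)) * normc (offset p) ^+ n.
Proof.
by rewrite !ComplexField.Normc.normcM normc_cis mul1r normcX normc_real ger0_norm ?expR_ge0.
Qed.

Let mx : measurable_fun setT (fun p => p.1.1 : measurableTypeR R).
Proof. by do 2 apply: (measurableT_comp measurable_fst). Qed.

Let my : measurable_fun setT (fun p => p.1.2 : measurableTypeR R).
Proof. by apply: (measurableT_comp measurable_snd). Qed.

Let mt : measurable_fun setT (fun p => p.2 : measurableTypeR R).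
Proof. exact: measurable_snd. Qed.

Lemma cmeas_offset : cmeas offset.
Proof.
split; rewrite /offset/=; first exact: measurable_funB.
by apply: measurableT_comp => //; exact: measurable_funB.
Qed.

Lemma measurable_dist2 : measurable_fun setT dist2.
Proof.
by apply: measurable_funD; apply: measurable_funX; exact: measurable_funB.
Qed.

Lemma cmeas_Psi n : cmeas (Psi n).
Proof.
apply: cmeasM; last by apply: cmeasX; exact: cmeas_offset.
apply: cmeasM.
  apply: cmeas_cis; apply: measurable_funD.
    by apply: measurableT_comp => //; exact: measurable_funM.
  by apply: measurable_funM => //; apply: measurable_funB; exact: measurable_funM.
apply: cmeas_real; apply: measurableT_comp => //; apply: measurableT_comp => //.
by apply: measurable_funM => //; exact: measurable_dist2.
Qed.

End def.

Lemma expR_ge_term (x : R) n : 0 <= x -> x ^+ n / n`!%:R <= expR x.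
Proof.
move=> x0; apply: le_trans (expS_le n.+1 x0); rewrite expSS lerDr.
by apply: sumr_ge0 => i _; rewrite divr_ge0 ?exprn_ge0.
Qed.

(** The bound is uniform in the centre and in all tau >= tau0; the latter provides the dominating
    function when tau varies. It rests on e^(-x) x^n <= n!. *)
Lemma Psi_bounded tau0 n : 0 < tau0 ->
  exists C, forall tau a1 a2 p, tau0 <= tau -> normc (Psi tau a1 a2 n p) <= C.
Proof.
move=> t0; exists (1 + n`!%:R * (4 / tau0) ^+ n) => tau a1 a2 p tt.
rewrite normc_Psi; set d := dist2 a1 a2 p; set v := normc _.
have d0 : 0 <= d by rewrite addr_ge0 ?sqr_ge0.
have v0 : 0 <= v by exact: normc_ge0.
have vd : v ^+ 2 = d by exact: normc_offset.
have e1 : expR (- (tau / 4 * d)) <= expR (- (tau0 / 4 * d)).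
  by rewrite ler_expR lerN2 ler_wpM2r// ler_pM2r.
have e2 : expR (- (tau0 / 4 * d)) <= 1.
  by rewrite expR_le1 oppr_le0 !mulr_ge0// ltW.
(* An odd power of the distance v is replaced by a power of d = v^2, through w <= 1 + w^2. *)
have vn : v ^+ n <= 1 + d ^+ n.
  have : 0 <= (v ^+ n - 1) ^+ 2 by rewrite sqr_ge0.
  have : 0 <= v ^+ n by rewrite exprn_ge0.
  by rewrite -vd -exprM mulnC exprM; set w := v ^+ n; nra.
have dn : expR (- (tau0 / 4 * d)) * d ^+ n <= n`!%:R * (4 / tau0) ^+ n.
  have x0 : 0 <= tau0 / 4 * d by rewrite !mulr_ge0// ltW.
  have := expR_ge_term n x0; set x := tau0 / 4 * d.
  rewrite expRN ler_pdivrMr; last by rewrite ltr0n fact_gt0.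
  move=> H; rewrite mulrC ler_pdivrMr ?expR_gt0//.
  have -> : d ^+ n = (4 / tau0) ^+ n * x ^+ n.
    by rewrite -exprMn /x; congr (_ ^+ _); field; rewrite gt_eqF.
  rewrite (_ : n`!%:R * _ * _ = (4 / tau0) ^+ n * (expR x * n`!%:R)); last by ring.
  by rewrite ler_wpM2l// exprn_ge0// divr_ge0// ltW.
apply: le_trans (ler_wpM2r _ e1) _; first by rewrite exprn_ge0.
apply: le_trans (ler_wpM2l (expR_ge0 _) vn) _.
by rewrite mulrDr mulr1 lerD.
Qed.

Section eigenfunction.
Variables (l a1 a2 : R) (k : nat).
Hypothesis l0 : 0 < l.
Let tau : R := 2 * k%:R * l ^+ 2.
Local Notation P := (l^-1 * (2 * pi)).
Local Notation T := (pi * l^-1 ^+ 2).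

(** By the choice of tau, tau T = 2 pi k, so the phase changes by k full turns. *)
Lemma Psi_turn n p : Psi tau a1 a2 n (heis_mul (0, 0, - T) p) = Psi tau a1 a2 n p.
Proof.
case: p => [[x y] t]; rewrite /Psi /heis_mul /offset /dist2 /= !add0r !mul0r subrr mulr0 addr0.
congr (_ * _ * _).
have -> : - (tau * (- T + t)) = k%:R * (2 * pi) + - (tau * t).
  by rewrite /tau; field; rewrite gt_eqF.
by rewrite -addrA cisD cis_turn mul1r.
Qed.

(** With theta = l s, the vertical motion contributes e^(i k theta) and the power contributes e^(-i
    (k + n) theta). The k cancels, which is why degree k + n has to be paired with degree n. *)
Lemma Psi_back n q s : Psi tau a1 a2 (k + n) (back l q s) =
  (expR (- (tau / 4 * l^-1 ^+ 2)))%:C%C *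
  (cis (- (tau * q.2) + tau / 2 * (a1 * q.1.2 - a2 * q.1.1)) *
   (expR (- (tau / 4 * dist2 a1 a2 q)))%:C%C) *
  ((offset a1 a2 q * cis (l^-1^-1 * s) - l^-1%:C%C) ^+ (k + n) *
   (cis (- (n%:R / l^-1 * s)) * cexp ((k%:R / l^-1)%:C%C * offset a1 a2 q * cis (l^-1^-1 * s)))).
Proof.
have ln0 : l != 0 by rewrite gt_eqF.
pose th := l^-1^-1 * s.
have -> : - (n%:R / l^-1 * s) = - (n%:R * th) by rewrite /th; field.
rewrite -/th; set z := offset a1 a2 q.
(* The conjugate of z - r e^(i theta), with the rotation pulled out. *)
have zE : offset a1 a2 (back l q s) = (z * cis th - l^-1%:C%C) * cis (- th).
  rewrite mulrBl -mulrA -cisD subrr cis0 mulr1.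
  have thE : s / l^-1 = th by rewrite /th mulrC.
  rewrite /z /offset /back /heis_opp /geod /heis_mul /cis.
  case: q {z} => [[x y] t] /=; rewrite thE cosN sinN.
  by apply: complex_eq => /=; ring.
rewrite /Psi zE exprMn -cisX.
have -> : (k + n)%:R * - th = - (k%:R * th) + - (n%:R * th) by rewrite natrD; ring.
rewrite (cisD (- (k%:R * th))) /cexp.
set w := (z * cis th - l^-1%:C%C) ^+ (k + n).
have wE : Re ((k%:R / l^-1)%:C%C * z * cis th) =
    tau / 2 / l * ((q.1.1 - a1) * cos th + (q.1.2 - a2) * sin th).
  by rewrite /z /offset/= /tau; field.
have wI : Im ((k%:R / l^-1)%:C%C * z * cis th) =
    tau / 2 / l * ((q.1.1 - a1) * sin th - (q.1.2 - a2) * cos th).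
  by rewrite /z /offset/= /tau; field.
rewrite wE wI.
have eE : expR (- (tau / 4 * dist2 a1 a2 (back l q s))) =
    expR (- (tau / 4 * l^-1 ^+ 2)) * expR (- (tau / 4 * dist2 a1 a2 q)) *
    expR (tau / 2 / l * ((q.1.1 - a1) * cos th + (q.1.2 - a2) * sin th)).
  rewrite -!expRD; congr expR; rewrite /dist2 /back /heis_opp /geod /heis_mul.
  case: q {z w zE wE wI} => [[x y] t] /=.
  have -> : s / l^-1 = th by rewrite /th mulrC.
  have := cos2Dsin2 th; set c := cos th; set d := sin th => cd.
  have -> : l^-1 ^+ 2 = l^-1 ^+ 2 * (c ^+ 2 + d ^+ 2) by rewrite cd mulr1.
  by field.
have cE : cis (- (tau * (back l q s).2) + tau / 2 * (a1 * (back l q s).1.2 - a2 * (back l q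
  s).1.1)) =
   cis (- (tau * q.2) + tau / 2 * (a1 * q.1.2 - a2 * q.1.1)) * cis (k%:R * th) *
   cis (tau / 2 / l * ((q.1.1 - a1) * sin th - (q.1.2 - a2) * cos th)).
  rewrite -!cisD; congr cis; rewrite /back /heis_opp /geod /heis_mul.
  case: q {z w zE wE wI eE} => [[x y] t] /=.
  have -> : s / l^-1 = th by rewrite /th mulrC.
  have -> : s = th / l by rewrite /th; field.
  rewrite /tau; set c := cos th; set d := sin th; by field.
rewrite eE cE !rmorphM/=.
have k1 := cisN (k%:R * th).
transitivity ((cis (- (k%:R * th)) * cis (k%:R * th)) *
  ((expR (- (tau / 4 * l^-1 ^+ 2)))%:C%C *
  (cis (- (tau * q.2) + tau / 2 * (a1 * q.1.2 - a2 * q.1.1)) *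
   (expR (- (tau / 4 * dist2 a1 a2 q)))%:C%C) * (w * (cis (- (n%:R * th)) *
   ((expR (tau / 2 / l * ((q.1.1 - a1) * cos th + (q.1.2 - a2) * sin th)))%:C%C *
  cis (tau / 2 / l * ((q.1.1 - a1) * sin th - (q.1.2 - a2) * cos th))))))).
  by ring.
by rewrite k1 mul1r.
Qed.

End eigenfunction.
End test_functions.

Section vanishing_moments.
Variable R : realType.
Local Notation leb := (@lebesgue_measure R).

Definition vanishes_at (F : heis R -> R) (l : R) :=
  {ae haarf, forall p, Glam_dom l p -> \int[leb]_s F (heis_mul p (geod l s)) = 0}.

Lemma normc_neq0 (z : R[i]) : normc z != 0 -> z != 0.
Proof. by apply: contra_neq => ->; rewrite ComplexField.Normc.normc0. Qed.

Section one_charge.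
Variables (l a1 a2 : R) (k n : nat).
Hypotheses (l0 : 0 < l) (k0 : (0 < k)%N).
Let tau : R := 2 * k%:R * l ^+ 2.
Local Notation P := (l^-1 * (2 * pi)).
Local Notation T := (pi * l^-1 ^+ 2).

Let tau0 : 0 < tau. Proof. by rewrite !mulr_gt0 ?ltr0n ?exprn_gt0. Qed.

Definition eigenvalue_turn : R :=
  expR (- (tau / 4 * l^-1 ^+ 2)) * (P * ((- l^-1) ^+ k * shift_coef R n k)).

Lemma Psi_eigen q :
  cint leb (fun s => (\1_(turn P) s)%:C%C * Psi tau a1 a2 (k + n) (back l q s)) =
  eigenvalue_turn%:C%C * Psi tau a1 a2 n q.
Proof.
have r0 : 0 < l^-1 by rewrite invr_gt0.
have [C PsiC] := @Psi_bounded R tau (k + n) tau0.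
set A := (expR (- (tau / 4 * l^-1 ^+ 2)))%:C%C *
  (cis (- (tau * q.2) + tau / 2 * (a1 * q.1.2 - a2 * q.1.1)) *
   (expR (- (tau / 4 * dist2 a1 a2 q)))%:C%C).
have A0 : A != 0.
  apply: normc_neq0; rewrite !ComplexField.Normc.normcM normc_cis mul1r !normc_real.
  by rewrite mulf_neq0// normr_eq0 gt_eqF ?expR_gt0.
set G := fun s : R => (\1_(turn P) s)%:C%C *
  ((offset a1 a2 q * cis (l^-1^-1 * s) - l^-1%:C%C) ^+ (k + n) *
   (cis (- (n%:R / l^-1 * s)) * cexp ((k%:R / l^-1)%:C%C * offset a1 a2 q * cis (l^-1^-1 * s)))).
have GE : (fun s => (\1_(turn P) s)%:C%C * Psi tau a1 a2 (k + n) (back l q s)) = fun s => A * G s.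
  by apply/funext => s; rewrite Psi_back// -/A /G; ring.
have Gi : cintg leb G.
  (* Integrability is inherited from the bounded function [Psi], which is [G] up to the nonzero
     factor [A]. *)
  have -> : G = fun s => A^-1 * (A * G s) by apply/funext => s; rewrite mulKf.
  apply: cintgZ; rewrite -GE; apply: (@cintg_turn _ _ C).
    by have [mr mi] := cmeas_Psi tau a1 a2 (k + n); split;
      [exact: (measurableT_comp mr (backs l q))|exact: (measurableT_comp mi (backs l q))].
  by move=> s; exact: PsiC.
rewrite GE cintZ// circle_eigen//.
(* The product (-r)^(n - i) (k / r)^(n - i) is (-k)^(n - i): apart from the prefactor (-r)^k the
   charge disappears, and whether the sum vanishes depends on k and n only. *)
have -> : \sum_(i < n.+1) 'C(k + n, i)%:R * (- l^-1) ^+ (k + n - i) *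
    ((k%:R / l^-1) ^+ (n - i) / (n - i)`!%:R) = (- l^-1) ^+ k * shift_coef R n k.
  rewrite /shift_coef mulr_sumr; apply: eq_bigr => -[i /= ltin] _.
  rewrite -addnBA// exprD.
  have -> : (- k%:R) ^+ (n - i) = (- l^-1) ^+ (n - i) * (k%:R / l^-1) ^+ (n - i) :> R.
    by rewrite -exprMn; congr (_ ^+ _); field; rewrite gt_eqF.
  by ring.
rewrite /eigenvalue_turn !rmorphM/= /A /Psi; ring.
Qed.

Lemma moment_zero (F : heis R -> R) : intg haarf F -> vanishes_at F l ->
  shift_coef R n k != 0 -> cint haarf (fun q => (F q)%:C%C * Psi tau a1 a2 n q) = 0.
Proof.
move=> Fi Fl sc0.
have [C PsiC] := @Psi_bounded R tau n tau0.
have FPi : cintg haarf (fun q => (F q)%:C%C * Psi tau a1 a2 n q).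
  by apply: (cintg_bounded (C := C)) => //; [exact: cmeas_Psi|move=> p; exact: PsiC].
have K0 : eigenvalue_turn%:C%C != 0 :> R[i].
  apply: normc_neq0; rewrite normc_real normr_eq0.
  apply: mulf_neq0; first by rewrite gt_eqF ?expR_gt0.
  apply: mulf_neq0; first by rewrite gt_eqF// !mulr_gt0 ?invr_gt0 ?pi_gt0.
  by apply: mulf_neq0 => //; rewrite expf_neq0// oppr_eq0 invr_eq0 gt_eqF.
apply: (mulfI K0); rewrite mulr0 -cintZ//.
have [C' PsiC'] := @Psi_bounded R tau (k + n) tau0.
have [mr mi] := cmeas_Psi tau a1 a2 (k + n).
have E q : eigenvalue_turn%:C%C * ((F q)%:C%C * Psi tau a1 a2 n q) =
    (F q)%:C%C * cint leb (fun s => (\1_(turn P) s)%:C%C * Psi tau a1 a2 (k + n) (back l q s)).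
  by rewrite Psi_eigen mulrCA.
rewrite (funext E).
apply: complex_eq => /=.
  rewrite -[RHS](@orthogonality _ _ l0 (fun p => Re (Psi tau a1 a2 (k + n) p)) C' mr _ _ F)//.
  - apply: eq_Rintegral => q _ /=; rewrite mul0r subr0; congr (_ * _).
    by apply: eq_Rintegral => s _; rewrite cReM /= mul0r subr0.
  - by move=> p; apply: le_trans (normc_re _) _; exact: PsiC'.
  - by move=> p; rewrite Psi_turn.
rewrite -[RHS](@orthogonality _ _ l0 (fun p => Im (Psi tau a1 a2 (k + n) p)) C' mi _ _ F)//.
- apply: eq_Rintegral => q _ /=; rewrite mul0r addr0; congr (_ * _).
  by apply: eq_Rintegral => s _; rewrite cImM /= mul0r addr0.
- by move=> p; apply: le_trans (normc_im _) _; exact: PsiC'.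
- by move=> p; rewrite Psi_turn.
Qed.

End one_charge.

Lemma ccvg_cis (u : nat -> R) (x : R) : u n @[n --> \oo] --> x -> ccvg (fun n => cis (u n)) (cis x).
Proof.
move=> ux; split.
  exact: (continuous_cvg _ (@continuous_cos R x)).
exact: (continuous_cvg _ (@continuous_sin R x)).
Qed.

Lemma ccvg_real (u : nat -> R) (x : R) : u n @[n --> \oo] --> x ->
  ccvg (fun n => (u n)%:C%C) x%:C%C.
Proof. by move=> ux; split=> //; exact: cvg_cst. Qed.

(** The frequencies approach tau from above, so that the bound of [Psi_bounded] at tau covers the
    whole sequence. *)
Lemma moment_limit (F : heis R -> R) (tau_ : nat -> R) tau a1 a2 n : intg haarf F ->
  0 < tau -> (forall j, tau <= tau_ j) -> tau_ j @[j --> \oo] --> tau ->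
  (forall j, cint haarf (fun q => (F q)%:C%C * Psi (tau_ j) a1 a2 n q) = 0) ->
  cint haarf (fun q => (F q)%:C%C * Psi tau a1 a2 n q) = 0.
Proof.
move=> Fi tau0 tt ct F0; have [C PsiC] := @Psi_bounded R tau n tau0.
have [|||_] := @cdct _ _ _ haarf (fun j q => (F q)%:C%C * Psi (tau_ j) a1 a2 n q)
  (fun q => (F q)%:C%C * Psi tau a1 a2 n q) (fun q => C * `|F q|) _ _ (intgZ C (intg_norm Fi)).
- move=> j; apply: cmeasM; last exact: cmeas_Psi.
  by apply: cmeas_real; exact: intg_meas Fi.
- move=> q; apply: (ccvgM (ccvg_cst _)); apply: ccvgM; last exact: ccvg_cst.
  apply: ccvgM.
    apply: ccvg_cis; apply: cvgD.
      by apply: cvgN; apply: cvgM => //; exact: cvg_cst.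
    by apply: cvgM; [apply: cvgM => //|]; exact: cvg_cst.
  apply: ccvg_real; apply: (continuous_cvg _ (@continuous_expR R _)).
  by apply: cvgN; apply: cvgM; [apply: cvgM => //|]; exact: cvg_cst.
- move=> j q; rewrite ComplexField.Normc.normcM normc_real mulrC ler_wpM2r//.
  exact: PsiC.
move=> lim; apply: (ccvg_unique lim).
by apply: (@ccvg_near _ (fun=> 0) _ _ 0%N); [move=> j _; rewrite F0|exact: ccvg_cst].
Qed.

Section dense_charges.
Variables (F : heis R -> R) (eta : R).
Hypotheses (Fi : intg haarf F) (eta0 : 0 < eta).
Hypothesis dense : forall al be, 0 < al -> al < be -> be <= eta ->
  exists2 l, al < l < be & vanishes_at F l.

Lemma all_moments_zero tau a1 a2 n : 0 < tau ->
  cint haarf (fun q => (F q)%:C%C * Psi tau a1 a2 n q) = 0.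
Proof.
move=> tau0.
(* This lower bound on k puts the charge sqrt(tau / (2 k)) below eta. *)
have [k kK sc0] := shift_coef_neq0 R n (Num.truncn (tau / (2 * eta ^+ 2))).
have k0 : (0 < k)%N by rewrite (leq_trans _ kK).
have kR : 0 < k%:R :> R by rewrite ltr0n.
have ke : tau < 2 * k%:R * eta ^+ 2.
  rewrite mulrAC -ltr_pdivrMl ?mulr_gt0 ?exprn_gt0// mulrC.
  by apply: lt_le_trans (truncnS_gt _) _; rewrite ler_nat.
pose ls : R := Num.sqrt (tau / (2 * k%:R)).
have ls2 : 2 * k%:R * ls ^+ 2 = tau.
  rewrite sqr_sqrtr; last by rewrite divr_ge0 ?mulr_ge0// ltW.
  by field; rewrite gt_eqF.
have ls0 : 0 < ls by rewrite sqrtr_gt0 divr_gt0// mulr_gt0.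
have lse : ls < eta.
  rewrite -(ltr_pXn2r (n := 2))//; try by rewrite nnegrE ltW.
  by rewrite -(ltr_pM2l (x := 2 * k%:R)) ?mulr_gt0// ls2.
(* The charge [ls] itself need not be among the good ones; it is approached by good charges from
   above, with k kept fixed. *)
have ex j : exists l, (ls < l < Num.min eta (ls + j.+1%:R^-1)) /\ vanishes_at F l.
  have [|||l ll lv] := dense (al := ls) (be := Num.min eta (ls + j.+1%:R^-1)) => //.
  - by rewrite lt_min lse ltrDl invr_gt0 ltr0n.
  - by rewrite ge_min lexx.
  - by exists l.
pose l_ j := projT1 (cid (ex j)).
have [lo hi lv] : [/\ forall j, ls < l_ j, forall j, l_ j < ls + j.+1%:R^-1 &
    forall j, vanishes_at F (l_ j)].
  by split=> j; rewrite /l_; case: cid => l /= [/andP[]]; rewrite lt_min => ? /andP[].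
have cl : l_ j @[j --> \oo] --> ls.
  apply: (@squeeze_cvgr _ _ _ _ (fun=> ls) (fun j => ls + j.+1%:R^-1)).
  - by apply: nearW => j; rewrite !ltW.
  - exact: cvg_cst.
  - by rewrite -[X in _ --> X]addr0; apply: cvgD; [exact: cvg_cst|exact: cvg_harmonic].
apply: (@moment_limit F (fun j => 2 * k%:R * l_ j ^+ 2)) => //.
- move=> j; have lj := lo j; rewrite -ls2 ler_pM2l ?mulr_gt0//.
  by apply: lerXn2r; rewrite ?nnegrE; apply: ltW => //; exact: lt_trans ls0 lj.
- by rewrite -ls2; apply: cvgM; [exact: cvg_cst|apply: cvgM].
- by move=> j; apply: moment_zero => //; exact: lt_trans (lo j).
Qed.

End dense_charges.
End vanishing_moments.

(** * From vanishing moments to a vanishing function *)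

Section real_uniqueness.
Variable R : realType.
Variable F : heis R -> R.
Hypothesis Fi : intg haarf F.

Let px : measurable_fun setT (fun p : heis R => p.1.1 : measurableTypeR R).
Proof. by do 2 apply: (measurableT_comp measurable_fst). Qed.

Let py : measurable_fun setT (fun p : heis R => p.1.2 : measurableTypeR R).
Proof. by apply: (measurableT_comp measurable_snd). Qed.

Let pt : measurable_fun setT (fun p : heis R => p.2 : measurableTypeR R).
Proof. exact: measurable_snd. Qed.

Let gauss (tau : R) (p : heis R) := expR (- (tau / 4 * (p.1.1 ^+ 2 + p.1.2 ^+ 2))).

Section fourier.
Variables (tau : R).
Hypothesis tau0 : 0 < tau.
Hypothesis moments : forall a1 a2 n,
  cint haarf (fun q => (F q)%:C%C * Psi tau a1 a2 n q) = 0.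

(* The moments of all orders add up to an exponential which turns the shifted
   Gaussian back into a centred one. *)
Lemma Psi0_cexp a1 a2 (q : heis R) :
  Psi tau a1 a2 0 q * cexp ((- (tau / 2 * a1) +i* - (tau / 2 * a2))%C * offset a1 a2 q) =
  (expR (tau / 4 * (a1 ^+ 2 + a2 ^+ 2)) * gauss tau q)%:C%C *
  cis (- (tau * q.2) + tau * (a1 * q.1.2 - a2 * q.1.1)).
Proof.
case: q => [[x y] t]; rewrite /Psi expr0 mulr1 /cexp /gauss /offset /dist2/=.
set c1 := cis _; set e1 := expR _; set e2 := expR _; set c2 := cis _.
rewrite -expRD; have -> : c1 * e1%:C%C * (e2%:C%C * c2) = (e1 * e2)%:C%C * (c1 * c2).
  by rewrite rmorphM/=; ring.
rewrite /e1 /e2 /c1 /c2 -expRD -cisD; congr ((expR _)%:C%C * cis _); by field.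
Qed.

Lemma gauss_char0 a1 a2 : cint haarf (fun q => (F q * gauss tau q)%:C%C *
  cis (- (tau * q.2) + tau * (a1 * q.1.2 - a2 * q.1.1))) = 0.
Proof.
(* With a = a1 + i a2, this is - (tau / 2) a: the real part of w conj(z - a) cancels the cross term
   of the shifted Gaussian, and its imaginary part doubles the horizontal phase of [Psi]. *)
set w : R[i] := (- (tau / 2 * a1) +i* - (tau / 2 * a2))%C.
pose f N (q : heis R) : R[i] := (F q)%:C%C * (Psi tau a1 a2 0 q * expS N (w * offset a1 a2 q)).
set c0 : R := expR (tau / 4 * (a1 ^+ 2 + a2 ^+ 2)).
have c0n : c0%:C%C != 0 :> R[i] by apply: normc_neq0; rewrite normc_real normr_eq0 gt_eqF ?expR_gt0.
have gle1 q : gauss tau q <= 1.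
  by rewrite expR_le1 oppr_le0 !mulr_ge0 ?addr_ge0 ?sqr_ge0// ltW.
have mF := intg_meas Fi.
have mg : measurable_fun setT (gauss tau).
  apply: measurableT_comp => //; apply: measurableT_comp => //.
  by apply: measurable_funM => //; apply: measurable_funD; exact: measurable_funX.
have [||||_] := @cdct _ _ _ haarf f (fun q => (F q)%:C%C * (Psi tau a1 a2 0 q * cexp (w * offset
  a1 a2 q)))
   (fun q => expR (normc w ^+ 2 / tau) * `|F q|).
- move=> N; apply: cmeasM; first exact: cmeas_real.
  apply: cmeasM; first exact: cmeas_Psi.
  by apply: cmeas_expS; apply: cmeasM; [exact: cmeas_cst|exact: cmeas_offset].
- move=> q; do 2 apply: (ccvgM (ccvg_cst _)); exact: ccvg_expS.
- exact: intgZ (intg_norm Fi).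
- move=> N q; rewrite ComplexField.Normc.normcM normc_real mulrC ler_wpM2r//.
  rewrite ComplexField.Normc.normcM normc_Psi expr0 mulr1.
  apply: le_trans (ler_wpM2l (expR_ge0 _) (normc_expS _ _)) _.
  rewrite -expRD ler_expR ComplexField.Normc.normcM -normc_offset.
  set u := normc w; set v := normc _.
  (* Completing the square: the Gaussian absorbs the exponential growth of the partial sums,
     uniformly in N. *)
  rewrite -subr_ge0 (_ : _ - _ = (tau / 2 * v - u) ^+ 2 / tau).
    by rewrite divr_ge0 ?sqr_ge0// ltW.
  by field; rewrite gt_eqF.
move=> lim; apply: (mulfI c0n); rewrite mulr0 -cintZ; last first.
  apply: (cintg_bounded (C := 1)).
  - apply: (intgM_bounded (C := 1)) => // q.
    by rewrite ger0_norm ?expR_ge0.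
  - apply: cmeas_cis; apply: measurable_funD.
      by apply: measurableT_comp => //; exact: measurable_funM.
    by apply: measurable_funM => //; apply: measurable_funB; exact: measurable_funM.
  - by move=> q; rewrite normc_cis.
have -> : (fun q => c0%:C%C * ((F q * gauss tau q)%:C%C *
    cis (- (tau * q.2) + tau * (a1 * q.1.2 - a2 * q.1.1)))) =
    (fun q => (F q)%:C%C * (Psi tau a1 a2 0 q * cexp (w * offset a1 a2 q))).
  by apply/funext => q; rewrite Psi0_cexp -/c0 !rmorphM/=; ring.
apply: (ccvg_unique lim).
apply: (@ccvg_near _ (fun=> 0) _ _ 0%N); last exact: ccvg_cst.
move=> N _; apply/esym.
transitivity (\sum_(i < N) (w ^+ i / i`!%:R) * cint haarf (fun q => (F q)%:C%C * Psi tau a1 a2 i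
  q)).
  have PI i : cintg haarf (fun q => (F q)%:C%C * Psi tau a1 a2 i q).
    have [C PsiC] := @Psi_bounded R tau i tau0.
    by apply: (cintg_bounded (C := C)) => //; [exact: cmeas_Psi|move=> p; exact: PsiC].
  under eq_bigr do rewrite -cintZ//.
  rewrite -cint_sum; last by move=> i; exact: cintgZ.
  congr cint; apply/funext => q; rewrite /f /expS !mulr_sumr.
  by apply: eq_bigr => i _; rewrite exprMn /Psi; ring.
by rewrite big1// => i _; rewrite moments mulr0.
Qed.

Lemma gauss_char xi eta c : \int[haarf]_q (F q * gauss tau q *
  cos (xi * q.1.1 + eta * q.1.2 - tau * q.2 + c)) = 0.
Proof.
(* The centre is chosen so that tau (a1 y - a2 x) = xi x + eta y; any horizontal frequency arises
   because tau is nonzero. *)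
have := gauss_char0 (eta / tau) (- xi / tau).
set f := (X in cint haarf X) => f0.
have tn0 : tau != 0 by rewrite gt_eqF.
have mg : measurable_fun setT (gauss tau).
  apply: measurableT_comp => //; apply: measurableT_comp => //.
  by apply: measurable_funM => //; apply: measurable_funD; exact: measurable_funX.
have fi : cintg haarf f.
  apply: (cintg_bounded (C := 1)).
  - apply: (intgM_bounded (C := 1)) => // q.
    rewrite ger0_norm ?expR_ge0// expR_le1 oppr_le0 !mulr_ge0 ?addr_ge0 ?sqr_ge0//.
    exact: ltW.
  - apply: cmeas_cis; apply: measurable_funD.
      by apply: measurableT_comp => //; exact: measurable_funM.
    by apply: measurable_funM => //; apply: measurable_funB; exact: measurable_funM.
  - by move=> q; rewrite normc_cis.
have : cint haarf (fun q => cis c * f q) = 0 by rewrite cintZ// f0 mulr0.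
move=> /(congr1 (@complex.Re _)) E.
have {}E : \int[haarf]_q Re (cis c * f q) = 0 by exact: E.
rewrite -[RHS]E; apply: eq_Rintegral => q _.
rewrite /f mulrCA -cisD cReM /= mul0r subr0; congr (_ * cos _).
by field.
Qed.

End fourier.

Let gauss_meas tau : measurable_fun setT (gauss tau).
Proof.
apply: measurableT_comp => //; apply: measurableT_comp => //.
by apply: measurable_funM => //; apply: measurable_funD; exact: measurable_funX.
Qed.

Hypothesis moments : forall tau a1 a2 n, 0 < tau ->
  cint haarf (fun q => (F q)%:C%C * Psi tau a1 a2 n q) = 0.

Let mcosp (f : heis R -> R) (c d : R) : measurable_fun setT f ->
  measurable_fun setT (fun q => cos (c * f q + d)).
Proof.
move=> mf; apply: (measurableT_comp (continuous_measurable_fun (@continuous_cos R))).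
by apply: measurable_funD => //; exact: measurable_funM.
Qed.

Let cos1 (x : R) : `|cos x| <= 1.
Proof. by rewrite ler_norml cos_geN1 cos_le1. Qed.

Let gauss01 tau q : 0 < tau -> 0 <= gauss tau q <= 1.
Proof.
move=> tau0; rewrite expR_ge0 expR_le1 oppr_le0 !mulr_ge0 ?addr_ge0 ?sqr_ge0//.
exact: ltW.
Qed.

(** The product form lets the one-variable uniqueness theorem be applied to x and to y in turn.
    Signs are arranged so that all four characters of the expansion have vertical frequency -tau,
    the one carried by the Gaussian. *)
Lemma gauss_cos3 tau xi a eta b c : 0 < tau ->
  \int[haarf]_q (F q * gauss tau q * cos (eta * q.1.2 + b) * cos (tau * q.2 + c) *
    cos (xi * q.1.1 + a)) = 0.
Proof.
move=> tau0; have G := gauss_char tau0 (fun a1 a2 n => moments a1 a2 n tau0).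
pose I x y d := fun q : heis R => F q * gauss tau q * cos (x * q.1.1 + y * q.1.2 - tau * q.2 + d).
have Ii x y d : intg haarf (I x y d).
  apply: (intgM_bounded (C := 1)) => //.
    apply: (intgM_bounded (C := 1)) => // q.
    by have /andP[? ?] := gauss01 q tau0; rewrite ger0_norm.
  apply: (measurableT_comp (continuous_measurable_fun (@continuous_cos R))).
  apply: measurable_funD => //; apply: measurable_funB; last exact: measurable_funM.
  by apply: measurable_funD; exact: measurable_funM.
transitivity (\int[haarf]_q (4^-1 * ((I xi eta (a + b - c) q + I xi (- eta) (a - b - c) q) +
   (I (- xi) (- eta) (- a - b - c) q + I (- xi) eta (- a + b - c) q)))).
  apply: eq_Rintegral => q _; rewrite /I.
  set A := xi * q.1.1 + a; set B := eta * q.1.2 + b; set D := tau * q.2 + c.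
  rewrite (_ : xi * _ + eta * _ - _ + _ = A + B - D); last by rewrite /A /B /D; ring.
  rewrite (_ : xi * _ + - eta * _ - _ + _ = A - B - D); last by rewrite /A /B /D; ring.
  rewrite (_ : - xi * _ + - eta * _ - _ + _ = - (A + B + D)); last by rewrite /A /B /D; ring.
  rewrite (_ : - xi * _ + eta * _ - _ + _ = - (A - B + D)); last by rewrite /A /B /D; ring.
  rewrite !cosN (cosB (A + B)) (cosB (A - B)) (cosD (A + B)) (cosD (A - B)) (cosD A) (cosB A).
  by field.
rewrite RintegralZl ?RintegralD//; try by repeat apply: intgD.
by rewrite /I !G !addr0 mulr0.
Qed.

(** The growing exponential cancels one coordinate of the Gaussian, so that testing against this
    function localizes and removes the weight at the same time. *)
Let expx (tau : R) (A : set R) (x : R) := \1_A x * expR (tau / 4 * x ^+ 2).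

Let expx_ge0 tau A x : 0 <= expx tau A x.
Proof. by rewrite mulr_ge0 ?expR_ge0. Qed.

Let expx_meas tau (A : set R) : measurable A -> measurable_fun setT (expx tau A).
Proof.
move=> mA; apply: measurable_funM; first exact: measurable_indic.
by apply: measurableT_comp => //; apply: measurable_funM => //; exact: measurable_funX.
Qed.

Let indic1 (A : set R) (x : R) : `|\1_A x| <= 1 :> R.
Proof. by rewrite indicE; case: (_ \in _); rewrite ?normr1 ?normr0. Qed.

Lemma fourier_t_pos tau c (A B : set R) : 0 < tau -> measurable A -> measurable B ->
  \int[haarf]_q (F q * (\1_A q.1.1 * \1_B q.1.2) * cos (tau * q.2 + c)) = 0.
Proof.
move=> tau0 mA mB.
pose gy (q : heis R) := expR (- (tau / 4 * q.1.2 ^+ 2)).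
have gE q : gauss tau q * expR (tau / 4 * q.1.1 ^+ 2) = gy q.
  by rewrite /gauss /gy -expRD; congr expR; ring.
have gE' q : gy q * expR (tau / 4 * q.1.2 ^+ 2) = 1.
  by rewrite /gy -expRD addNr expR0.
have mgy : measurable_fun setT gy.
  apply: measurableT_comp => //; apply: measurableT_comp => //.
  by apply: measurable_funM => //; exact: measurable_funX.
have gy1 q : `|gy q| <= 1.
  by rewrite ger0_norm ?expR_ge0// expR_le1 oppr_le0 mulr_ge0 ?sqr_ge0// divr_ge0// ltW.
have mAx : measurable_fun setT (fun q : heis R => \1_A q.1.1 : R).
  exact: (measurableT_comp (measurable_indic mA) px).
have mBy : measurable_fun setT (fun q : heis R => \1_B q.1.2 : R).
  exact: (measurableT_comp (measurable_indic mB) py).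
have i1 : intg haarf (fun q => F q * \1_A q.1.1).
  by apply: (intgM_bounded (C := 1)).
have i2 : intg haarf (fun q => F q * \1_A q.1.1 * cos (tau * q.2 + c)).
  by apply: (intgM_bounded (C := 1)) => //; exact: mcosp.
have i3 : intg haarf (fun q => F q * \1_A q.1.1 * cos (tau * q.2 + c) * gy q).
  by apply: (intgM_bounded (C := 1)).
have sx eta b : \int[haarf]_q ((F q * \1_A q.1.1 * cos (tau * q.2 + c) * gy q) * cos (eta * q.1.2
  + b)) = 0.
  have i4 : intg haarf (fun q => F q * gauss tau q * cos (eta * q.1.2 + b) * cos (tau * q.2 + c)).
    apply: (intgM_bounded (C := 1)) => //; last exact: mcosp.
    apply: (intgM_bounded (C := 1)) => //; last exact: mcosp.
    apply: (intgM_bounded (C := 1)) => // q.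
    by have /andP[? ?] := gauss01 q tau0; rewrite ger0_norm.
  have E q : F q * gauss tau q * cos (eta * q.1.2 + b) * cos (tau * q.2 + c) * expx tau A q.1.1 =
      (F q * \1_A q.1.1 * cos (tau * q.2 + c) * gy q) * cos (eta * q.1.2 + b).
    by rewrite -gE /expx; ring.
  rewrite -(funext E).
  (* Uniqueness in x, with y and t frozen into cosines; the factor [gy] of the Gaussian is left. *)
  apply: (trig_unique i4 px (fun xi a => gauss_cos3 xi a eta b c tau0) (expx_meas tau mA)) => //.
  rewrite (funext E); apply: (intgM_bounded (C := 1)) => //; exact: mcosp.
have E q : (F q * \1_A q.1.1 * cos (tau * q.2 + c) * gy q) * expx tau B q.1.2 =
    F q * (\1_A q.1.1 * \1_B q.1.2) * cos (tau * q.2 + c).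
  rewrite -[RHS]mulr1 -(gE' q) /expx; ring.
(* Uniqueness in y removes the rest of the Gaussian. The vertical variable has to wait, as the
   weight depends on tau until this point. *)
rewrite -(funext E); apply: (trig_unique i3 py sx (expx_meas tau mB)) => //.
rewrite (funext E); apply: (intgM_bounded (C := 1)) => //; last exact: mcosp.
apply: (intgM_bounded (C := 1)) => //; first exact: measurable_funM.
by move=> q; rewrite normrM -[leRHS]mulr1 ler_pM.
Qed.

(** Negative frequencies follow by parity of the cosine, and frequency 0 as the limit of the
    frequencies 1 / (n + 1). *)
Lemma fourier_t tau c (A B : set R) : measurable A -> measurable B ->
  \int[haarf]_q (F q * (\1_A q.1.1 * \1_B q.1.2) * cos (tau * q.2 + c)) = 0.
Proof.
move=> mA mB.
have [tau0|tau0|->] := ltgtP tau 0.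
- rewrite -[RHS](@fourier_t_pos (- tau) (- c) A B)//; last by rewrite oppr_gt0.
  by apply: eq_Rintegral => q _; rewrite -[in RHS]cosN; congr (_ * cos _); ring.
- exact: fourier_t_pos.
have mAx : measurable_fun setT (fun q : heis R => \1_A q.1.1 : R).
  exact: (measurableT_comp (measurable_indic mA) px).
have mBy : measurable_fun setT (fun q : heis R => \1_B q.1.2 : R).
  exact: (measurableT_comp (measurable_indic mB) py).
have i1 : intg haarf (fun q => F q * (\1_A q.1.1 * \1_B q.1.2)).
  apply: (intgM_bounded (C := 1)) => //; first exact: measurable_funM.
  by move=> q; rewrite normrM -[leRHS]mulr1 ler_pM.
have [|||_] := @dct _ _ _ haarf (fun n q => F q * (\1_A q.1.1 * \1_B q.1.2) * cos (n.+1%:R^-1 *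
  q.2 + c))
  (fun q => F q * (\1_A q.1.1 * \1_B q.1.2) * cos (0 * q.2 + c)) _ _ _ (intg_norm i1).
- move=> n; apply: measurable_funM; [exact: intg_meas i1|exact: mcosp].
- move=> q; apply: cvgMr; apply: (continuous_cvg _ (@continuous_cos R _)).
  apply: cvgD; last exact: cvg_cst.
  by apply: cvgM; [exact: cvg_harmonic|exact: cvg_cst].
- by move=> n q; rewrite normrM -[leRHS]mulr1 ler_wpM2l.
under eq_cvg do rewrite fourier_t_pos//.
by move=> /(cvg_unique _ (cvg_cst 0)) <-.
Qed.

(** Uniqueness in t gives zero integrals over all measurable boxes; the monotone class argument
    extends this to sets in the plane times a vertical set, and then to all measurable sets. *)
Lemma ae_zero : {ae haarf, forall p, F p = 0}.
Proof.
have F1 : intg haarf (fun x => F x * 1) by under eq_fun do rewrite mulr1.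
have NZ := @null_classZ _ _ _ haarf F.
have NB := @null_classB _ _ _ haarf F.
have NL := @null_class_lim _ _ _ haarf F (fun=> 1) (fun=> ler01) F1.
have box (A B C : set R) : measurable A -> measurable B -> measurable C ->
    null_class haarf F (fun q => \1_A q.1.1 * (\1_B q.1.2 * \1_C q.2)).
  move=> mA mB mC.
  have mAx : measurable_fun setT (fun q : heis R => \1_A q.1.1 : R).
    exact: (measurableT_comp (measurable_indic mA) px).
  have mBy : measurable_fun setT (fun q : heis R => \1_B q.1.2 : R).
    exact: (measurableT_comp (measurable_indic mB) py).
  have mCt : measurable_fun setT (fun q : heis R => \1_C q.2 : R).
    exact: (measurableT_comp (measurable_indic mC) pt).
  have i1 : intg haarf (fun q => F q * (\1_A q.1.1 * \1_B q.1.2)).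
    apply: (intgM_bounded (C := 1)) => //; first exact: measurable_funM.
    by move=> q; rewrite normrM -[leRHS]mulr1 ler_pM.
  have i2 : intg haarf (fun q => F q * (\1_A q.1.1 * \1_B q.1.2) * \1_C q.2).
    exact: (intgM_bounded (C := 1)).
  have E q : F q * (\1_A q.1.1 * (\1_B q.1.2 * \1_C q.2)) =
    F q * (\1_A q.1.1 * \1_B q.1.2) * \1_C q.2 by ring.
  rewrite /null_class (funext E); split; first exact: i2.
  apply: (trig_unique i1 pt (fun tau c => fourier_t tau c mA mB) (h := \1_C)) => //.
have cyl (D : set (measurableTypeR R * measurableTypeR R)) (C : set R) :
    measurable D -> measurable C ->
    null_class haarf F (fun q => \1_D q.1 * (\1_C q.2 * 1)).
  move=> mD mC; have := @class_prod _ _ _ (fun=> 1) NZ NB NL _ _ _ _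
    (fun q : heis R => q.1.1) (fun q : heis R => q.1.2) (fun q : heis R => \1_C q.2) 1 _ _ D mD.
  move=> H; rewrite (_ : (fun q => _) = (fun q : heis R => \1_D (q.1.1, q.1.2) * \1_C q.2)).
    by apply: H => [q|A B mA mB]; [rewrite mulr1|exact: box].
  by apply/funext => -[[x y] t] /=; rewrite mulr1.
have all (D : set (heis R)) : measurable D -> null_class haarf F (fun q => \1_D q * 1).
  move=> mD; have := @class_prod _ _ _ (fun=> 1) NZ NB NL _ _ _ _
    (fun q : heis R => q.1) (fun q : heis R => q.2) (fun=> 1) 1 _ _ D mD.
  move=> H; rewrite (_ : (fun q => _) = (fun q : heis R => \1_D (q.1, q.2) * 1)).
    by apply: H => [q|A B mA mB]; [rewrite normr1 mulr1|exact: cyl].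
  by apply/funext => -[[x y] t].
have : ae_eq haarf setT (EFin \o F) (cst 0%E).
  apply: integral_ae_eq => //= E _ mE; rewrite integral0 integral_mkcond.
  have [Ei E0] := all E mE.
  rewrite epatch_indic -[LHS]fineK; last first.
    apply: integrable_fin_num => //; apply: eq_integrable Ei => // q _ /=.
    by rewrite mulr1 EFinM.
  congr EFin; rewrite -[RHS]E0 /Rintegral; congr fine.
  by apply: eq_integral => q _ /=; rewrite mulr1 EFinM.
by apply: filterS => q /= /(_ Logic.I) [].
Qed.

End real_uniqueness.

(** * Density of continuous functions of compact support *)

Section approximation.
Variable R : realType.
Local Notation leb := (@lebesgue_measure R).
Implicit Types (f g : heis R -> R).

Definition bounded_support f :=
  exists M, forall p, f p != 0 -> [/\ `|p.1.1| <= M, `|p.1.2| <= M & `|p.2| <= M].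

(** Shaped to satisfy the closure conditions of the monotone class theorem, so that density is
    obtained by the same argument as uniqueness, starting from boxes. *)
Definition approximable f := intg haarf f /\ forall eps, 0 < eps ->
  exists g, [/\ continuous g, bounded_support g, intg haarf g &
    \int[haarf]_p `|f p - g p| <= eps].

Lemma approximable_refl g : continuous g -> bounded_support g -> intg haarf g ->
  approximable g.
Proof.
move=> cg bg gi; split=> // eps eps0; exists g; split=> //.
under eq_Rintegral do rewrite subrr normr0.
by rewrite /Rintegral integral0 ltW.
Qed.

Lemma approximableZ c f : approximable f -> approximable (fun p => c * f p).
Proof.
move=> [fi fa]; split=> [|eps eps0]; first exact: intgZ.
have d0 : 0 < eps / (`|c| + 1) by rewrite divr_gt0// ltr_wpDl.
have [g [cg [M bg] gi fg]] := fa _ d0.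
exists (fun p => c * g p); split.
- by move=> p; apply: cvgM; [exact: cvg_cst|exact: cg].
- by exists M => p; rewrite mulf_eq0 negb_or => /andP[_]; exact: bg.
- exact: intgZ.
- under eq_Rintegral do rewrite -mulrBr normrM.
  rewrite RintegralZl//; last by apply: intg_norm; exact: intgB.
  apply: le_trans (_ : (`|c| + 1) * (eps / (`|c| + 1)) <= _).
    apply: ler_pM => //; last by rewrite lerDl.
    by apply: Rintegral_ge0.
  by rewrite mulrC divfK// gt_eqF// ltr_wpDl.
Qed.

Lemma approximableB f g : approximable f -> approximable g ->
  approximable (fun p => f p - g p).
Proof.
move=> [fi fa] [gi ga]; split=> [|eps eps0]; first exact: intgB.
have d0 : 0 < eps / 2 by rewrite divr_gt0.
have [f' [cf [M bf] f'i ff]] := fa _ d0.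
have [g' [cg [N bg] g'i gg]] := ga _ d0.
exists (fun p => f' p - g' p); split.
- by move=> p; apply: cvgB; [exact: cf|exact: cg].
- exists (Num.max M N) => p; have [->|f0 _] := eqVneq (f' p) 0.
    rewrite sub0r oppr_eq0 => /bg[? ? ?].
    by split; rewrite le_max; apply/orP; right.
  by have [? ? ?] := bf _ f0; split; rewrite le_max; apply/orP; left.
- exact: intgB.
- apply: le_trans (_ : \int[haarf]_p (`|f p - f' p| + `|g p - g' p|) <= _).
    apply: le_Rintegral => //.
    + by apply: intg_norm; apply: intgB; exact: intgB.
    + by apply: intgD; apply: intg_norm; exact: intgB.
    + move=> p _; rewrite (_ : _ - _ - _ = (f p - f' p) - (g p - g' p)); last by ring.
      exact: ler_normB.
  rewrite RintegralD//; try by apply: intg_norm; exact: intgB.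
  by rewrite [leRHS]splitr lerD.
Qed.

Lemma approximable_lim e (h_ : nat -> heis R -> R) h C : intg haarf e ->
  (forall n, approximable (h_ n)) -> (forall n p, `|h_ n p| <= C * e p) ->
  (forall p, h_ ^~ p @ \oo --> h p) -> approximable h.
Proof.
move=> ei ha hC ch.
have Ce := intgZ C ei.
have [hi _] := dct (fun n => intg_meas (ha n).1) ch Ce hC.
split=> // eps eps0.
have hle p : `|h p| <= C * e p.
  by apply: (cvgr_to_le (cvg_norm (ch p))); apply: nearW => n; exact: hC.
have [|||_] := @dct _ _ _ haarf (fun n p => `|h p - h_ n p|) (fun=> 0)
  (fun p => 2 * (C * e p)) _ _ (intgZ 2 Ce).
- by move=> n; apply: measurableT_comp => //; apply: intg_meas (intgB hi (ha n).1).
- move=> p; rewrite -[X in _ --> X](@normr0 _ R) -(subrr (h p)).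
  by apply: cvg_norm; apply: cvgB; [exact: cvg_cst|exact: ch].
- by move=> n p; rewrite normr_id (le_trans (ler_normB _ _))// mulr_natl mulr2n lerD.
rewrite [X in _ --> X](_ : _ = 0); last by rewrite /Rintegral integral0.
move=> /cvgrPdist_le/(_ (eps / 2)) []; first by rewrite divr_gt0.
move=> N _ /(_ N (leqnn N)) /=; rewrite sub0r normrN => hN.
have [g [cg bg gi hg]] := (ha N).2 _ (divr_gt0 eps0 (ltr0n _ 2)).
exists g; split=> //.
apply: le_trans (_ : \int[haarf]_p (`|h p - h_ N p| + `|h_ N p - g p|) <= _).
  apply: le_Rintegral => //.
  - by apply: intg_norm; exact: intgB.
  - by apply: intgD; apply: intg_norm; apply: intgB => //; exact: (ha N).1.
  - by move=> p _; rewrite (le_trans _ (ler_normD _ _))// addrA subrK.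
rewrite RintegralD//.
- by rewrite [leRHS]splitr lerD// (le_trans (ler_norm _)).
- by apply: intg_norm; apply: intgB => //; exact: (ha N).1.
- by apply: intg_norm; apply: intgB => //; exact: (ha N).1.
Qed.

(** A continuous trapezoid with sides of slope n, which exhausts the indicator of the open interval
    from below. *)
Definition trap (a b : R) n (x : R) :=
  Num.max 0 (Num.min 1 (n%:R * Num.min (x - a) (b - x))).

Lemma continuous_trap a b n : continuous (trap a b n).
Proof.
move=> x.
apply: (@continuous_max _ _ (fun=> 0) (fun x => Num.min 1 (n%:R * Num.min (x - a) (b - x)))).
  exact: cst_continuous.
apply: (@continuous_min _ _ (fun=> 1) (fun x => n%:R * Num.min (x - a) (b - x))).
  exact: cst_continuous.
apply: cvgM; first exact: cvg_cst.
apply: (@continuous_min _ _ (fun x => x - a) (fun x => b - x)).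
- by apply: cvgB; [exact: cvg_id|exact: cvg_cst].
- by apply: cvgB; [exact: cvg_cst|exact: cvg_id].
Qed.

Lemma trap_ge0 a b n x : 0 <= trap a b n x.
Proof. by rewrite le_max lexx. Qed.

Lemma trap_le_indic a b n x : trap a b n x <= \1_(`]a, b[%classic : set R) x.
Proof.
rewrite indicE; have [|xab] := boolP (x \in _).
  by move=> _; rewrite ge_max ler01 ge_min lexx.
rewrite ge_max lexx ge_min; apply/orP; right.
rewrite mulr_ge0_le0// ge_min !subr_le0 //.
by move: xab; rewrite notin_setE/= in_itv/= => /negP; rewrite negb_and -!leNgt.
Qed.

Lemma cvg_trap a b x : trap a b n x @[n --> \oo] --> (\1_(`]a, b[%classic : set R) x : R).
Proof.
have [xab|xab] := boolP (x \in (`]a, b[%classic : set R)); last first.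
  have t0 n : trap a b n x = 0.
    apply/eqP; rewrite eq_le trap_ge0 andbT (le_trans (trap_le_indic _ _ _ _))//.
    by rewrite indicE (negbTE xab).
  by under eq_cvg do rewrite t0; rewrite indicE (negbTE xab); exact: cvg_cst.
apply: cvg_near_cst; rewrite indicE xab.
have m0 : 0 < Num.min (x - a) (b - x).
  by move: xab; rewrite inE/= in_itv/= lt_min !subr_gt0.
near=> n; rewrite /trap.
have n1 : 1 <= n%:R * Num.min (x - a) (b - x).
  by rewrite -ler_pdivrMr// div1r; near: n; exact: nbhs_infty_ger.
by rewrite (min_idPl n1); apply/max_idPr.
Unshelve. all: by end_near. Qed.

Lemma continuous_coord1 : continuous (fun p : heis R => p.1.1 : R).
Proof.
by move=> p; apply: (@cvg_comp _ _ _ (fun p : heis R => p.1) fst _ (nbhs p.1)); exact: cvg_fst.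
Qed.

Lemma continuous_coord2 : continuous (fun p : heis R => p.1.2 : R).
Proof.
move=> p; apply: (@cvg_comp _ _ _ (fun p : heis R => p.1) snd _ (nbhs p.1)); first exact: cvg_fst.
exact: cvg_snd.
Qed.

Lemma continuous_coord3 : continuous (fun p : heis R => p.2 : R).
Proof. by move=> p; exact: cvg_snd. Qed.

Section boxes.
Variable M : R.

(** All lower ends are -M, so the sides are the traces on ]-M, M[ of the rays that generate the
    Borel sets. The full cube serves as integrable dominating function. *)
Definition box (a b c : R) (p : heis R) : R :=
  \1_(`]- M, a[%classic : set R) p.1.1 *
  (\1_(`]- M, b[%classic : set R) p.1.2 * \1_(`]- M, c[%classic : set R) p.2).

Let e := box M M M.

Lemma box_ge0 a b c p : 0 <= box a b c p.
Proof. by rewrite !mulr_ge0. Qed.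

Lemma intg_box : intg haarf e.
Proof.
pose I : set (measurableTypeR R) := `]- M, M[%classic.
have mI : measurable I by exact: measurable_itv.
have mII : measurable (I `*` I) by exact: measurableX.
have eE : e = \1_((I `*` I) `*` I).
  apply/funext => -[[x y] t]; rewrite /e /box !indicE !in_setX/=.
  by do 3 case: (_ \in _); rewrite /= ?(mulr1, mul1r, mul0r, mulr0).
apply/integrableP; split.
  by apply/measurable_EFinP; rewrite eE; apply: measurable_indic; exact: measurableX.
under eq_integral => p _ do rewrite /= ger0_norm ?box_ge0//.
rewrite eE integral_indic//; last exact: measurableX.
rewrite setIT [ltLHS]product_measure1E//.
have IE : (lebesgue_measure I < +oo)%E.
  by rewrite lebesgue_measure_itv/=; case: ifP => _; rewrite ?ltry// -EFinB ltry.
apply: lte_mul_pinfty => //; rewrite [X in X \is a fin_num]product_measure1E//.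
by rewrite fin_numM// ge0_fin_numE.
Qed.

Lemma approximable_box a b c : a <= M -> b <= M -> c <= M -> approximable (box a b c).
Proof.
move=> aM bM cM.
pose g n (p : heis R) := trap (- M) a n p.1.1 * (trap (- M) b n p.1.2 * trap (- M) c n p.2).
have indS (a' x : R) : a' <= M ->
    \1_(`]- M, a'[%classic : set R) x <= \1_(`]- M, M[%classic : set R) x :> R.
  move=> a'M; rewrite !indicE; have [|_] := boolP (x \in `]- M, a'[%classic).
    rewrite inE/= in_itv/= => /andP[x1 x2]; rewrite mem_set//= in_itv/= x1.
    exact: lt_le_trans a'M.
  by case: (_ \in _).
have gle n p : g n p <= e p.
  rewrite /g /e /box; apply: ler_pM; rewrite ?mulr_ge0 ?trap_ge0//.
    by apply: le_trans (trap_le_indic _ _ _ _) (indS _ _ _).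
  apply: ler_pM; rewrite ?trap_ge0//.
    by apply: le_trans (trap_le_indic _ _ _ _) (indS _ _ _).
  by apply: le_trans (trap_le_indic _ _ _ _) (indS _ _ _).
have g0 n p : 0 <= g n p by rewrite !mulr_ge0 ?trap_ge0.
have mtrap a' n (f : heis R -> measurableTypeR R) : measurable_fun setT f ->
    measurable_fun setT (fun p => trap (- M) a' n (f p)).
  by move=> mf; apply: (measurableT_comp (continuous_measurable_fun (@continuous_trap (- M) a' n))).
have mg n : measurable_fun setT (g n).
  apply: measurable_funM.
    by apply: mtrap; do 2 apply: (measurableT_comp measurable_fst).
  apply: measurable_funM; apply: mtrap.
    by apply: (measurableT_comp measurable_snd).
  exact: measurable_snd.
have gi n : intg haarf (g n).
  by apply: (intg_le (g := e)) => //; [exact: intg_box|move=> p; rewrite ger0_norm].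
apply: (@approximable_lim e g _ 1 intg_box).
- move=> n; apply: approximable_refl => //.
  + move=> p; apply: cvgM; last apply: cvgM.
    * apply: (continuous_cvg _ (@continuous_trap _ _ _ _)).
      exact: continuous_coord1.
    * apply: (continuous_cvg _ (@continuous_trap _ _ _ _)).
      exact: continuous_coord2.
    * apply: (continuous_cvg _ (@continuous_trap _ _ _ _)); exact: continuous_coord3.
  + exists M => p gp.
    have : 0 < e p by apply: lt_le_trans (gle n p); rewrite lt_def gp g0.
    rewrite /e /box !indicE -!natrM ltr0n !muln_gt0 !lt0b.
    move=> /and3P[]; rewrite !inE/= !in_itv/= => /andP[? ?] /andP[? ?] /andP[? ?].
    by split; rewrite ler_norml !ltW.
- by move=> n p; rewrite mul1r ger0_norm.
- by move=> p; apply: cvgM; [|apply: cvgM]; exact: cvg_trap.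
Qed.

Let NZ := approximableZ.
Let NB := approximableB.
Let NL (h_ : nat -> heis R -> R) h C : (forall n, approximable (h_ n)) ->
  (forall n p, `|h_ n p| <= C * e p) -> (forall p, h_ ^~ p @ \oo --> h p) ->
  approximable h.
Proof. by move=> *; apply: (@approximable_lim e h_ h C intg_box). Qed.

Let I : set R := `]- M, M[%classic.

Let ind_ray a x : \1_(`]-oo, a[%classic : set R) x * \1_I x =
  \1_(`]- M, Num.min a M[%classic : set R) x :> R.
Proof.
rewrite !indicE -natrM mulnb; congr (nat_of_bool _)%:R.
by rewrite !mem_setE !in_itv/= lt_min andbCA.
Qed.

(** Passes from rays to Borel sets in one coordinate, the others being kept in [w]; used for the
    three coordinates in succession. *)
Let one_coordinate (X : heis R -> R) (w : heis R -> R) :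
  (forall p, `|w p * \1_I (X p)| <= 1 * e p) ->
  (forall a, a <= M -> approximable (fun p => w p * \1_(`]- M, a[%classic : set R) (X p))) ->
  forall A : set R, measurable A -> approximable (fun p => (w p * \1_A (X p)) * \1_I (X p)).
Proof.
move=> we wa A mA.
have := @class_dynkin _ _ approximable e NZ NB NL _ _ X (@RGenInftyO.G R)
  (fun p => w p * \1_I (X p)) 1 _ _ we (wa _ (lexx _)) _ A mA.
move=> H; rewrite (_ : (fun p => _) = fun p => \1_A (X p) * (w p * \1_I (X p))); last first.
  by apply/funext => p; ring.
apply: H.
- exact: RGenInftyO.measurableE.
- move=> _ _ [a ->] [b ->]; exists (Num.min a b).
  by apply/seteqP; split=> x /=; rewrite !in_itv/= lt_min => /andP.
- move=> _ [a ->]; have := wa (Num.min a M); rewrite ge_min lexx orbT => /(_ isT).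
  by congr approximable; apply/funext => p; rewrite -ind_ray; ring.
Qed.

Let rayI a x : a <= M -> \1_(`]- M, a[%classic : set R) x <= \1_I x :> R.
Proof.
move=> aM; rewrite !indicE ler_nat; case E : (x \in _) => //.
rewrite mem_set//; move: E; rewrite mem_setE /I /= !in_itv/= => /andP[-> xa].
exact: lt_le_trans aM.
Qed.

Let setI_le (A : set R) x : \1_A x * \1_I x <= \1_I x :> R.
Proof. by rewrite ler_piMl// indicE; case: (_ \in _). Qed.

Lemma approximable_indic (D : set (heis R)) : measurable D ->
  approximable (fun p => \1_D p * e p).
Proof.
have s1 (A : set R) b c : measurable A -> b <= M -> c <= M ->
    approximable (fun p => (\1_(`]- M, b[%classic : set R) p.1.2 *
      \1_(`]- M, c[%classic : set R) p.2) * \1_A p.1.1 * \1_I p.1.1).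
  move=> mA bM cM; apply: (one_coordinate (X := fun p => p.1.1)
    (w := fun p => \1_(`]- M, b[%classic : set R) p.1.2 * \1_(`]- M, c[%classic : set R) p.2)) =>
      //.
    move=> p; rewrite mul1r ger0_norm ?mulr_ge0// /e /box [leLHS]mulrC.
    apply: ler_pM; rewrite ?mulr_ge0//.
    by apply: ler_pM => //; exact: rayI.
  move=> a aM; have := approximable_box aM bM cM; congr approximable.
  by apply/funext => p; rewrite /box mulrC.
have s2 (A B : set R) c : measurable A -> measurable B -> c <= M ->
    approximable (fun p => (\1_A p.1.1 * \1_I p.1.1 * \1_(`]- M, c[%classic : set R) p.2) *
      \1_B p.1.2 * \1_I p.1.2).
  move=> mA mB cM; apply: (one_coordinate (X := fun p => p.1.2)
    (w := fun p => \1_A p.1.1 * \1_I p.1.1 * \1_(`]- M, c[%classic : set R) p.2)) => //.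
    move=> p; rewrite mul1r ger0_norm ?mulr_ge0// /e /box -(mulrA (\1_A p.1.1 * \1_I p.1.1)).
    apply: ler_pM; rewrite ?mulr_ge0//.
    by rewrite [leLHS]mulrC; apply: ler_pM => //; exact: rayI.
  move=> a aM; have := s1 _ _ _ mA aM cM; congr approximable.
  by apply/funext => p; ring.
have s3 (A B C : set R) : measurable A -> measurable B -> measurable C ->
    approximable (fun p => \1_A p.1.1 * (\1_B p.1.2 * (\1_C p.2 * e p))).
  move=> mA mB mC; rewrite (_ : (fun p => _) = fun p =>
    (\1_A p.1.1 * \1_I p.1.1 * (\1_B p.1.2 * \1_I p.1.2)) * \1_C p.2 * \1_I p.2); last first.
    by apply/funext => p; rewrite /e /box -/I; ring.
  apply: (one_coordinate (X := fun p => p.2)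
    (w := fun p => \1_A p.1.1 * \1_I p.1.1 * (\1_B p.1.2 * \1_I p.1.2))) => //.
    move=> p; rewrite mul1r ger0_norm ?mulr_ge0// /e /box -(mulrA (\1_A p.1.1 * \1_I p.1.1)).
    apply: ler_pM; rewrite ?mulr_ge0//.
    by apply: ler_pM; rewrite ?mulr_ge0//; exact: setI_le.
  move=> a aM; have := s2 _ _ _ mA mB aM; congr approximable.
  by apply/funext => p; ring.
have e1 p : `|e p| <= 1 * e p by rewrite mul1r ger0_norm// box_ge0.
have s4 (S : set (measurableTypeR R * measurableTypeR R)) (C : set R) :
    measurable S -> measurable C ->
    approximable (fun p => \1_S p.1 * (\1_C p.2 * e p)).
  move=> mS mC; have := @class_prod _ _ approximable e NZ NB NL _ _ _ _
    (fun p : heis R => p.1.1) (fun p : heis R => p.1.2) (fun p : heis R => \1_C p.2 * e p) 1 _ _ S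
      mS.
  move=> H; rewrite (_ : (fun p => _) = (fun p : heis R => \1_S (p.1.1, p.1.2) * (\1_C p.2 * e p))).
    apply: H => [p|A B mA mB]; last exact: s3.
    rewrite normrM (le_trans _ (e1 p))// ler_piMl// indicE.
    by case: (_ \in _); rewrite ?normr1 ?normr0.
  by apply/funext => -[[x y] t].
move=> mD; have := @class_prod _ _ approximable e NZ NB NL _ _ _ _
  (fun p : heis R => p.1) (fun p : heis R => p.2) e 1 e1 s4 D mD.
by congr approximable; apply/funext => -[[x y] t].
Qed.

Lemma approximable_ge0_bounded (h : heis R -> R) C : measurable_fun setT h ->
  (forall p, 0 <= h p <= C) -> approximable (fun p => h p * e p).
Proof.
move=> mh hC; apply: (@class_fun _ _ approximable e NZ NB NL _ _ id e C) => //.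
- exact: approximable_indic.
- by move=> p; have /andP[] := hC p.
- move=> p; have /andP[? ?] := hC p.
  by rewrite ger0_norm ?mulr_ge0 ?box_ge0// ler_wpM2r// box_ge0.
Qed.

End boxes.

Lemma approximable_ge0 f : intg haarf f -> (forall p, 0 <= f p) -> approximable f.
Proof.
move=> fi f0; have mf := intg_meas fi.
(* Truncation in height and in space at once: dominated by f, and at each point eventually equal to
   f. *)
apply: (@approximable_lim f (fun n p => Num.min (f p) n.+1%:R * box n.+1%:R n.+1%:R n.+1%:R
  n.+1%:R p) f 1 fi).
- move=> n; apply: (approximable_ge0_bounded n.+1%:R (C := n.+1%:R)) => //.
    by apply: measurable_minr.
  by move=> p; rewrite le_min f0 ge_min lexx orbT ler0n.
- move=> n p; rewrite mul1r normrM -[leRHS]mulr1 ler_pM//.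
    by rewrite ger0_norm ?ge_min ?lexx// le_min f0 ler0n.
  by rewrite ger0_norm ?box_ge0// !mulr_ile1 ?mulr_ge0// indicE; case: (_ \in _).
- move=> p; apply: cvg_near_cst.
  pose m := Num.max (f p) (Num.max `|p.1.1| (Num.max `|p.1.2| `|p.2|)).
  near=> n; have mn : m < n.+1%:R.
    apply: le_lt_trans (_ : n%:R < _); last by rewrite ltr_nat.
    by near: n; exact: nbhs_infty_ger.
  move: mn; rewrite !gt_max !ltr_norml => /and4P[fn /andP[a1 a2] /andP[b1 b2] /andP[c1 c2]].
  rewrite (min_idPl (ltW fn)) /box !indicE !mem_setE !in_itv/= a1 a2 b1 b2 c1 c2.
  by rewrite !mulr1.
Unshelve. all: by end_near. Qed.

Lemma dense_Cc_real f : intg haarf f -> approximable f.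
Proof.
move=> fi; have mf := intg_meas fi.
have P (g : heis R -> R) : intg haarf g -> approximable (fun p => Num.max (g p) 0).
  move=> gi; apply: approximable_ge0 => [|p]; last by rewrite le_max lexx orbT.
  apply: (intg_le _ (intg_norm gi)); first by apply: measurable_maxr => //; exact: intg_meas gi.
  by move=> p; rewrite ger0_norm ?le_max ?lexx ?orbT// ge_max ler_norm normr_ge0.
have := approximableB (P _ fi) (P _ (intgZ (-1) fi)).
congr approximable; apply/funext => p; rewrite mulN1r.
by rewrite /Num.max oppr_lt0; case: ltgtP => [?|?|->]; rewrite ?(sub0r, opprK, subr0).
Qed.

End approximation.

(** * Bounded extensions *)

Section operators.
Context (R : realType) d d' (T : measurableType d) (T' : measurableType d').
Variables (mu : {measure set T -> \bar R}) (nu : {measure set T' -> \bar R}).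

Lemma L1_cintg d0 (X : measurableType d0) (m : {measure set X -> \bar R}) (f : X -> R[i]) :
  L1 m f <-> cintg m f.
Proof. by split=> -[fr fi]; split; apply/Lfun1_integrable. Qed.

Lemma normc_le_ReIm (z : R[i]) : normc z <= `|Re z| + `|Im z|.
Proof.
case: z => u v /=.
have uv : u ^+ 2 + v ^+ 2 <= (`|u| + `|v|) ^+ 2.
  by rewrite sqrrD !real_normK ?num_real// addrAC lerDl mulrn_wge0// mulr_ge0.
by apply: le_trans (ler_wsqrtr uv) _; rewrite sqrtr_sqr ger0_norm// addr_ge0.
Qed.

Lemma L1normE d0 (X : measurableType d0) (m : {measure set X -> \bar R}) (f : X -> R[i]) :
  L1norm m f = (\int[m]_x (normc (f x))%:E)%E.
Proof.
rewrite /L1norm Lnorm1; apply: eq_integral => x _ /=.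
by rewrite ger0_norm// normc_ge0.
Qed.

Lemma measurable_normc d0 (X : measurableType d0) (f : X -> R[i]) : cmeas f ->
  measurable_fun setT (fun x => normc (f x)).
Proof.
move=> [fr fi]; rewrite (_ : (fun x => _) = fun x => Num.sqrt (Re (f x) ^+ 2 + Im (f x) ^+ 2));
  last first.
  by apply/funext => x; case: (f x).
apply: (measurableT_comp (continuous_measurable_fun (@sqrt_continuous R))).
by apply: measurable_funD; exact: measurable_funX.
Qed.

(** For g in [K] close to f, A f - B f equals A (f - g) - B (f - g) almost everywhere, and its norm
    is arbitrarily small. *)
Lemma bounded_operator_agree (K : set (T -> R[i])) A B :
  bounded_operator mu nu A -> bounded_operator mu nu B ->
  (forall g, K g -> A g = B g %[ae nu]) ->
  (forall f, L1 mu f -> forall eps : R, 0 < eps -> exists g, [/\ K g, L1 mu g &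
    (L1norm mu (fun x => f x - g x)%R <= eps%:E)%E]) ->
  forall f, L1 mu f -> A f = B f %[ae nu].
Proof.
move=> [A1 Al [MA Ab]] [B1 Bl [MB Bb]] AB dense f Lf.
pose D y := A f y - B f y.
have cD : cmeas D.
  have [/L1_cintg/cintg_meas mA /L1_cintg/cintg_meas mB] := (A1 _ Lf, B1 _ Lf).
  rewrite (_ : D = fun y => A f y + (-1) * B f y); last first.
    by apply/funext => y; rewrite /D mulN1r.
  by apply: cmeasD => //; apply: cmeasM => //; exact: cmeas_cst.
have mD := measurable_normc cD.
have small eps : 0 < eps -> (\int[nu]_y (normc (D y))%:E <= ((`|MA| + `|MB|) * eps)%:E)%E.
  move=> eps0; have [g [Kg Lg fg]] := dense f Lf _ eps0.
  pose h x := f x - g x.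
  have Lh : L1 mu h.
    apply/L1_cintg; move/L1_cintg : Lf => fi; move/L1_cintg : Lg => gi.
    rewrite (_ : h = fun x => f x + (-1) * g x); last by apply/funext => x; rewrite /h mulN1r.
    by apply: cintgD => //; exact: cintgZ.
  have fE : f = fun x => 1 * h x + g x by apply/funext => x; rewrite mul1r subrK.
  have mAh : measurable_fun setT (fun y => normc (A h y)).
    by apply: measurable_normc; apply: cintg_meas; apply/L1_cintg/A1.
  have mBh : measurable_fun setT (fun y => normc (B h y)).
    by apply: measurable_normc; apply: cintg_meas; apply/L1_cintg/B1.
  apply: (@le_trans _ _ (\int[nu]_y ((normc (A h y))%:E + (normc (B h y))%:E))%E).
    apply: ae_ge0_le_integral => //.
    - by move=> y _; rewrite lee_fin normc_ge0.
    - exact/measurable_EFinP.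
    - by move=> y _; rewrite adde_ge0// lee_fin normc_ge0.
    - by apply: emeasurable_funD; exact/measurable_EFinP.
    - have := Al 1 _ _ Lh Lg; have := Bl 1 _ _ Lh Lg; have := AB _ Kg.
      rewrite -fE; apply: filterS3 => y /(_ Logic.I) ABy /(_ Logic.I) By /(_ Logic.I) Ay _.
      rewrite -EFinD lee_fin /D Ay By ABy !mul1r opprD addrACA subrr addr0.
      by rewrite (le_trans (le_normcD _ _))// normcN.
  rewrite ge0_integralD//; try by move=> y _; rewrite lee_fin normc_ge0.
  - have hN : (0 <= L1norm mu h)%E by rewrite L1normE integral_ge0// => x _;
    rewrite lee_fin normc_ge0.
    have step M (C : (T -> R[i]) -> T' -> R[i]) :
        (L1norm nu (C h) <= M%:E * L1norm mu h)%E ->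
        (\int[nu]_y (normc (C h y))%:E <= (`|M| * eps)%:E)%E.
      rewrite -L1normE => H; apply: le_trans H _.
      rewrite EFinM (@le_trans _ _ (`|M|%:E * L1norm mu h)%E)//.
        by rewrite lee_wpmul2r// lee_fin ler_norm.
      by rewrite lee_wpmul2l.
    rewrite mulrDl EFinD; apply: leeD; first exact: step (Ab _ Lh).
    exact: step (Bb _ Lh).
  - exact/measurable_EFinP.
  - exact/measurable_EFinP.
have D0 : (\int[nu]_y `|(normc (D y))%:E| = 0)%E.
  apply/eqP; rewrite eq_le integral_ge0// andbT.
  have -> : (\int[nu]_y `|(normc (D y))%:E| = \int[nu]_y (normc (D y))%:E)%E.
    by apply: eq_integral => y _; rewrite gee0_abs// lee_fin normc_ge0.
  apply/lee_addgt0Pr => eps eps0; rewrite add0e.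
  have M0 : 0 < `|MA| + `|MB| + 1 by rewrite ltr_wpDl// addr_ge0.
  apply: le_trans (small _ (divr_gt0 eps0 M0)) _.
  by rewrite lee_fin mulrA ler_pdivrMr// mulrC ler_pM2l// lerDl.
have mDE : measurable_fun setT (fun y => (normc (D y))%:E) by exact/measurable_EFinP.
have := (ae_eq_integral_abs nu measurableT mDE).1 D0.
apply: filterS => y /= /(_ Logic.I) [] /ComplexField.Normc.eq0_normc D0y _.
by apply/eqP; rewrite -subr_eq0; apply/eqP.
Qed.

Lemma bounded_extension_eq (K : set (T -> R[i])) A0 : bounded_operator mu nu A0 ->
  (forall f, L1 mu f -> forall eps : R, 0 < eps -> exists g, [/\ K g, L1 mu g &
    (L1norm mu (fun x => f x - g x)%R <= eps%:E)%E]) ->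
  forall f, L1 mu f -> bounded_extension mu nu K A0 f = A0 f %[ae nu].
Proof.
move=> bA dense f Lf.
have [bE EA] : bounded_operator mu nu (bounded_extension mu nu K A0) /\
    forall g, K g -> bounded_extension mu nu K A0 g = A0 g %[ae nu].
  (* [A0] is itself a bounded extension, so the default value of [xget] is not taken. *)
  rewrite /bounded_extension; case: xgetP => [A -> []//|/(_ A0)[]].
  by split=> // g _; exact: aeW.
exact: (bounded_operator_agree bE bA EA dense).
Qed.

End operators.

Section density_Cc.
Variable R : realType.

Lemma compact_support (g : heis R -> R[i]) (M : R) :
  (forall p, g p != 0 -> [/\ `|p.1.1| <= M, `|p.1.2| <= M & `|p.2| <= M]) ->
  compact (closure [set p | g p != 0]).
Proof.
move=> gM; pose I : set R := `[- M, M]%classic.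
have cK : compact ((I `*` I) `*` I : set (heis R)).
  apply: compact_setX; last exact: segment_compact.
  by apply: compact_setX; exact: segment_compact.
have clK : closed ((I `*` I) `*` I : set (heis R)).
  rewrite (_ : _ `*` _ = (fun p : heis R => p.1.1 : R) @^-1` I `&`
    ((fun p : heis R => p.1.2 : R) @^-1` I `&` (fun p : heis R => p.2 : R) @^-1` I)); last first.
    by apply/seteqP; split=> -[[x y] t] /= => [[[? ?] ?]|[? [? ?]]].
  have cI : closed I by exact: interval_closed.
  apply: closedI; first by apply: closed_comp => // p _; exact: continuous_coord1.
  by apply: closedI; apply: closed_comp => // p _;
    [exact: continuous_coord2|exact: continuous_coord3].
apply: (subclosed_compact _ cK); first exact: closed_closure.
have KE := (closure_id _).1 clK; rewrite [X in _ `<=` X]KE; apply: closure_subset.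
move=> -[[x y] t] /gM[/= x1 y1 t1]; rewrite /I /= !in_itv/=.
by rewrite -!ler_norml.
Qed.

Lemma dense_Cc (f : heis R -> R[i]) : L1 (haar R) f -> forall eps : R, 0 < eps ->
  exists g, [/\ Cc g, L1 (haar R) g &
    (L1norm (haar R) (fun x => f x - g x)%R <= eps%:E)%E].
Proof.
move=> /L1_cintg[fr fi] eps eps0.
have e2 : 0 < eps / 2 by rewrite divr_gt0.
have [gr [cgr [M bgr] gri fgr]] := (dense_Cc_real fr).2 _ e2.
have [gi [cgi [N bgi] gii fgi]] := (dense_Cc_real fi).2 _ e2.
exists (fun p => (gr p +i* gi p)%C); split.
- split=> //; apply: (@compact_support _ (Num.max M N)) => p.
  rewrite eq_complex /= negb_and => /orP[/bgr|/bgi] [? ? ?].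
    by split; rewrite le_max; apply/orP; left.
  by split; rewrite le_max; apply/orP; right.
- by apply/L1_cintg; split.
- rewrite L1normE.
  have dr : intg haarf (fun p => `|Re (f p) - gr p|) by apply: intg_norm; exact: intgB.
  have di : intg haarf (fun p => `|Im (f p) - gi p|) by apply: intg_norm; exact: intgB.
  apply: (@le_trans _ _ (\int[haarf]_p (`|Re (f p) - gr p| + `|Im (f p) - gi p|)%:E)%E).
    apply: ge0_le_integral => //.
    + by move=> p _; rewrite lee_fin normc_ge0.
    + apply/measurable_EFinP; apply: measurable_normc.
      rewrite (_ : (fun _ => _) = fun p => f p + (-1) * (gr p +i* gi p)%C); last first.
        by apply/funext => p; rewrite mulN1r.
      apply: cmeasD; first by split; [exact: intg_meas fr|exact: intg_meas fi].
      apply: cmeasM; first exact: cmeas_cst.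
      by split; [exact: intg_meas gri|exact: intg_meas gii].
    + by apply/measurable_EFinP; apply: measurable_funD; [exact: intg_meas dr|exact: intg_meas di].
    + move=> p _; rewrite lee_fin (le_trans (normc_le_ReIm _))// cReB cImB//.
  have -> : (\int[haarf]_p (`|Re (f p) - gr p| + `|Im (f p) - gi p|)%:E)%E =
      (\int[haarf]_p (`|Re (f p) - gr p| + `|Im (f p) - gi p|))%:E.
    by rewrite /Rintegral fineK//; apply: integrable_fin_num => //; exact: intgD.
  by rewrite lee_fin RintegralD// [leRHS]splitr lerD.
Qed.

End density_Cc.

(** * Measures given by a density *)

Section density.
Context (R : realType) d (T : measurableType d).
Variables (m nu : {measure set T -> \bar R}) (D : set T) (w : T -> R).
Hypotheses (mD : measurable D) (mw : measurable_fun setT w).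
Hypothesis w_gt0 : forall y, D y -> 0 < w y.
Hypothesis nuE : forall A, measurable A -> nu A = (\int[m]_(y in A `&` D) (w y)%:E)%E.

Let W y : R := \1_D y * w y.

Let mW : measurable_fun setT W.
Proof. by apply: measurable_funM => //; exact: measurable_indic. Qed.

Let W0 y : 0 <= W y.
Proof.
rewrite /W indicE; case: (pselect (D y)) => Dy; last by rewrite memNset// mul0r.
by rewrite mem_set// mul1r ltW// w_gt0.
Qed.

Import HBNNSimple.

Let nu_indic A : measurable A -> nu A = (\int[m]_y (W y * \1_A y)%:E)%E.
Proof.
move=> mA; rewrite nuE// [LHS]integral_mkcond epatch_indic.
apply: eq_integral => y _ /=; rewrite -EFinM indicI /=; congr EFin.
by rewrite /W; ring.
Qed.

(** [nu] is described only by its values on sets, hence the passage through simple functions and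
    monotone convergence. This treats the measure at one charge and the measure on all geodesics
    together. *)
Lemma integral_density (f : T -> R) : measurable_fun setT f -> (forall y, 0 <= f y) ->
  (\int[nu]_y (f y)%:E = \int[m]_y (\1_D y * w y * f y)%:E)%E.
Proof.
move=> mf f0; have mfE : measurable_fun setT (EFin \o f) by exact/measurable_EFinP.
pose h := nnsfun_approx measurableT mfE.
have hf y : (EFin \o h ^~ y) @ \oo --> (f y)%:E.
  by apply: (@cvg_nnsfun_approx _ _ _ _ _ _ mfE) => // x _; rewrite /= lee_fin.
have nd y a b : (a <= b)%N -> h a y <= h b y.
  by move=> ab; exact/lefP/nd_nnsfun_approx.
have hS n : (\int[nu]_y (h n y)%:E = \int[m]_y (W y * h n y)%:E)%E.
  rewrite integralT_nnsfun sintegralE.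
  transitivity (\sum_(r \in range (h n)) \int[m]_y (W y * (r * \1_(h n @^-1` [set r]) y))%:E)%E.
    apply: eq_fsbigr => r; rewrite inE => -[z _ <-].
    rewrite nu_indic// -ge0_integralZl//.
    - by apply: eq_integral => y _; rewrite -EFinM mulrCA.
    - by apply/measurable_EFinP; apply: measurable_funM.
    - by move=> y _; rewrite lee_fin mulr_ge0.
    - by rewrite lee_fin.
  rewrite -ge0_integral_fsum//.
  - apply: eq_integral => y _; rewrite fsumEFin//; congr EFin.
    by rewrite [in RHS]fimfunE mulr_fsumr.
  - move=> r; apply/measurable_EFinP; apply: measurable_funM => //.
    by apply: measurable_funM.
  - move=> r y _; rewrite EFinM mule_ge0 ?lee_fin//; exact: nnfun_muleindic_ge0.
have l1 : (\int[nu]_y (h n y)%:E)%E @[n --> \oo] --> (\int[nu]_y (f y)%:E)%E.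
  have := @cvg_monotone_convergence _ _ _ nu setT measurableT (fun n => EFin \o h n).
  rewrite (_ : (fun y => limn _) = EFin \o f); last first.
    by apply/funext => y; apply/cvg_lim => //; exact: hf.
  apply.
  - by move=> n; exact/measurable_EFinP.
  - by move=> n y _; rewrite /= lee_fin.
  - by move=> y _ a b ab; rewrite /= lee_fin nd.
have l2 : (\int[m]_y (W y * h n y)%:E)%E @[n --> \oo] --> (\int[m]_y (W y * f y)%:E)%E.
  have := @cvg_monotone_convergence _ _ _ m setT measurableT (fun n y => (W y * h n y)%:E).
  rewrite (_ : (fun y => limn _) = fun y => (W y * f y)%:E); last first.
    apply/funext => y; apply/cvg_lim => //.
    apply: cvg_EFin; first exact: nearW.
    by apply: cvgM; [exact: cvg_cst|exact: (fine_cvg (hf y))].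
  apply.
  - by move=> n; apply/measurable_EFinP; apply: measurable_funM.
  - by move=> n y _; rewrite lee_fin mulr_ge0.
  - by move=> y _ a b ab; rewrite lee_fin ler_wpM2l// nd.
rewrite (funext hS) in l1.
exact: cvg_unique l1 l2.
Qed.

(** As w > 0 on D, a set is null for [nu] exactly when its part in D is null for [m]. *)
Lemma ae_density (P : T -> Prop) :
  {ae nu, forall y, P y} <-> {ae m, forall y, D y -> P y}.
Proof.
split=> [[N [mN N0 NP]]|[N [mN N0 NP]]].
- have /eqP : (\int[m]_(y in N `&` D) `|(w y)%:E|)%E = 0%E.
    rewrite -[RHS]N0 nuE//; apply: eq_integral => y /[!inE] -[_ /w_gt0/ltW wy].
    by rewrite gee0_abs// lee_fin.
  have mND : measurable (N `&` D) by exact: measurableI.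
  have mwE : measurable_fun (N `&` D) (EFin \o w) by apply/measurable_funTS/measurable_EFinP.
  move=> /eqP /(ae_eq_integral_abs m mND mwE).1.
  apply: filterS => y H Dy; apply: contrapT => nP.
  have Ny : N y by apply: NP.
  by have := H (conj Ny Dy) => -[] w0; move: (w_gt0 Dy); rewrite w0 ltxx.
- exists (N `|` ~` D); split.
  + by apply: measurableU => //; exact: measurableC.
  + rewrite nuE; last by apply: measurableU => //; exact: measurableC.
    have ND : (N `|` ~` D) `&` D `<=` N by move=> y [[//|nD Dy]]; exfalso; exact: nD.
    have mND : measurable ((N `|` ~` D) `&` D).
      by apply: measurableI => //; apply: measurableU => //; exact: measurableC.
    apply: null_set_integral => //; first exact/measurable_funTS/measurable_EFinP.
    exact: (subset_measure0 mND mN ND).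
  + move=> y nP; case: (pselect (D y)) => Dy; last by right.
    by left; apply: NP => /(_ Dy).
Qed.

End density.

(** * Integration along a family of curves as a bounded operator *)

Section line_integrals.
Context (R : realType) d d' (T : measurableType d) (T' : measurableType d').
Variables (mu : {measure set T -> \bar R}) (m : {sigma_finite_measure set T' -> \bar R}).
Variables (nu : {measure set T' -> \bar R}) (D : set T') (w : T' -> R).
Hypotheses (mD : measurable D) (mw : measurable_fun setT w).
Hypothesis w_gt0 : forall y, D y -> 0 < w y.
Hypothesis nuE : forall A, measurable A -> nu A = (\int[m]_(y in A `&` D) (w y)%:E)%E.
Local Notation leb := (@lebesgue_measure R).
Variables (phi : T' * measurableTypeR R -> T) (C : R).
Hypothesis C_ge0 : 0 <= C.
Implicit Type F : T -> R.
Hypothesis mphi : measurable_fun setT phi.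
Hypothesis mass : forall F : T -> R, measurable_fun setT F -> (forall p, 0 <= F p) ->
  (\int[m \x leb]_z (\1_D z.1 * w z.1 * F (phi z))%:E <= C%:E * \int[mu]_p (F p)%:E)%E.

Definition line_integral (F : T -> R) y := \int[leb]_s F (phi (y, s)).

Let W y : R := \1_D y * w y.

Let mW : measurable_fun setT W.
Proof. by apply: measurable_funM => //; exact: measurable_indic. Qed.

Let W0 y : 0 <= W y.
Proof.
rewrite /W indicE; case: (pselect (D y)) => Dy; last by rewrite memNset// mul0r.
by rewrite mem_set// mul1r ltW// w_gt0.
Qed.

Let mline F y : measurable_fun setT F -> measurable_fun setT (fun s : measurableTypeR R => F (phi
  (y, s))).
Proof.
by move=> mF; apply: (measurableT_comp mF); apply: (measurableT_comp mphi); exact: pair1_measurable.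
Qed.

Let mtotal F : measurable_fun setT F -> measurable_fun setT (F \o phi).
Proof. by move=> mF; exact: measurableT_comp. Qed.

Lemma measurable_line_integral F : measurable_fun setT F ->
  measurable_fun setT (line_integral F).
Proof.
move=> mF; have mFE : measurable_fun setT (EFin \o (F \o phi)) by apply/measurable_EFinP;
  exact: mtotal.
apply: (measurableT_comp (f := fine)); first exact: fine_measurable.
(* [F] is only measurable here, so Tonelli is applied to its positive and negative parts. *)
rewrite (_ : (fun y => _) = fun y => (\int[leb]_s (EFin \o (F \o phi))^\+ (y, s) -
    \int[leb]_s (EFin \o (F \o phi))^\- (y, s))%E); last first.
  by apply/funext => y; rewrite integralE; congr (_ - _)%E; apply: eq_integral => s _;
    rewrite ?funeposE ?funenegE.
apply: emeasurable_funB.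
  apply: (measurable_fun_fubini_tonelli_F (m2 := leb) (EFin \o (F \o phi))^\+%E) => //.
  exact: measurable_funepos.
apply: (measurable_fun_fubini_tonelli_F (m2 := leb) (EFin \o (F \o phi))^\-%E) => //.
exact: measurable_funeneg.
Qed.

Lemma line_integral_mass F : measurable_fun setT F ->
  (\int[nu]_y `|line_integral F y|%:E <= C%:E * \int[mu]_p `|F p|%:E)%E.
Proof.
move=> mF; have mL := measurable_line_integral mF.
rewrite (@integral_density _ _ _ m nu D w mD mw w_gt0 nuE (fun y => `|line_integral F y|))//;
  last first.
  exact: measurableT_comp.
have mnF : measurable_fun setT (fun p => `|F p|) by exact: measurableT_comp.
apply: le_trans (mass mnF _) => //.
have mG : measurable_fun setT (fun z : T' * measurableTypeR R => (W z.1 * `|F (phi z)|)%:E).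
  apply/measurable_EFinP; apply: measurable_funM.
    exact: (measurableT_comp mW measurable_fst).
  exact: (mtotal mnF).
rewrite (@fubini_tonelli1 _ _ _ _ _ m leb)//; last first.
  by move=> z; rewrite lee_fin mulr_ge0//; exact: W0.
apply: ge0_le_integral => //.
- by move=> y _; rewrite lee_fin mulr_ge0//; exact: W0.
- by apply/measurable_EFinP; apply: measurable_funM => //; exact: measurableT_comp.
- apply: measurable_fun_fubini_tonelli_F => // z; rewrite lee_fin mulr_ge0//; exact: W0.
- move=> y _; rewrite /fubini_F /= EFinM.
  under eq_integral do rewrite EFinM.
  rewrite ge0_integralZl//; first last.
  + by rewrite lee_fin; exact: W0.
  + by apply/measurable_EFinP; exact: (mline _ mnF).
  rewrite lee_wpmul2l//; first by rewrite lee_fin; exact: W0.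
  have mFE : measurable_fun setT (fun s : measurableTypeR R => (F (phi (y, s)))%:E).
    by apply/measurable_EFinP; exact: mline.
  apply: le_trans (le_abse_integral leb measurableT mFE).
  (* If the integral is infinite, [fine] returns 0 and the inequality still holds. *)
  by rewrite /line_integral /Rintegral; case: (\int[leb]_s _)%E => [r| |] //=; rewrite normr0 leey.
Qed.

Lemma line_integrable F : intg mu F -> intg nu (line_integral F).
Proof.
move=> Fi; have mF := intg_meas Fi; apply/integrableP; split.
  by apply/measurable_EFinP; exact: measurable_line_integral.
apply: le_lt_trans (line_integral_mass mF) _.
move: Fi => /integrableP[_ Foo]; by rewrite lte_mul_pinfty//.
Qed.

Lemma ae_line_integrable F : intg mu F ->
  {ae m, forall y, D y -> intg leb (fun s => F (phi (y, s)))}.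
Proof.
move=> /integrableP[/measurable_EFinP mF Foo].
have : (m \x leb)%E.-integrable setT (fun z => (W z.1 * F (phi z))%:E).
  apply/integrableP; split.
    apply/measurable_EFinP; apply: measurable_funM; last exact: mtotal.
    exact: (measurableT_comp mW measurable_fst).
  have -> : (\int[m \x leb]_z `|(W z.1 * F (phi z))%:E| =
      \int[m \x leb]_z (\1_D z.1 * w z.1 * `|F (phi z)|)%:E)%E.
    by apply: eq_integral => z _; rewrite /= normrM ger0_norm// W0.
  apply: (@le_lt_trans _ _ (C%:E * \int[mu]_p `|F p|%:E)%E).
    by apply: (@mass (fun p => `|F p|)) => //; exact: measurableT_comp.
  by rewrite lte_mul_pinfty//.
move=> /(@ae_integrable1 _ _ _ _ _ m leb).
apply: filterS => y H Dy.
have Wy : W y != 0 by rewrite /W indicE mem_set// mul1r gt_eqF// w_gt0.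
have := intgZ (W y)^-1 H.
by apply: eq_integrable => // s _ /=; rewrite mulKf.
Qed.

Definition cline_integral (f : T -> R[i]) y : R[i] := cint leb (fun s => f (phi (y, s))).

Lemma ae_line_cintg f : cintg mu f ->
  {ae m, forall y, D y -> cintg leb (fun s => f (phi (y, s)))}.
Proof.
move=> [fr fi]; have := ae_line_integrable fi; have := ae_line_integrable fr.
apply: filterS2 => y fry fiy Dy; split; [exact: (fry Dy)|exact: (fiy Dy)].
Qed.

Lemma bounded_line_integral : bounded_operator mu nu cline_integral.
Proof.
split.
- move=> f /L1_cintg[fr fi]; apply/L1_cintg; split;
  [exact: (line_integrable fr)|exact: (line_integrable fi)].
- move=> a f g /L1_cintg fi /L1_cintg gi.
  apply/(ae_density mD mw w_gt0 nuE).
  (* Linearity may fail on curves along which an integral is not defined and a default value is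
     taken; these form a null set. *)
  have := ae_line_cintg gi; have := ae_line_cintg fi.
  apply: filterS2 => y fy gy Dy _; have {}fy := fy Dy; have {}gy := gy Dy.
  rewrite /cline_integral (cintD (f := fun s => a * f (phi (y, s))))//; last exact: cintgZ.
  by rewrite cintZ.
(* The factor 2 comes from bounding the real and the imaginary part separately. *)
- exists (C * 2) => f /L1_cintg[fr fi]; rewrite !L1normE.
  have [mr mi] := (measurable_line_integral (intg_meas fr), measurable_line_integral (intg_meas
    fi)).
  apply: (@le_trans _ _ (\int[nu]_y (`|line_integral (fun p => Re (f p)) y|%:E +
      `|line_integral (fun p => Im (f p)) y|%:E))%E).
    apply: ge0_le_integral => //.
    + by move=> p _; rewrite lee_fin normc_ge0.
    + by apply/measurable_EFinP; apply: measurable_normc.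
    + by apply: emeasurable_funD; apply/measurable_EFinP; exact: measurableT_comp.
    + by move=> y _; rewrite -EFinD lee_fin normc_le_ReIm.
  rewrite ge0_integralD//; try by apply/measurable_EFinP; exact: measurableT_comp.
  apply: le_trans (leeD (line_integral_mass (intg_meas fr)) (line_integral_mass (intg_meas fi))) _.
  rewrite -ge0_muleDr ?integral_ge0// EFinM -muleA lee_wpmul2l//.
  have mn : measurable_fun setT (fun p => (normc (f p))%:E).
    by apply/measurable_EFinP; apply: measurable_normc; split;
      [exact: intg_meas fr|exact: intg_meas fi].
  rewrite mule_natl mule2n; apply: leeD; apply: ge0_le_integral => //.
  - by apply/measurable_EFinP; apply: measurableT_comp => //; exact: intg_meas fr.
  - by move=> p _; rewrite lee_fin normc_re.
  - by apply/measurable_EFinP; apply: measurableT_comp => //; exact: intg_meas fi.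
  - by move=> p _; rewrite lee_fin normc_im.
Qed.

End line_integrals.

(** * The two X-ray transforms as bounded operators *)

Section xray_operators.
Variable R : realType.
Local Notation leb := (@lebesgue_measure R).

(** The weight l of the measure cancels the length 2 pi / l of a turn, which gives the mass constant
    2 pi for every charge. *)
Lemma bounded_xray_at (l : {posnum R}) :
  bounded_operator (haar R) (Glam_measure l) (geod_integral l%:num).
Proof.
have l0 : 0 < l%:num by [].
apply: (@bounded_line_integral _ _ _ _ _ _ haarf (Glam_measure l) (Glam_dom l%:num)
  (fun=> l%:num) _ _ _ _ (flow l%:num) (2 * pi)) => //.
- exact: measurable_Glam_dom.
- move=> A mA; rewrite integral_cst//; apply: measurableI => //; exact: measurable_Glam_dom.
- by rewrite mulr_ge0// pi_ge0.
- exact: measurable_flow.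
- move=> F mF F0.
  have := @tube_mass R l%:num l0 (fun p => l%:num * F p) (measurable_funM (measurable_cst _) mF).
  move=> H; rewrite (_ : (fun z => _) = fun z : heis R * measurableTypeR R =>
      (\1_(Glam_dom l%:num) z.1 * (l%:num * F (flow l%:num z)))%:E); last first.
    by apply/funext => z; rewrite mulrA.
  rewrite H; last by move=> p; rewrite mulr_ge0.
  rewrite (_ : \int[haarf]_p _ = l%:num%:E * \int[haarf]_p (F p)%:E)%E; last first.
    rewrite -ge0_integralZl//; last by move=> p _; rewrite lee_fin.
    exact/measurable_EFinP.
  by rewrite muleA -EFinM mulrAC mulVf// mul1r.
Qed.

Lemma measurable_invr : measurable_fun setT (fun x : measurableTypeR R => x^-1 : measurableTypeR R).
Proof.
have oA : open [set~ (0 : R)] by apply: closed_openC; exact: closed_eq.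
rewrite -(setUv [set (0 : R)]) measurable_funU//; last first.
  by apply: measurableC; exact: measurable_set1.
split; first exact: measurable_fun_set1.
apply: open_continuous_measurable_fun => //.
move=> x /set_mem /= /eqP x0.
exact: inv_continuous.
Qed.

Definition gspace : set (heis R * measurableTypeR R) -> \bar R := (haarf \x leb)%E.

HB.instance Definition _ := Measure.on gspace.

HB.instance Definition _ := @Measure_isSigmaFinite.Build _ _ _ gspace
  (product_sigma_finite haarf leb).

Definition gflow (z : heis R * measurableTypeR R * measurableTypeR R) : heis R :=
  heis_mul z.1.1 (geod z.1.2 z.2).

Lemma measurable_gflow : measurable_fun setT gflow.
Proof.
have m1 : measurable_fun setT (fun z : heis R * measurableTypeR R * measurableTypeR R => z.1.2).
  exact: (measurableT_comp measurable_snd measurable_fst).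
have m2 : measurable_fun setT (fun z : heis R * measurableTypeR R * measurableTypeR R => z.2).
  exact: measurable_snd.
apply: measurable_heis_mul; first exact: (measurableT_comp measurable_fst measurable_fst).
have mi := measurableT_comp measurable_invr m1.
have md : measurable_fun setT (fun z : heis R * measurableTypeR R * measurableTypeR R => z.2 /
  z.1.2^-1).
  by apply: measurable_funM => //; exact: (measurableT_comp measurable_invr).
apply: measurable_fun_triple.
- apply: measurable_funM => //.
  exact: (measurableT_comp (continuous_measurable_fun (@continuous_cos R)) md).
- apply: measurable_funM => //.
  exact: (measurableT_comp (continuous_measurable_fun (@continuous_sin R)) md).
- by apply: measurable_funM => //; apply: measurable_funM.
Qed.

Lemma measurable_G_weightT : measurable_fun setT (@G_weight R).
Proof.
apply: measurable_funM; first exact: measurable_snd.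
by apply: measurableT_comp => //; exact: measurableT_comp.
Qed.

(** At charge l the weight l e^(-l) meets the turn length 2 pi / l and leaves 2 pi e^(-l); the
    exponential density has total mass 1. *)
Lemma gflow_mass (F : heis R -> R) : measurable_fun setT F -> (forall p, 0 <= F p) ->
  (\int[gspace \x leb]_z (\1_(@G_dom R) z.1 * G_weight z.1 * F (gflow z))%:E <=
   (2 * pi)%:E * \int[haarf]_p (F p)%:E)%E.
Proof.
move=> mF F0.
have W0 y : 0 <= \1_(@G_dom R) y * G_weight y.
  rewrite indicE; case: (pselect (G_dom y)) => Dy; last by rewrite memNset// mul0r.
  by rewrite mem_set// mul1r; exact: G_weight_ge0.
pose H (z : heis R * measurableTypeR R * measurableTypeR R) : \bar R :=
  (\1_(@G_dom R) z.1 * G_weight z.1 * F (gflow z))%:E.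
have H0 z : (0 <= H z)%E by rewrite lee_fin mulr_ge0.
have mH : measurable_fun setT H.
  have mW : measurable_fun setT (fun q => \1_(@G_dom R) q * G_weight q).
    apply: measurable_funM; last exact: measurable_G_weightT.
    by apply: measurable_indic; exact: measurable_G_dom.
  apply/measurable_EFinP; apply: measurable_funM;
    last exact: (measurableT_comp mF measurable_gflow).
  exact: (measurableT_comp mW measurable_fst).
have mK := measurable_fun_fubini_tonelli_F (m2 := leb) H mH H0.
have K0 q : (0 <= fubini_F leb H q)%E by apply: integral_ge0 => s _; exact: H0.
have c0 : (0 <= \int[haarf]_p (F p)%:E)%E by apply: integral_ge0 => p _; rewrite lee_fin.
rewrite (fubini_tonelli1 (m1 := gspace) (m2 := leb) H mH H0).
rewrite [leLHS](fubini_tonelli2 (m1 := haarf) (m2 := leb) _ mK K0).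
apply: (@le_trans _ _ (\int[leb]_l ((exponential_pdf 1 l)%:E * ((2 * pi)%:E * \int[haarf]_p (F
  p)%:E)))%E).
  apply: ge0_le_integral => //.
  - by move=> l _; apply: integral_ge0.
  - exact: (measurable_fun_fubini_tonelli_G (m1 := haarf) _ mK K0).
  - by apply: emeasurable_funM => //; apply/measurable_EFinP; exact: measurable_exponential_pdf.
  - move=> l _; rewrite /fubini_G /fubini_F.
    have sl : measurable_fun setT (fun z : heis R * measurableTypeR R => H ((z.1, l), z.2)).
      have mf : measurable_fun setT (fun z : heis R * measurableTypeR R => z.1)
        by exact: measurable_fst.
      have ms : measurable_fun setT (fun z : heis R * measurableTypeR R => z.2)
        by exact: measurable_snd.
      exact: (measurableT_comp mH (measurable_fun_pair
        (measurable_fun_pair mf (measurable_cst (l : measurableTypeR R))) ms)).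
    rewrite -(fubini_tonelli1 (m1 := haarf) (m2 := leb) (fun z => H ((z.1, l), z.2)) sl)//.
    have [l0|l0] := ltP 0 l; last first.
      rewrite integral0_eq; last first.
        move=> z _; rewrite /H indicE memNset ?mul0r// => -[/=].
        by rewrite ltNge l0.
      by rewrite mule_ge0// ?mule_ge0// lee_fin ?mulr_ge0 ?pi_ge0// exponential_pdf_ge0.
    have E := tube_mass l0 (measurable_funM (measurable_cst (l * expR (- l))) mF).
    rewrite (_ : (fun z => H _) = fun z => (\1_(Glam_dom l) z.1 * (l * expR (- l) * F (flow l
      z)))%:E); last first.
      apply/funext => z; rewrite /H /G_weight /gflow /flow /=; congr EFin; rewrite [RHS]mulrA;
        congr (_ * _ * _).
      rewrite !indicE; congr (nat_of_bool _)%:R; apply/idP/idP; rewrite !inE => //.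
      by case.
    rewrite E; last by move=> p; rewrite mulr_ge0// mulr_ge0 ?expR_ge0// ltW.
    rewrite (_ : \int[haarf]_p _ = (l * expR (- l))%:E * \int[haarf]_p (F p)%:E)%E; last first.
      rewrite -ge0_integralZl//.
      + exact/measurable_EFinP.
      + by move=> p _; rewrite lee_fin.
      + by rewrite lee_fin mulr_ge0 ?expR_ge0// ltW.
    rewrite !muleA -!EFinM (exponential_pdfE 1 (ltW l0)) mul1r mulN1r.
    rewrite (_ : l^-1 * (2 * pi) * (l * expR (- l)) = expR (- l) * (2 * pi))//.
    by rewrite mulrACA mulVf ?gt_eqF// mul1r mulrC.
rewrite ge0_integralZr//.
  by rewrite integral_exponential_pdf// mul1e.
- by apply/measurable_EFinP; exact: measurable_exponential_pdf.
- by move=> l _; rewrite lee_fin exponential_pdf_ge0.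
- by rewrite mule_ge0// lee_fin mulr_ge0 ?pi_ge0.
Qed.

Lemma bounded_xray :
  bounded_operator (haar R) (G_measure R) (fun f q => geod_integral q.2 f q.1).
Proof.
apply: (@bounded_line_integral _ _ _ _ _ _ gspace (G_measure R) (@G_dom R)
  (@G_weight R) _ _ _ _ gflow (2 * pi)) => //.
- exact: measurable_G_dom.
- exact: measurable_G_weightT.
- by move=> q [q0 _]; rewrite mulr_gt0// expR_gt0.
- by rewrite mulr_ge0// pi_ge0.
- exact: measurable_gflow.
- exact: gflow_mass.
Qed.

Lemma ae_G_measure (P : heis R * measurableTypeR R -> Prop) :
  {ae G_measure R, forall q, P q} -> {ae gspace, forall q, G_dom q -> P q}.
Proof.
apply: (@ae_density _ _ _ gspace (G_measure R) (@G_dom R) (@G_weight R) _ _ _ _ P).1 => //.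
- exact: measurable_G_dom.
- exact: measurable_G_weightT.
- by move=> q [q0 _]; rewrite mulr_gt0// expR_gt0.
Qed.

Lemma ae_Glam_measure (l : {posnum R}) (P : heis R -> Prop) :
  {ae Glam_measure l, forall p, P p} -> {ae haarf, forall p, Glam_dom l%:num p -> P p}.
Proof.
apply: (@ae_density _ _ _ haarf (Glam_measure l) (Glam_dom l%:num) (fun=> l%:num) _ _ _ _ P).1 =>
  //.
- exact: measurable_Glam_dom.
- move=> A mA; rewrite integral_cst//; apply: measurableI => //; exact: measurable_Glam_dom.
Qed.

End xray_operators.

(** * Injectivity *)

Section null_slices.
Context d1 d2 (T1 : measurableType d1) (T2 : measurableType d2) (R : realType).
Variables (m1 : {sigma_finite_measure set T1 -> \bar R})
  (m2 : {sigma_finite_measure set T2 -> \bar R}).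

Lemma ae_slices (P : T1 * T2 -> Prop) : {ae (m1 \x m2)%E, forall z, P z} ->
  {ae m2, forall y, {ae m1, forall x, P (x, y)}}.
Proof.
move=> [N [mN N0 NP]].
have mY : measurable_fun setT (fun y => m1 (ysection N y)) by exact: measurable_fun_ysection.
have : (\int[m2]_y `|m1 (ysection N y)| = 0)%E.
  rewrite -[RHS]N0 [RHS](product_measureC m1 m2 mN).
  by apply: eq_integral => y _; rewrite gee0_abs.
move=> /(ae_eq_integral_abs m2 measurableT mY).1; apply: filterS => y /(_ Logic.I) Ny.
exists (ysection N y); split => //.
  exact: measurable_ysection.
by move=> x nP; rewrite /ysection /= inE; apply: NP.
Qed.

End null_slices.

Section injectivity.
Variable R : realType.
Local Notation leb := (@lebesgue_measure R).

Lemma ae_meets_interval (P : measurableTypeR R -> Prop) (al be : R) : al < be ->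
  {ae leb, forall l, P l} -> exists2 l, al < l < be & P l.
Proof.
move=> albe [N [mN N0 NP]]; apply: contrapT => nex.
have sub : `]al, be[%classic `<=` N.
  move=> l; rewrite /= in_itv/= => lab; apply: NP => Pl; apply: nex; exists l => //.
have mI : measurable (`]al, be[%classic : set (measurableTypeR R)) by exact: measurable_itv.
have := @subset_measure0 _ _ _ leb _ _ mI mN sub N0.
have E : leb `]al, be[%classic = (be - al)%:E.
  by rewrite [LHS]lebesgue_measure_itv/= lte_fin albe.
by move=> /(etrans (esym E))[] /eqP; rewrite subr_eq0 gt_eqF.
Qed.

Lemma dense_charges_inj (f : heis R -> R[i]) (eta : R) : cintg haarf f -> 0 < eta ->
  (forall al be, 0 < al -> al < be -> be <= eta -> exists2 l, al < l < be &
    {ae haarf, forall p, Glam_dom l p -> geod_integral l f p = 0}) ->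
  {ae haarf, forall p, f p = 0}.
Proof.
move=> [fr fi] eta0 dense.
have r0 : {ae haarf, forall p, Re (f p) = 0}.
  apply: (ae_zero fr) => tau a1 a2 n; apply: (all_moments_zero fr eta0).
  move=> al be al0 albe bee; have [l lab H] := dense al be al0 albe bee.
  by exists l => //; apply: filterS H => p H /H [].
have i0 : {ae haarf, forall p, Im (f p) = 0}.
  apply: (ae_zero fi) => tau a1 a2 n; apply: (all_moments_zero fi eta0).
  move=> al be al0 albe bee; have [l lab H] := dense al be al0 albe bee.
  by exists l => //; apply: filterS H => p H /H [].
by move: r0 i0; apply: filterS2 => p r i; apply/eqP; rewrite eq_complex r i /= eqxx.
Qed.

End injectivity.

Theorem theorem1 (R : realType) :
  (forall f g : heis R -> R[i], L1 (haar R) f -> L1 (haar R) g ->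
     xray f = xray g %[ae G_measure R] -> f = g %[ae haar R]) /\
  (forall f : heis R -> R[i], L1 (haar R) f ->
     (exists2 eta : R, 0 < eta & forall l : {posnum R}, l%:num < eta ->
        xray_at l f = (fun=> 0) %[ae Glam_measure l]) ->
     f = (fun=> 0) %[ae haar R]).
Proof.
split=> [f g Lf Lg fg|f Lf [eta eta0 f0]].
- have [_ lin _] := bounded_xray R.
  have L := lin (-1) _ _ Lg Lf.
  have Ef := bounded_extension_eq (@bounded_xray R) (@dense_Cc R) Lf.
  have Eg := bounded_extension_eq (@bounded_xray R) (@dense_Cc R) Lg.
  (* The difference in the form a f + g of the linearity clause, so that its line integrals split
     almost everywhere. *)
  pose h p := -1 * g p + f p.
  have h0 : {ae G_measure R, forall q, geod_integral q.2 h q.1 = 0}.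
    have E : {ae G_measure R, forall q, geod_integral q.2 f q.1 = geod_integral q.2 g q.1}.
      move: Ef Eg fg; apply: filterS3 => q /(_ Logic.I) a /(_ Logic.I) b /(_ Logic.I).
      by rewrite /xray a b.
    move: L E; apply: filterS2 => q /(_ Logic.I) -> ->.
    by rewrite mulN1r addNr.
  have Hl := ae_slices (m1 := haarf) (m2 := @lebesgue_measure R) (ae_G_measure h0).
  have hi : cintg haarf h.
    by apply: cintgD; [apply: cintgZ|]; apply/L1_cintg.
  have : {ae haarf, forall p, h p = 0}.
    (* The bound 1 on the charges is arbitrary: almost every charge is good, so good charges are
       dense in the whole half-line. *)
    apply: (dense_charges_inj hi ltr01) => al be al0 albe _.
    have [l lab Pl] := ae_meets_interval albe Hl; exists l => //.
    move: Pl; apply: filterS => p + pl; apply; split=> //=.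
    by apply: lt_trans al0 _; case/andP: lab.
  apply: filterS => p + _; rewrite /h mulN1r addrC => /eqP.
  by rewrite subr_eq0 => /eqP.
- have : {ae haarf, forall p, f p = 0}.
    apply: (dense_charges_inj ((L1_cintg _ _).1 Lf) eta0) => al be al0 albe bee.
    have [l1 l2] := midf_lt albe.
    (* Every positive charge below eta is good; the midpoint is one, since be <= eta. *)
    exists ((al + be) / 2); first by rewrite l1.
    have l0 : 0 < (al + be) / 2 by exact: lt_trans al0 l1.
    have := f0 (PosNum l0) (lt_le_trans l2 bee).
    have := bounded_extension_eq (@bounded_xray_at R (PosNum l0)) (@dense_Cc R) Lf.
    move=> E Z; apply: (@ae_Glam_measure _ (PosNum l0)).
    by move: E Z; apply: filterS2 => p /(_ Logic.I) + /(_ Logic.I); rewrite /xray_at => ->.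
  by apply: filterS.
Qed.
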